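(* Let $V$ be an $n$-dimensional complex vector space, let $W\subset\mathrm{GL}(V)$ be a finite complex reflection group, and let $U_k(W)=eH_k(W)e$ be the spherical subalgebra of the rational Cherednik algebra $H_k(W)$ (defined in the context). Then $\mathrm{Frac}(U_k(W))\cong F_n$, where $F_n$ is the skew field of fractions of the $n$-th Weyl algebra over $\mathbb{C}$.
   Context: A complex reflection is a non-identity element of $\mathrm{GL}(V)$ acting as the identity on some hyperplane; $W$ is a finite group generated by complex reflections. Let $(\cdot,\cdot)$ be a $W$-invariant positive definite Hermitian form on $V$, antilinear in the first argument and linear in the second; for $x\in V$ let $x^*\in V^*$ be the linear form $v\mapsto (x,v)$. Let $\mathcal{A}$ be the set of reflection hyperplanes of $W$; $W$ permutes $\mathcal{A}$. For $H\in\mathcal{A}$, the pointwise stabilizer $W_H$ of $H$ in $W$ is cyclic, of order denoted $n_H$; let $\alpha_H\in V^*$ be a linear form with zero set $H$, and let $v_H\in V$ be such that $\alpha_H=v_H^*$. Set $$e_{H,i}=\frac{1}{n_H}\sum_{w\in W_H}(\det w)^{-i}w\in\mathbb{C}W_H .$$ For each $H\in\mathcal{A}$ fix a sequence of non-negative integers $k_H=\{k_{H,i}\}_{i=0}^{n_H-1}$ such that $k_H=k_{H'}$ whenever $H$ and $H'$ lie in the same $W$-orbit in $\mathcal{A}$; the index $i$ is read modulo $n_H$ (so $k_{H,n_H}=k_{H,0}$). The rational Cherednik algebra $H_k=H_k(W)$ is the associative $\mathbb{C}$-algebra generated by $x\in V^*$, $\xi\in V$ and $w\in W$ (linearly in $x$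 and in $\xi$, and with the group relations of $W$) subject to $$[x,x']=0,\quad [\xi,\xi']=0,\quad wxw^{-1}=w(x),\quad w\xi w^{-1}=w(\xi),$$ $$[\xi,x]=\langle\xi,x\rangle+\sum_{H\in\mathcal{A}}\frac{\langle\alpha_H,\xi\rangle\,\langle x,v_H\rangle}{\langle\alpha_H,v_H\rangle}\sum_{i=0}^{n_H-1}n_H\,(k_{H,i}-k_{H,i+1})\,e_{H,i},$$ where $\langle\cdot,\cdot\rangle$ is the natural pairing of $V$ and $V^*$. Let $e=|W|^{-1}\sum_{w\in W}w\in\mathbb{C}W\subset H_k$; the spherical subalgebra is $U_k(W)=eH_ke$ (with unit $e$). $\mathrm{Frac}$ denotes the skew field of fractions. *)

(* Defs.v *)
From HB Require Import structures.
From mathcomp Require Import all_boot all_order all_fingroup all_algebra.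
From mathcomp Require Import generic_quotient boolp reals complex.
From mathcomp.multinomials Require Import monalg.

Set Implicit Arguments.
Unset Strict Implicit.
Unset Printing Implicit Defensive.

Import Order.TTheory GRing.Theory Num.Theory.

Local Open Scope ring_scope.
Local Open Scope quotient_scope.

(* An algebra over K is a ring A with a ring morphism from K to the center of *)
(* A.  Unlike [algType], this allows the zero ring, because an algebra given  *)
(* by generators and relations may be zero.                                   *)
HB.mixin Record hasCentralScalars (K : pzRingType) A of GRing.PzRing A := {
  scalar_of : K -> A;
  scalar_of_is_zmod_morphism : {morph scalar_of : a b / a - b};
  scalar_of_is_monoid_morphism : scalar_of 1 = 1 /\
    {morph scalar_of : a b / a * b};
  scalar_of_central : forall (a : K) (x : A), scalar_of a * x = x * scalar_of a
}.

#[short(type="pzAlgType")]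
HB.structure Definition PzAlgebra (K : pzRingType) :=
  {A of GRing.PzRing A & hasCentralScalars K A}.

Fact scaled_idempotent (K : pzRingType) (A : pzAlgType K) (a b : K) (S : A) :
    a * b = 1 -> S * S = scalar_of b * S ->
  (scalar_of a * S) * (scalar_of a * S) = scalar_of a * S.
Proof.
have [s1 sM] := @scalar_of_is_monoid_morphism K A.
move=> ab SS; rewrite mulrA -[_ * S * _]mulrA -scalar_of_central mulrA -mulrA.
by rewrite SS mulrA -[_ * _ * scalar_of b]mulrA -sM ab s1 mulr1.
Qed.

Section Presentation.
Variables (K : fieldType) (G : choiceType).

Notation free_alg := {malg K[{fmonom G}]}.

Definition fgen (g : G) : free_alg := << fmu g >>.

Variable rel : free_alg -> free_alg -> Prop.

Inductive two_sided_ideal : free_alg -> Prop :=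
| ideal_rel u v : rel u v -> two_sided_ideal (u - v)
| ideal_0 : two_sided_ideal 0
| ideal_B u v :
    two_sided_ideal u -> two_sided_ideal v -> two_sided_ideal (u - v)
| ideal_Ml u v : two_sided_ideal v -> two_sided_ideal (u * v)
| ideal_Mr u v : two_sided_ideal u -> two_sided_ideal (u * v).

Definition ideal_mem : {pred free_alg} := fun u => `[< two_sided_ideal u >].

Fact ideal_mem_zmod_closed : zmod_closed ideal_mem.
Proof.
split=> [|u v]; rewrite !unfold_in; first exact/asboolP/ideal_0.
by move=> /asboolP Iu /asboolP Iv; apply/asboolP/ideal_B.
Qed.
HB.instance Definition _ :=
  GRing.isZmodClosed.Build free_alg ideal_mem ideal_mem_zmod_closed.

Definition presented : Type := Quotient.quot ideal_mem.
HB.instance Definition _ := GRing.Zmodule.on presented.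
HB.instance Definition _ := EqQuotient.on presented.
HB.instance Definition _ := ZmodQuotient.on presented.

Definition presented_pi (u : free_alg) : presented := \pi_presented u.

Fact presented_piB : {morph presented_pi : u v / u - v}.
Proof. exact: raddfB. Qed.

Fact presented_piD : {morph presented_pi : u v / u + v}.
Proof. exact: raddfD. Qed.

Fact presented_reprK x : presented_pi (repr x) = x.
Proof. exact: reprK. Qed.

Fact presented_piP u v :
  presented_pi u = presented_pi v <-> two_sided_ideal (u - v).
Proof.
split=> [/eqP|Iuv]; first by rewrite -Quotient.idealrBE => /asboolP.
by apply/eqP; rewrite -Quotient.idealrBE; apply/asboolP.
Qed.

Definition presented_one := presented_pi 1.
Definition presented_mul (x y : presented) := presented_pi (repr x * repr y).

Fact presented_piM u v :
  presented_pi (u * v) = presented_mul (presented_pi u) (presented_pi v).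
Proof.
rewrite /presented_mul; set u' := repr _; set v' := repr _.
have Iu : two_sided_ideal (u - u').
  by apply/presented_piP; rewrite presented_reprK.
have Iv : two_sided_ideal (v - v').
  by apply/presented_piP; rewrite presented_reprK.
apply/presented_piP.
have -> : u * v - u' * v' = u * (v - v') - (u' - u) * v'.
  by rewrite mulrBr mulrBl opprB addrA subrK.
apply: ideal_B; first exact: ideal_Ml.
apply: ideal_Mr; rewrite -[u' - u]opprB -sub0r.
by apply: ideal_B => //; apply: ideal_0.
Qed.

Fact presented_mulA : associative presented_mul.
Proof.
move=> x y z; rewrite -[x]presented_reprK -[y]presented_reprK.
by rewrite -[z]presented_reprK -!presented_piM mulrA.
Qed.

Fact presented_mul1 : left_id presented_one presented_mul.
Proof. by move=> x; rewrite -[x]presented_reprK -presented_piM mul1r. Qed.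

Fact presented_mulr1 : right_id presented_one presented_mul.
Proof. by move=> x; rewrite -[x]presented_reprK -presented_piM mulr1. Qed.

Fact presented_mulDl : left_distributive presented_mul +%R.
Proof.
move=> x y z; rewrite -[x]presented_reprK -[y]presented_reprK.
by rewrite -[z]presented_reprK -presented_piD -!presented_piM mulrDl
  presented_piD.
Qed.

Fact presented_mulDr : right_distributive presented_mul +%R.
Proof.
move=> x y z; rewrite -[x]presented_reprK -[y]presented_reprK.
by rewrite -[z]presented_reprK -presented_piD -!presented_piM mulrDr
  presented_piD.
Qed.

HB.instance Definition _ := GRing.Zmodule_isPzRing.Build presented
  presented_mulA presented_mul1 presented_mulr1 presented_mulDl presented_mulDr.

HB.instance Definition _ :=
  GRing.isZmodMorphism.Build free_alg presented presented_pi presented_piB.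
HB.instance Definition _ :=
  GRing.isMonoidMorphism.Build free_alg presented presented_pi
    (conj (erefl _) presented_piM).

Definition presented_scalar (a : K) : presented := presented_pi a%:MP.

Fact presented_scalarB : {morph presented_scalar : a b / a - b}.
Proof. by move=> a b; rewrite /presented_scalar !raddfB. Qed.

Fact presented_scalarM :
  presented_scalar 1 = 1 /\ {morph presented_scalar : a b / a * b}.
Proof. by split=> [|a b]; rewrite /presented_scalar ?mpolyCM ?rmorphM. Qed.

Fact malgC_central (a : K) (u : free_alg) : a%:MP * u = u * a%:MP.
Proof.
rewrite !malgM_def fgmulUg fgmulgU; apply: eq_bigr => m _.
by rewrite mulrC mul1m mulm1.
Qed.

Fact presented_scalar_central a x :
  presented_scalar a * x = x * presented_scalar a.
Proof.
by rewrite -[x]presented_reprK -!rmorphM malgC_central.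
Qed.

HB.instance Definition _ := hasCentralScalars.Build K presented
  presented_scalarB presented_scalarM presented_scalar_central.

End Presentation.

Arguments fgen {K G} g.

(* The algebra eAe, with unit e. *)
Section Corner.
Variables (K : fieldType) (A : pzAlgType K) (e : A) (idem_e : e * e = e).

Definition corner_pred : {pred A} := fun x => `[< exists h, x = e * h * e >].

Fact corner_zmod_closed : zmod_closed corner_pred.
Proof.
split=> [|x y]; rewrite !unfold_in; first by apply/asboolP; exists 0;
  rewrite mulr0 mul0r.
move=> /asboolP[h ->] /asboolP[h' ->]; apply/asboolP; exists (h - h').
by rewrite mulrBr mulrBl.
Qed.
HB.instance Definition _ :=
  GRing.isZmodClosed.Build A corner_pred corner_zmod_closed.

(* The proof [he] is not used by the fields: it makes the ring structure, whose *)
(* unit is e, inferable from the type. *)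
Record corner (he : e * e = e) : predArgType :=
  Corner { corner_val : A; _ : corner_val \in corner_pred }.

Notation eAe := (corner idem_e).

HB.instance Definition _ := [isSub of eAe for @corner_val idem_e].
HB.instance Definition _ := [Choice of eAe by <:].
HB.instance Definition _ := [SubChoice_isSubZmodule of eAe by <:].

Fact corner_mem h : e * h * e \in corner_pred.
Proof. by apply/asboolP; exists h. Qed.

Definition corner_of (h : A) : eAe := Corner idem_e (corner_mem h).

Definition corner_one : eAe := corner_of 1.
Definition corner_mul (x y : eAe) : eAe := corner_of (val x * val y).

Fact corner_valE (x : eAe) : (e * val x = val x) * (val x * e = val x).
Proof.
case: x => x /= /asboolP[h ->].
by rewrite -!mulrA idem_e !mulrA idem_e.
Qed.

Fact corner_oneE : val corner_one = e.
Proof. by rewrite /= mulr1 idem_e. Qed.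

Fact corner_mulE (x y : eAe) : val (corner_mul x y) = val x * val y.
Proof. by rewrite /= mulrA corner_valE -mulrA corner_valE. Qed.

Fact corner_valD (x y : eAe) : val (x + y) = val x + val y.
Proof. exact: raddfD. Qed.

Fact corner_valB (x y : eAe) : val (x - y) = val x - val y.
Proof. exact: raddfB. Qed.

Fact corner_mulA : associative corner_mul.
Proof. by move=> x y z; apply: val_inj; rewrite !corner_mulE mulrA. Qed.

Fact corner_mul1 : left_id corner_one corner_mul.
Proof.
by move=> x; apply: val_inj; rewrite corner_mulE corner_oneE corner_valE.
Qed.

Fact corner_mulr1 : right_id corner_one corner_mul.
Proof.
by move=> x; apply: val_inj; rewrite corner_mulE corner_oneE corner_valE.
Qed.

Fact corner_mulDl : left_distributive corner_mul +%R.
Proof.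
move=> x y z; apply: val_inj.
by rewrite corner_valD !corner_mulE corner_valD mulrDl.
Qed.

Fact corner_mulDr : right_distributive corner_mul +%R.
Proof.
move=> x y z; apply: val_inj.
by rewrite corner_valD !corner_mulE corner_valD mulrDr.
Qed.

HB.instance Definition _ := GRing.Zmodule_isPzRing.Build eAe
  corner_mulA corner_mul1 corner_mulr1 corner_mulDl corner_mulDr.

Definition corner_scalar (a : K) : eAe := corner_of (scalar_of a).

Fact corner_scalarE a : val (corner_scalar a) = scalar_of a * e.
Proof. by rewrite /= -scalar_of_central -mulrA idem_e. Qed.

Fact corner_scalarB : {morph corner_scalar : a b / a - b}.
Proof.
move=> a b; apply: val_inj.
by rewrite corner_valB !corner_scalarE scalar_of_is_zmod_morphism mulrBl.
Qed.

Fact corner_scalarM :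
  corner_scalar 1 = 1 /\ {morph corner_scalar : a b / a * b}.
Proof.
have [s1 sM] := @scalar_of_is_monoid_morphism K A.
split=> [|a b]; apply: val_inj; first by rewrite /= s1.
rewrite corner_mulE !corner_scalarE sM -!mulrA [e * (_ * e)]mulrA.
by rewrite -scalar_of_central -mulrA idem_e.
Qed.

Fact corner_scalar_central a x : corner_scalar a * x = x * corner_scalar a.
Proof.
apply: val_inj; rewrite !corner_mulE !corner_scalarE.
by rewrite -mulrA corner_valE mulrA -scalar_of_central -mulrA corner_valE.
Qed.

HB.instance Definition _ := hasCentralScalars.Build K eAe
  corner_scalarB corner_scalarM corner_scalar_central.

End Corner.

Section Fractions.
Variable K : fieldType.

(* Every element of D is both a right fraction and a left fraction of         *)
(* elements of A, so that the existence of such a D amounts to A being a      *)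
(* two-sided Ore domain.                                                      *)
Definition skew_field_of_fractions (A : pzAlgType K) (D : unitAlgType K) :
    Prop :=
  (forall q : D, q != 0 -> q \is a GRing.unit) /\
  exists iota : {rmorphism A -> D},
    [/\ forall a : K, iota (scalar_of a) = a%:A,
        injective iota,
        forall q, exists a b, iota b != 0 /\ q = iota a / iota b
      & forall q, exists a b, iota b != 0 /\ q = (iota b)^-1 * iota a].

Definition isomorphic_fractions (A B : pzAlgType K) : Prop :=
  [/\ exists D, skew_field_of_fractions A D,
      exists F, skew_field_of_fractions B F
    & forall D F : unitAlgType K,
        skew_field_of_fractions A D -> skew_field_of_fractions B F ->
        exists f : {lrmorphism D -> F}, bijective f].

End Fractions.

Section Weyl.
Variables (K : fieldType) (n : nat).

Notation free := {malg K[{fmonom ('I_n + 'I_n)%type}]}.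

Definition weyl_x (i : 'I_n) : free := fgen (inl i).
Definition weyl_d (i : 'I_n) : free := fgen (inr i).

Local Notation x := weyl_x.
Local Notation d := weyl_d.

Inductive weyl_rel : free -> free -> Prop :=
| weyl_xx i j : weyl_rel (x i * x j - x j * x i) 0
| weyl_dd i j : weyl_rel (d i * d j - d j * d i) 0
| weyl_dx i j : weyl_rel (d i * x j - x j * d i) (i == j)%:R.

Definition weyl := presented weyl_rel.
HB.instance Definition _ := PzAlgebra.on weyl.

End Weyl.

Section Reflections.
Variables (C : numClosedFieldType) (V : vectType C) (W : finGroupType).

(* A finite subgroup of GL(V) is encoded by its inclusion in End(V).          *)
Record linear_group (rho : W -> 'End(V)) : Prop := LinearGroup {
  linear_group1 : rho 1%g = \1%VF;
  linear_groupM : forall g h, rho (g * h)%g = (rho g \o rho h)%VF;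
  linear_group_inj : injective rho
}.

Variable rho : W -> 'End(V).

Definition hyperplane (H : {vspace V}) : bool := (\dim H).+1 == \dim {:V}.

Definition complex_reflection (f : 'End(V)) : Prop :=
  [/\ lker f = 0%VS, f <> \1%VF
    & exists2 H : {vspace V}, hyperplane H & {in H, forall v, f v = v}].

Definition reflections : {set W} :=
  [set w | `[< complex_reflection (rho w) >]].

Definition generated_by_reflections : Prop :=
  (<<reflections>> = [set: W])%g.

(* The only hyperplane fixed pointwise by a reflection is its fixed space.    *)
Definition reflection_hyperplanes : seq {vspace V} :=
  undup [seq fixedSpace (rho w) | w <- enum reflections].

Definition pointwise_stabilizer (H : {vspace V}) : {set W} :=
  [set w | (H <= fixedSpace (rho w))%VS].

Record invariant_hermitian_form (form : V -> V -> C) : Prop :=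
  InvariantHermitianForm {
    hermitian_antilinearl : forall a u v w,
      form (a *: u + v) w = a^* * form u w + form v w;
    hermitian_linearr : forall a u v w,
      form u (a *: v + w) = a * form u v + form u w;
    hermitian_sym : forall u v, form v u = (form u v)^*;
    hermitian_posdef : forall u, u != 0 -> 0 < form u u;
    hermitian_inv : forall w u v, form (rho w u) (rho w v) = form u v
  }.

Definition lfun_det (f : 'End(V)) : C :=
  \det (passmx.mxof (vbasis {:V}) (vbasis {:V}) f).

End Reflections.

Section Cherednik.
Variables (C : numClosedFieldType) (V : vectType C) (W : finGroupType).
Variables (rho : W -> 'End(V)).
Variables (alpha : {vspace V} -> 'Hom(V, C^o)) (vH : {vspace V} -> V).
Variable k : {vspace V} -> nat -> nat.

Notation free := {malg C[{fmonom ('Hom(V, C^o) + V + W)%type}]}.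

Definition cherednik_X (x : 'Hom(V, C^o)) : free := fgen (inl (inl x)).
Definition cherednik_Y (xi : V) : free := fgen (inl (inr xi)).
Definition cherednik_T (w : W) : free := fgen (inr w).

Local Notation X := cherednik_X.
Local Notation Y := cherednik_Y.
Local Notation T := cherednik_T.
Local Notation n_ H := #|pointwise_stabilizer rho H|.

Definition stab_idempotent (H : {vspace V}) (i : nat) : free :=
  (n_ H)%:R^-1 *:
    \sum_(w in pointwise_stabilizer rho H) lfun_det (rho w) ^- i *: T w.

(* The value of [xi, x].  The form alpha H has kernel H, and vH H is the      *)
(* vector such that alpha H = (vH H, _) for the invariant Hermitian form; the *)
(* parameters k H i are indexed modulo n_ H.                                  *)
Definition cherednik_bracket (xi : V) (x : 'Hom(V, C^o)) : free :=
  (x xi : C)%:MP +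
  \sum_(H <- reflection_hyperplanes rho)
    ((alpha H xi * x (vH H) / alpha H (vH H) : C) *:
      \sum_(i < n_ H)
        ((n_ H)%:R *
          ((k H i)%:R - (k H (i.+1 %% n_ H)%N)%:R)) *: stab_idempotent H i).

Inductive cherednik_rel : free -> free -> Prop :=
| cherednik_linX a x x' : cherednik_rel (X (a *: x + x')) (a *: X x + X x')
| cherednik_linY a xi xi' :
    cherednik_rel (Y (a *: xi + xi')) (a *: Y xi + Y xi')
| cherednik_one : cherednik_rel (T 1%g) 1
| cherednik_mul w w' : cherednik_rel (T w * T w') (T (w * w')%g)
| cherednik_XX x x' : cherednik_rel (X x * X x' - X x' * X x) 0
| cherednik_YY xi xi' : cherednik_rel (Y xi * Y xi' - Y xi' * Y xi) 0
  (* W acts on linear forms by w(x) = x \o w^-1.                                *)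
| cherednik_TX w x :
    cherednik_rel (T w * X x * T w^-1%g) (X (x \o rho w^-1%g)%VF)
| cherednik_TY w xi : cherednik_rel (T w * Y xi * T w^-1%g) (Y (rho w xi))
| cherednik_YX xi x :
    cherednik_rel (Y xi * X x - X x * Y xi) (cherednik_bracket xi x).

Definition cherednik := presented cherednik_rel.
HB.instance Definition _ := PzAlgebra.on cherednik.

(* The idempotent (1/|W|) \sum_w w. *)
Definition cherednik_e : cherednik :=
  presented_pi cherednik_rel (#|W|%:R^-1 *: \sum_(w : W) T w).

Fact cherednik_e_idem : cherednik_e * cherednik_e = cherednik_e.
Proof.
have cardW : #|W|%:R != 0 :> C.
  by rewrite pnatr_eq0 -lt0n; apply/card_gt0P; exists 1%g.
pose t w : cherednik := presented_pi cherednik_rel (T w).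
pose s : C -> cherednik := scalar_of.
have tM w w' : t w * t w' = t (w * w')%g.
  by rewrite /t -rmorphM; apply/presented_piP/ideal_rel/cherednik_mul.
have sM a b : s (a * b) = s a * s b.
  exact: (@scalar_of_is_monoid_morphism C cherednik).2.
have eE : cherednik_e = s #|W|%:R^-1 * \sum_w t w.
  by rewrite /cherednik_e -mul_malgC rmorphM rmorph_sum.
have tS w : t w * \sum_w' t w' = \sum_w' t w'.
  rewrite mulr_sumr (reindex_inj (mulgI w^-1%g)).
  by apply: eq_bigr => w' _; rewrite tM mulKVg.
have SS : (\sum_w t w) * (\sum_w t w) = s #|W|%:R * \sum_w t w.
  rewrite mulr_suml (eq_bigr _ (fun w _ => tS w)) sumr_const.
  have -> : s #|W|%:R = #|W|%:R.
    have -> : s #|W|%:R = presented_pi cherednik_rel (#|W|%:R)%:MP by [].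
    by rewrite mpolyC_nat rmorph_nat.
  by rewrite mulr_natl.
rewrite eE; exact: (scaled_idempotent (mulVf cardW) SS).
Qed.

Definition spherical := corner cherednik_e_idem.
HB.instance Definition _ := PzAlgebra.on spherical.

End Cherednik.

(* Main.v *)
(* Let S = C[V] and let R = S^W; by Chevalley's theorem R is a polynomial ring,  *)
(* R = C[f_1, ..., f_n].  The Cherednik algebra acts on S by Dunkl operators,    *)
(* which differ from partial derivatives by terms vanishing on R.  Writing an    *)
(* element of He as a sum of products of polynomials and Dunkl operators shows   *)
(* that eHe acts on R = C[y_1, ..., y_n] by differential operators with          *)
(* polynomial coefficients, i.e. through the Weyl algebra A_n; comparing leading *)
(* symbols, where the Jacobian of f appears, shows that eHe -> A_n is injective. *)
(* Its image contains C[y_1, ..., y_n] and, for some nonzero D in this ring, all *)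
(* D d/dy_i, so every P in A_n is a left and a right fraction of elements of the *)
(* image, and A_n is an Ore domain.                                              *)
Require Import Defs.
From HB Require Import structures.
From mathcomp Require Import all_boot all_order all_fingroup all_algebra.
From mathcomp Require Import boolp reals complex.
From mathcomp Require finmap.
From mathcomp.multinomials Require Import -(notations) monalg.
From mathcomp.multinomials Require Import mpoly.

Set Implicit Arguments.
Unset Strict Implicit.
Unset Printing Implicit Defensive.

Import Order.TTheory GRing.Theory Num.Theory.
Local Open Scope ring_scope.

(** * Ore localization *)

(** Let A_n be the Weyl algebra, S the polynomial ring on V and R the ring of invariants of W.
    Everything reduces to embedding eHe in A_n so densely that both have the same fractions.

    Fractions. [fractions_restrict] shows that if every element of A has a nonzero left multiple and
    a nonzero right multiple in a subalgebra B, then a skew field of fractions of A is also one of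
    B. For A = A_n it exists by Ore localization: [weyl_integral] reads off from leading symbols
    that A_n is a domain, and [weyl_ore] obtains common multiples by counting dimensions, since the
    filtration of A_n grows polynomially. [fractions_unique] removes the dependence on the chosen
    field.

    Invariants. [chevalley] gives R = C[f_1, ..., f_n] with nonzero Jacobian determinant. It rests
    on [relation_flat]: divided differences along reflections lower the degree, so every polynomial
    relation between invariants is generated by invariant relations. [gradients_free] deduces that
    the gradients of invariants independent modulo products of invariants are linearly independent
    over S. This bounds the number of generators by n and gives algebraic independence and the
    Jacobian.

    Representation. Dunkl operators commute ([dunkl_commute]) and satisfy the remaining relations of
    the Cherednik algebra ([cherednik_relP]). On an invariant factor they obey the ordinary Leibniz
    rule ([dunklM]), because their reflection terms do not see it.

    Comparison. Elements of He are sums of products X(p) Y^b e ([nf_span]), so they act on R as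
    differential operators in f_1, ..., f_n ([action_diffop]). The leading symbol is the original
    one after a linear change of variables by the Jacobian matrix, so it does not vanish; hence
    [spherical_embed] from eHe to A_n is injective. Its image contains all polynomials, and D d_i
    for all i with one nonzero D ([realized_d]); clearing denominators gives [realized_left] and
    [realized_right], the multiples required above. *)

Section Scalars.
Variables (K : fieldType) (A : pzAlgType K).

Lemma scalar_of0 : scalar_of 0 = 0 :> A.
Proof. by rewrite -{1}(subrr 0) scalar_of_is_zmod_morphism subrr. Qed.

Lemma scalar_ofN (a : K) : scalar_of (- a) = - scalar_of a :> A.
Proof. by rewrite -sub0r scalar_of_is_zmod_morphism scalar_of0 sub0r. Qed.

Lemma scalar_ofD (a b : K) : scalar_of (a + b) = scalar_of a + scalar_of b :> A.
Proof. by rewrite -{1}[b]opprK scalar_of_is_zmod_morphism scalar_ofN opprK. Qed.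

Lemma scalar_of1 : scalar_of 1 = 1 :> A.
Proof. exact: (@scalar_of_is_monoid_morphism K A).1. Qed.

Lemma scalar_ofM (a b : K) : scalar_of (a * b) = scalar_of a * scalar_of b :> A.
Proof. exact: (@scalar_of_is_monoid_morphism K A).2. Qed.

End Scalars.

Record ore_domain (A : pzRingType) : Prop := OreDomain {
  ore_nonzero : 1 != 0 :> A;
  ore_integral : forall x y : A, x * y = 0 -> x = 0 \/ y = 0;
  ore_right : forall a b : A, a != 0 -> b != 0 ->
    exists s t, t != 0 /\ a * t = b * s;
  ore_left : forall a b : A, a != 0 -> b != 0 ->
    exists s t, t != 0 /\ t * a = s * b
}.

Section OreFractions.
Variables (A : pzRingType) (oreA : ore_domain A).

Lemma ore_mulf_neq0 (x y : A) : x != 0 -> y != 0 -> x * y != 0.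
Proof.
by move=> x0 y0; apply/eqP => /(ore_integral oreA)[] e; move: x0 y0;
  rewrite e eqxx.
Qed.

Lemma ore_right0 (a b : A) : b != 0 -> exists s t, t != 0 /\ a * t = b * s.
Proof.
move=> b0; have [->|a0] := eqVneq a 0; last exact: (ore_right oreA).
by exists 0, 1; rewrite mul0r mulr0 (ore_nonzero oreA).
Qed.

Lemma ore_left0 (a b : A) : b != 0 -> exists s t, t != 0 /\ t * a = s * b.
Proof.
move=> b0; have [->|a0] := eqVneq a 0; last exact: (ore_left oreA).
by exists 0, 1; rewrite mul0r mulr0 (ore_nonzero oreA).
Qed.

(* The fraction a / b is represented by the graph of the largest partial map  *)
(* x |-> (a / b) x from A to A; the proof H is a phantom parameter from which *)
(* the ring structure can be inferred.                                        *)
Record ore_frac (H : ore_domain A) := OreFrac {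
  ore_graph : A -> A -> Prop;
  ore_graph_lin : forall x y x' y' u v, ore_graph x y -> ore_graph x' y' ->
    ore_graph (x * u + x' * v) (y * u + y' * v);
  ore_graph0 : forall y, ore_graph 0 y -> y = 0;
  ore_graph_dom : exists x y, x != 0 /\ ore_graph x y;
  ore_graph_sat : forall x y t, t != 0 -> ore_graph (x * t) (y * t) ->
    ore_graph x y
}.

Local Notation D := (ore_frac oreA).

Lemma ore_frac_ext (p q : D) :
  (forall x y, ore_graph p x y -> ore_graph q x y) ->
  (forall x y, ore_graph q x y -> ore_graph p x y) -> p = q.
Proof.
case: p q => [G g1 g2 g3 g4] [G' g1' g2' g3' g4'] /= s s'.
have E : G = G'.
  by apply/funext => x; apply/funext => y; apply/propext; split; [apply: s|apply: s'].
subst G'.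
rewrite (Prop_irrelevance g1 g1') (Prop_irrelevance g2 g2').
by rewrite (Prop_irrelevance g3 g3') (Prop_irrelevance g4 g4').
Qed.

Lemma ore_graphM (q : D) x y t : ore_graph q x y -> ore_graph q (x * t) (y * t).
Proof.
by move=> h; have := ore_graph_lin t 0 h h; rewrite !mulr0 !addr0.
Qed.

Lemma ore_graph_fun (q : D) x y y' :
  ore_graph q x y -> ore_graph q x y' -> y = y'.
Proof.
move=> h h'; have := ore_graph_lin 1 (-1) h h'.
rewrite !mulr1 !mulrN1 subrr => /ore_graph0/eqP.
by rewrite subr_eq0 => /eqP.
Qed.

(** By the Ore condition u t = x s for some nonzero t, so the common value at x determines both maps
    at u t. Saturation of q then divides by t. *)
Lemma ore_graph_transfer (p q : D) x y u v : x != 0 ->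
  ore_graph p x y -> ore_graph q x y -> ore_graph p u v -> ore_graph q u v.
Proof.
move=> x0 px qx pu; have [s [t [t0 e]]] := ore_right0 u x0.
apply: (ore_graph_sat t0); rewrite e.
have := ore_graphM t pu; rewrite e => /(ore_graph_fun (ore_graphM s px)) <-.
exact: ore_graphM.
Qed.

(** The working equality test: each ring axiom below is checked at one nonzero point where all the
    maps involved are defined. *)
Lemma ore_frac_eq (p q : D) x y : x != 0 ->
  ore_graph p x y -> ore_graph q x y -> p = q.
Proof.
move=> x0 px qx; apply: ore_frac_ext => u v.
  exact: ore_graph_transfer x0 px qx.
exact: ore_graph_transfer x0 qx px.
Qed.

Lemma ore_graph_def (q : D) z : exists t z', t != 0 /\ ore_graph q (z * t) z'.
Proof.
have [x [y [x0 qx]]] := ore_graph_dom q.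
have [s [t [t0 e]]] := ore_right0 z x0.
by exists t, (y * s); rewrite e; split=> //; apply: ore_graphM.
Qed.

Section Fraction.
Variables (a b : A) (b0 : b != 0).

(** Division-free form of y = (a / b) x, the quotient s / t standing for b^-1 x. *)
Definition mkfrac_graph x y := exists s t, [/\ t != 0, x * t = b * s & y * t = a * s].

Fact mkfrac_lin x y x' y' u v : mkfrac_graph x y -> mkfrac_graph x' y' ->
  mkfrac_graph (x * u + x' * v) (y * u + y' * v).
Proof.
have scale x1 y1 w : mkfrac_graph x1 y1 -> mkfrac_graph (x1 * w) (y1 * w).
  case=> s [t [t0 e1 e2]].
  have [s' [t' [t0' e']]] := ore_right0 w t0.
  by exists (s * s'), t'; split=> //; rewrite -mulrA e' mulrA ?e1 ?e2 mulrA.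
move=> /(scale _ _ u)[s [t [t0 e1 e2]]] /(scale _ _ v)[s' [t' [t0' e1' e2']]].
(* A common right multiple t r = t' p of the two denominators, over which the numerators add. *)
have [p [r [r0 e]]] := ore_right oreA t0 t0'.
exists (s * r + s' * p), (t * r); split; first exact: ore_mulf_neq0.
  by rewrite mulrDl mulrDr {2}e !mulrA e1 e1'.
by rewrite mulrDl mulrDr {2}e !mulrA e2 e2'.
Qed.

Fact mkfrac_0 y : mkfrac_graph 0 y -> y = 0.
Proof.
case=> s [t [t0 /esym]]; rewrite mul0r => /(ore_integral oreA)[e|->].
  by case/eqP: b0.
by rewrite mulr0 => /(ore_integral oreA)[] // e; rewrite e eqxx in t0.
Qed.

Fact mkfrac_self : mkfrac_graph b a.
Proof. by exists 1, 1; rewrite !mulr1 (ore_nonzero oreA). Qed.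

Fact mkfrac_sat x y t : t != 0 -> mkfrac_graph (x * t) (y * t) -> mkfrac_graph x y.
Proof.
move=> t0 [s [u [u0 e1 e2]]]; exists s, (t * u).
by rewrite !mulrA; split=> //; apply: ore_mulf_neq0.
Qed.

Definition mkfrac : D := OreFrac oreA mkfrac_lin mkfrac_0
  (ex_intro _ b (ex_intro _ a (conj b0 mkfrac_self))) mkfrac_sat.

End Fraction.

HB.instance Definition _ := gen_eqMixin D.
HB.instance Definition _ := gen_choiceMixin D.

(** Only an inclusion of graphs is asked: a maximal sum can be defined beyond the common domain, as
    for p and -p. The inclusion still determines r, by [ore_frac_eq]. *)
Lemma ore_add_subproof (p q : D) : exists r : D,
  forall x y z, ore_graph p x y -> ore_graph q x z -> ore_graph r x (y + z).
Proof.
have [x [y [x0 px]]] := ore_graph_dom p.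
have [t [z [t0 qx]]] := ore_graph_def q x.
have xt0 := ore_mulf_neq0 x0 t0.
exists (mkfrac (y * t + z) xt0) => u v w pu qu.
have [s [r [r0 e]]] := ore_right0 u xt0.
exists s, r; split=> //; rewrite !mulrDl; congr (_ + _).
  by apply: (ore_graph_fun (ore_graphM r pu)); rewrite e; do 2 apply: ore_graphM.
by apply: (ore_graph_fun (ore_graphM r qu)); rewrite e; apply: ore_graphM.
Qed.

Lemma ore_mul_subproof (p q : D) : exists r : D,
  forall x y z, ore_graph q x y -> ore_graph p y z -> ore_graph r x z.
Proof.
have [x [y [x0 qx]]] := ore_graph_dom q.
have [t [z [t0 py]]] := ore_graph_def p y.
have xt0 := ore_mulf_neq0 x0 t0.
exists (mkfrac z xt0) => u v w qu pv.
have [s [r [r0 e]]] := ore_right0 u xt0.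
exists s, r; split=> //.
apply: (ore_graph_fun (ore_graphM r pv)).
have -> : v * r = y * t * s.
  by apply: (ore_graph_fun (ore_graphM r qu)); rewrite e; do 2 apply: ore_graphM.
exact: ore_graphM.
Qed.

Lemma ore_opp_subproof (p : D) : exists r : D,
  forall x y, ore_graph p x y -> ore_graph r x (- y).
Proof.
have [x [y [x0 px]]] := ore_graph_dom p.
exists (mkfrac (- y) x0) => u v pu.
have [s [r [r0 e]]] := ore_right0 u x0.
exists s, r; split=> //; rewrite !mulNr; congr (- _).
by apply: (ore_graph_fun (ore_graphM r pu)); rewrite e; apply: ore_graphM.
Qed.

Definition ore_embed (a : A) : D := mkfrac a (ore_nonzero oreA).
Definition ore_add p q : D := projT1 (cid (ore_add_subproof p q)).
Definition ore_mul p q : D := projT1 (cid (ore_mul_subproof p q)).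
Definition ore_opp p : D := projT1 (cid (ore_opp_subproof p)).

Lemma ore_addP p q x y z :
  ore_graph p x y -> ore_graph q x z -> ore_graph (ore_add p q) x (y + z).
Proof. by rewrite /ore_add; case: cid => r /=; apply. Qed.

Lemma ore_mulP p q x y z :
  ore_graph q x y -> ore_graph p y z -> ore_graph (ore_mul p q) x z.
Proof. by rewrite /ore_mul; case: cid => r /=; apply. Qed.

Lemma ore_oppP p x y : ore_graph p x y -> ore_graph (ore_opp p) x (- y).
Proof. by rewrite /ore_opp; case: cid => r /=; apply. Qed.

Lemma ore_embedP a x : ore_graph (ore_embed a) x (a * x).
Proof. by exists x, 1; rewrite !mulr1 mul1r (ore_nonzero oreA). Qed.

Lemma ore_embed0P x : ore_graph (ore_embed 0) x 0.
Proof. by have := ore_embedP 0 x; rewrite mul0r. Qed.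

Lemma ore_embed1P x : ore_graph (ore_embed 1) x x.
Proof. by have := ore_embedP 1 x; rewrite mul1r. Qed.

Lemma ore_graph_def2 (p q : D) :
  exists x y z, [/\ x != 0, ore_graph p x y & ore_graph q x z].
Proof.
have [x [y [x0 px]]] := ore_graph_dom p.
have [t [z [t0 qx]]] := ore_graph_def q x.
exists (x * t), (y * t), z; split=> //; last exact: ore_graphM.
exact: ore_mulf_neq0.
Qed.

Lemma ore_graph_def3 (p q r : D) :
  exists x y z w, [/\ x != 0, ore_graph p x y, ore_graph q x z & ore_graph r x w].
Proof.
have [x [y [z [x0 px qx]]]] := ore_graph_def2 p q.
have [t [w [t0 rx]]] := ore_graph_def r x.
exists (x * t), (y * t), (z * t), w; split=> //; try exact: ore_graphM.
exact: ore_mulf_neq0.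
Qed.

Fact ore_addA : associative ore_add.
Proof.
move=> p q r; have [x [y [z [w [x0 px qx rx]]]]] := ore_graph_def3 p q r.
apply: (ore_frac_eq x0 (ore_addP px (ore_addP qx rx))).
by rewrite addrA; do 2?apply: ore_addP.
Qed.

Fact ore_addC : commutative ore_add.
Proof.
move=> p q; have [x [y [z [x0 px qx]]]] := ore_graph_def2 p q.
by apply: (ore_frac_eq x0 (ore_addP px qx)); rewrite addrC; apply: ore_addP.
Qed.

Fact ore_add0 : left_id (ore_embed 0) ore_add.
Proof.
move=> p; have [x [y [x0 px]]] := ore_graph_dom p.
apply: (ore_frac_eq x0 _ px).
by have := ore_addP (ore_embedP 0 x) px; rewrite mul0r add0r.
Qed.

Fact ore_addN : left_inverse (ore_embed 0) ore_opp ore_add.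
Proof.
move=> p; have [x [y [x0 px]]] := ore_graph_dom p.
apply: (ore_frac_eq x0 (ore_addP (ore_oppP px) px)).
by rewrite addNr; apply: ore_embed0P.
Qed.

HB.instance Definition _ :=
  GRing.isZmodule.Build D ore_addA ore_addC ore_add0 ore_addN.

Fact ore_mulA : associative ore_mul.
Proof.
move=> p q r; have [x [y [x0 rx]]] := ore_graph_dom r.
have [t [z [t0 qy]]] := ore_graph_def q y.
have [t' [w [t0' pz]]] := ore_graph_def p z.
have X0 : x * t * t' != 0 by do 2?apply: ore_mulf_neq0.
have qz := ore_graphM t' qy; have rx' := ore_graphM t' (ore_graphM t rx).
apply: (ore_frac_eq X0 (ore_mulP (ore_mulP rx' qz) pz)).
exact: ore_mulP rx' (ore_mulP qz pz).
Qed.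

Fact ore_mul1 : left_id (ore_embed 1) ore_mul.
Proof.
move=> p; have [x [y [x0 px]]] := ore_graph_dom p.
exact: (ore_frac_eq x0 (ore_mulP px (ore_embed1P _))).
Qed.

Fact ore_mulr1 : right_id (ore_embed 1) ore_mul.
Proof.
move=> p; have [x [y [x0 px]]] := ore_graph_dom p.
apply: (ore_frac_eq x0 _ px).
exact: (ore_mulP (ore_embed1P x)).
Qed.

Fact ore_mulDl : left_distributive ore_mul ore_add.
Proof.
move=> p q r; have [x [y [x0 rx]]] := ore_graph_dom r.
have [t [z [t0 py]]] := ore_graph_def p y.
have [t' [w [t0' qy]]] := ore_graph_def q (y * t).
have X0 : x * t * t' != 0 by do 2?apply: ore_mulf_neq0.
have py' := ore_graphM t' py; have rx' := ore_graphM t' (ore_graphM t rx).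
apply: (ore_frac_eq X0 (ore_mulP rx' (ore_addP py' qy))).
by apply: ore_addP; [apply: ore_mulP py'|apply: ore_mulP qy].
Qed.

Fact ore_mulDr : right_distributive ore_mul ore_add.
Proof.
move=> p q r; have [x [y [z [x0 qx rx]]]] := ore_graph_def2 q r.
have [t [v [t0 py]]] := ore_graph_def p y.
have [t' [w [t0' pz]]] := ore_graph_def p (z * t).
have X0 : x * t * t' != 0 by do 2?apply: ore_mulf_neq0.
have qx' := ore_graphM t' (ore_graphM t qx).
have rx' := ore_graphM t' (ore_graphM t rx).
have py' := ore_graphM t' py.
have := ore_graph_lin 1 1 py' pz; rewrite !mulr1 => pyz.
apply: (ore_frac_eq X0 (ore_mulP (ore_addP qx' rx') pyz)).
by apply: ore_addP; [apply: ore_mulP py'|apply: ore_mulP pz].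
Qed.

Lemma ore_embed_inj : injective ore_embed.
Proof.
move=> a b e; have := ore_embedP a 1; rewrite e.
by move=> /(ore_graph_fun (ore_embedP b 1)); rewrite !mulr1.
Qed.

Fact ore_one_neq0 : ore_embed 1 != 0.
Proof. by rewrite (inj_eq ore_embed_inj) (ore_nonzero oreA). Qed.

HB.instance Definition _ := GRing.Zmodule_isNzRing.Build D
  ore_mulA ore_mul1 ore_mulr1 ore_mulDl ore_mulDr ore_one_neq0.

(** Inversion transposes the graph. The condition on p sits under the existential so that one total
    choice of r can be made; for p = 0 any r will do. *)
Lemma ore_inv_subproof (p : D) : exists r : D,
  forall x y, p <> 0 -> ore_graph p x y -> ore_graph r y x.
Proof.
have [x [y [x0 px]]] := ore_graph_dom p.
have [y0|y0] := eqVneq y 0.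
  exists 0 => u v []; rewrite y0 in px; apply: (ore_frac_eq x0 px).
  exact: ore_embed0P.
exists (mkfrac x y0) => u v _ pu.
have [s [t [t0 e]]] := ore_right0 u x0.
exists s, t; split=> //.
by apply: (ore_graph_fun (ore_graphM t pu)); rewrite e; apply: ore_graphM.
Qed.

Definition ore_inv p : D :=
  if p == 0 then 0 else projT1 (cid (ore_inv_subproof p)).

Lemma ore_invP p x y : p != 0 -> ore_graph p x y -> ore_graph (ore_inv p) y x.
Proof. by move=> p0; rewrite /ore_inv; rewrite (negPf p0); case: cid => r /= h; apply/h/eqP. Qed.

Lemma ore_graph_neq0 p x y : p != 0 -> x != 0 -> ore_graph p x y -> y != 0.
Proof.
move=> p0 x0 px; apply: contra_neqN p0 => /eqP y0; rewrite y0 in px.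
by apply: (ore_frac_eq x0 px); apply: ore_embed0P.
Qed.

Fact ore_mulVr : {in [pred p : D | p != 0], left_inverse 1 ore_inv *%R}.
Proof.
move=> p p0; have [x [y [x0 px]]] := ore_graph_dom p.
apply: (ore_frac_eq x0 (ore_mulP px (ore_invP p0 px))).
exact: ore_embed1P.
Qed.

Fact ore_mulrV : {in [pred p : D | p != 0], right_inverse 1 ore_inv *%R}.
Proof.
move=> p p0; have [x [y [x0 px]]] := ore_graph_dom p.
have y0 := ore_graph_neq0 p0 x0 px.
apply: (ore_frac_eq y0 (ore_mulP (ore_invP p0 px) px)).
exact: ore_embed1P.
Qed.

Fact ore_unitP (p q : D) : q * p = 1 /\ p * q = 1 -> p != 0.
Proof.
by case=> _ e; apply: contra_eqN e => /eqP ->; rewrite mul0r eq_sym oner_eq0.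
Qed.

Fact ore_inv_out : {in [predC [pred p : D | p != 0]], ore_inv =1 id}.
Proof. by move=> p; rewrite !inE negbK => /eqP ->; rewrite /ore_inv eqxx. Qed.

HB.instance Definition _ := GRing.NzRing_hasMulInverse.Build D
  ore_mulVr ore_mulrV ore_unitP ore_inv_out.

Fact ore_embedB : {morph ore_embed : a b / a - b}.
Proof.
move=> a b; apply: (ore_frac_eq (ore_nonzero oreA) (ore_embedP _ 1)).
by rewrite mulrBl; apply: ore_addP; [|apply: ore_oppP]; apply: ore_embedP.
Qed.

Fact ore_embedM : ore_embed 1 = 1 /\ {morph ore_embed : a b / a * b}.
Proof.
split=> // a b; apply: (ore_frac_eq (ore_nonzero oreA) (ore_embedP _ 1)).
by rewrite -mulrA; apply: ore_mulP (ore_embedP _ _) (ore_embedP _ _).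
Qed.

HB.instance Definition _ := GRing.isZmodMorphism.Build A D ore_embed ore_embedB.
HB.instance Definition _ := GRing.isMonoidMorphism.Build A D ore_embed
  (ore_embedM.1, ore_embedM.2).

Lemma ore_fracE (q : D) : exists a b, b != 0 /\ q = ore_embed a / ore_embed b.
Proof.
have [b [a [b0 qb]]] := ore_graph_dom q; exists a, b; split=> //.
have ib0 : ore_embed b != 0 by rewrite -(raddf0 ore_embed) (inj_eq ore_embed_inj).
apply: (mulIr (x := ore_embed b)) => //; rewrite mulrVK //.
apply: (ore_frac_eq (ore_nonzero oreA)).
  by apply: (ore_mulP (ore_embedP _ _)); rewrite mulr1; apply: qb.
by have := ore_embedP a 1; rewrite mulr1.
Qed.

(** The left Ore condition turns t a = s b into a / b = t^-1 s. *)
Lemma ore_frac_leftE (q : D) :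
  exists a b, b != 0 /\ q = (ore_embed b)^-1 * ore_embed a.
Proof.
have [a [b [b0 ->]]] := ore_fracE q.
have [s [t [t0 e]]] := ore_left0 a b0; exists s, t; split=> //.
have u x : x != 0 -> ore_embed x \is a GRing.unit.
  by move=> x0; rewrite unfold_in /= -(raddf0 ore_embed) (inj_eq ore_embed_inj).
apply: (mulrI (u _ t0)); rewrite mulVKr ?u //.
by apply: (mulIr (u _ b0)); rewrite mulrA mulrVK ?u // -!rmorphM e.
Qed.

End OreFractions.

Section OreAlgebra.
Variables (K : fieldType) (A : pzAlgType K) (oreA : ore_domain A).
Local Notation D := (ore_frac oreA).

Definition ore_scale (a : K) (q : D) : D := ore_embed oreA (scalar_of a) * q.

Fact ore_scaleA a b q : ore_scale a (ore_scale b q) = ore_scale (a * b) q.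
Proof. by rewrite /ore_scale mulrA -rmorphM scalar_ofM. Qed.

Fact ore_scale1 : left_id 1 ore_scale.
Proof. by move=> q; rewrite /ore_scale scalar_of1 rmorph1 mul1r. Qed.

Fact ore_scaleDr : right_distributive ore_scale +%R.
Proof. by move=> a p q; rewrite /ore_scale mulrDr. Qed.

Fact ore_scaleDl q : {morph ore_scale^~ q : a b / a + b}.
Proof. by move=> a b; rewrite /ore_scale scalar_ofD raddfD mulrDl. Qed.

HB.instance Definition _ := GRing.Zmodule_isLmodule.Build K D
  ore_scaleA ore_scale1 ore_scaleDr ore_scaleDl.

Fact ore_scaleAl (a : K) (p q : D) : a *: (p * q) = a *: p * q.
Proof. exact: mulrA. Qed.

HB.instance Definition _ := GRing.Lmodule_isLalgebra.Build K D ore_scaleAl.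

Fact ore_scaleAr (a : K) (p q : D) : a *: (p * q) = p * (a *: q).
Proof.
have [x [y [b0 ->]]] := ore_fracE p.
have uy : ore_embed oreA y \is a GRing.unit.
  by rewrite unfold_in /= -(raddf0 (ore_embed oreA)) (inj_eq (@ore_embed_inj _ _)).
have C z : GRing.comm (ore_embed oreA (scalar_of a)) (ore_embed oreA z).
  by rewrite /GRing.comm -!rmorphM scalar_of_central.
rewrite [LHS]mulrA [RHS]mulrA; congr (_ * _).
by apply: commrM; [|apply: commrV].
Qed.

HB.instance Definition _ := GRing.Lalgebra_isAlgebra.Build K D ore_scaleAr.

Lemma ore_frac_exists : exists F : unitAlgType K, skew_field_of_fractions A F.
Proof.
exists D; split=> //; exists (ore_embed oreA); split.
- by move=> a; rewrite -[RHS]/(ore_embed oreA (scalar_of a) * 1) mulr1.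
- exact: ore_embed_inj.
- move=> q; have [a [b [b0 ->]]] := ore_fracE q; exists a, b; split=> //.
  by rewrite -(raddf0 (ore_embed oreA)) (inj_eq (@ore_embed_inj _ _)).
- move=> q; have [a [b [b0 ->]]] := ore_frac_leftE q; exists a, b; split=> //.
  by rewrite -(raddf0 (ore_embed oreA)) (inj_eq (@ore_embed_inj _ _)).
Qed.

End OreAlgebra.

(** * Uniqueness of the skew field of fractions and its passage to subalgebras *)

Section FractionsUnique.
Variables (K : fieldType) (A : pzAlgType K) (D F : unitAlgType K).
Hypothesis unitD : forall q : D, q != 0 -> q \is a GRing.unit.
Hypothesis unitF : forall q : F, q != 0 -> q \is a GRing.unit.
Variables (i : {rmorphism A -> D}) (j : {rmorphism A -> F}).
Hypothesis iK : forall a : K, i (scalar_of a) = a%:A.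
Hypothesis jK : forall a : K, j (scalar_of a) = a%:A.
Hypotheses (i_inj : injective i) (j_inj : injective j).
Hypothesis fracD : forall q, exists a b, i b != 0 /\ q = i a / i b.

Let i_eq0 a : (i a == 0) = (a == 0).
Proof. by rewrite -(raddf0 i) (inj_eq i_inj). Qed.

Let j_eq0 a : (j a == 0) = (a == 0).
Proof. by rewrite -(raddf0 j) (inj_eq j_inj). Qed.

Lemma frac_mulE (q : D) a b : b != 0 -> q = i a / i b -> q * i b = i a.
Proof. by move=> b0 ->; rewrite mulrVK // unitD // i_eq0. Qed.

(** The right Ore condition is recovered from the fractions themselves: write c^-1 b as s / t in D
    and clear denominators. *)
Lemma frac_common (b c : A) : b != 0 -> c != 0 ->
  exists s t, [/\ s != 0, t != 0 & b * t = c * s].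
Proof.
move=> b0 c0; have uc : i c \is a GRing.unit by rewrite unitD // i_eq0.
have [s [t [t0 e]]] := fracD ((i c)^-1 * i b).
have ut := unitD t0.
have E : b * t = c * s.
  apply: i_inj; rewrite !rmorphM; apply: (mulIr (x := (i t)^-1)).
    by rewrite unitrV.
  by rewrite mulrK // -[RHS]mulrA -e mulVKr.
exists s, t; split=> //; last by rewrite -i_eq0.
apply: contraNneq b0 => s0; move: E; rewrite s0 mulr0 => /(congr1 i).
rewrite rmorphM raddf0 => /(congr1 (fun z => z * (i t)^-1)).
by rewrite mulrK // mul0r => /eqP; rewrite i_eq0.
Qed.

(** Asking that r work for every presentation of q makes independence of the presentation part of
    the existence proof. *)
Lemma frac_extend_subproof (q : D) :
  exists r : F, forall a b, b != 0 -> q * i b = i a -> r * j b = j a.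
Proof.
have [a [b [b0 e]]] := fracD q; rewrite i_eq0 in b0.
exists (j a / j b) => c d d0 qd.
have [s [t [s0 t0 E]]] := frac_common b0 d0.
have uj x : x != 0 -> j x \is a GRing.unit by move=> ?; rewrite unitF // j_eq0.
have ui x : x != 0 -> i x \is a GRing.unit by move=> ?; rewrite unitD // i_eq0.
apply: (mulIr (uj _ s0)).
have -> : j c * j s = j a * j t.
  rewrite -!rmorphM; congr (j _); apply: i_inj; rewrite !rmorphM -qd.
  by rewrite -(frac_mulE b0 e) -!mulrA -!rmorphM E.
by rewrite -[LHS]mulrA -(rmorphM j d s) -E rmorphM mulrA mulrVK ?uj.
Qed.

Definition frac_extend q : F := projT1 (cid (frac_extend_subproof q)).

Lemma frac_extendP q a b : b != 0 -> q * i b = i a -> frac_extend q * j b = j a.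
Proof. by rewrite /frac_extend; case: cid => r /= h; apply: h. Qed.

Lemma frac_den q : exists a b, b != 0 /\ q * i b = i a.
Proof.
have [a [b [b0 e]]] := fracD q; rewrite i_eq0 in b0.
by exists a, b; split=> //; apply: frac_mulE.
Qed.

Let uj x : x != 0 -> j x \is a GRing.unit.
Proof. by move=> ?; rewrite unitF // j_eq0. Qed.

Fact frac_extendB : {morph frac_extend : p q / p - q}.
Proof.
move=> p q; have [a [b [b0 pb]]] := frac_den p; have [c [d [d0 qd]]] := frac_den q.
have [s [t [s0 t0 E]]] := frac_common b0 d0.
have bt0 : b * t != 0.
  rewrite -i_eq0 rmorphM; apply: contraNneq t0 => /(congr1 (fun z => (i b)^-1 * z)).
  by rewrite mulKr ?unitD ?i_eq0 // mulr0 => /eqP; rewrite i_eq0.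
have pbt : p * i (b * t) = i (a * t) by rewrite !rmorphM mulrA pb.
have qbt : q * i (b * t) = i (c * s) by rewrite E !rmorphM mulrA qd.
have pq : (p - q) * i (b * t) = i (a * t - c * s) by rewrite mulrBl pbt qbt raddfB.
apply: (mulIr (uj bt0)); rewrite mulrBl.
by rewrite (frac_extendP bt0 pbt) (frac_extendP bt0 qbt) (frac_extendP bt0 pq) raddfB.
Qed.

Lemma frac_extend_embed a : frac_extend (i a) = j a.
Proof.
have n0 : 1 != 0 :> A by rewrite -i_eq0 rmorph1 oner_eq0.
by have := @frac_extendP (i a) a 1 n0; rewrite !rmorph1 !mulr1; apply.
Qed.

Fact frac_extendM : frac_extend 1 = 1 /\ {morph frac_extend : p q / p * q}.
Proof.
split=> [|p q]; first by rewrite -(rmorph1 i) frac_extend_embed rmorph1.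
have [c [d [d0 qd]]] := frac_den q; have [a [b [b0 pb]]] := frac_den p.
have [c0|c0] := eqVneq c 0.
  have q0 : q = 0.
    apply: (mulIr (x := i d)); first by rewrite unitD // i_eq0.
    by rewrite qd c0 raddf0 mul0r.
  have f0 : frac_extend 0 = 0 by rewrite -{1}(subrr 0) frac_extendB subrr.
  by rewrite q0 mulr0 f0 mulr0.
have [s [t [s0 t0 E]]] := frac_common c0 b0.
have dt0 : d * t != 0.
  rewrite -i_eq0 rmorphM; apply: contraNneq t0 => /(congr1 (fun z => (i d)^-1 * z)).
  by rewrite mulKr ?unitD ?i_eq0 // mulr0 => /eqP; rewrite i_eq0.
have pq : p * q * i (d * t) = i (a * s).
  by rewrite rmorphM !mulrA -[p * q * _]mulrA qd -mulrA -rmorphM E !rmorphM mulrA pb.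
apply: (mulIr (uj dt0)); rewrite (frac_extendP dt0 pq) (rmorphM j a s) (rmorphM j d t) -[RHS]mulrA.
rewrite [frac_extend q * _]mulrA (frac_extendP d0 qd) -(rmorphM j c t) E rmorphM.
by rewrite mulrA (frac_extendP b0 pb).
Qed.

Fact frac_extendZ : scalable frac_extend.
Proof.
move=> a q; rewrite -[a *: q]mulr_algl frac_extendM.2 -iK frac_extend_embed jK.
by rewrite mulr_algl.
Qed.

Lemma frac_extend_inj : injective frac_extend.
Proof.
move=> p q e; apply/eqP; rewrite -subr_eq0; apply/eqP.
have : frac_extend (p - q) = 0 by rewrite frac_extendB e subrr.
have [a [b [b0 ab]]] := frac_den (p - q) => f0.
have := frac_extendP b0 ab; rewrite f0 mul0r => /esym/eqP; rewrite j_eq0 => /eqP a0.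
apply: (mulIr (x := i b)); first by rewrite unitD // i_eq0.
by rewrite ab a0 raddf0 mul0r.
Qed.

Lemma frac_extend_iso :
  (forall q, exists a b, j b != 0 /\ q = j a / j b) ->
  exists f : {lrmorphism D -> F}, bijective f.
Proof.
move=> fracF.
pose m1 := GRing.isZmodMorphism.Build D F frac_extend frac_extendB.
pose m2 := GRing.isMonoidMorphism.Build D F frac_extend frac_extendM.
pose m3 := GRing.isScalable.Build K D F *:%R frac_extend frac_extendZ.
pose f : {lrmorphism D -> F} := HB.pack frac_extend m1 m2 m3.
exists f; have sur q : {p | frac_extend p = q}.
  apply: cid; have [a [b [b0 ->]]] := fracF q; rewrite j_eq0 in b0.
  exists (i a / i b); apply: (mulIr (uj b0)); rewrite mulrVK ?uj //.
  by apply: frac_extendP => //; rewrite mulrVK // unitD // i_eq0.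
exists (fun q => projT1 (sur q)) => [p|q]; last by case: (sur q).
by case: (sur _) => r /= /frac_extend_inj.
Qed.

End FractionsUnique.

Lemma fractions_unique (K : fieldType) (A : pzAlgType K) (D F : unitAlgType K) :
  skew_field_of_fractions A D -> skew_field_of_fractions A F ->
  exists f : {lrmorphism D -> F}, bijective f.
Proof.
move=> [uD [i [iK iI iR _]]] [uF [j [jK jI jR _]]].
exact: (frac_extend_iso uD uF iK jK iI jI iR jR).
Qed.

(** A fraction over A becomes a fraction over B after multiplying numerator and denominator by a
    common factor from B; the two multiple conditions supply it on the right and on the left. *)
Lemma fractions_restrict (K : fieldType) (A B : pzAlgType K) (F : unitAlgType K)
    (h : {rmorphism B -> A}) :
  (forall a : K, h (scalar_of a) = scalar_of a) -> injective h ->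
  (forall a, exists2 b, b != 0 & exists c, h b * a = h c) ->
  (forall a, exists2 b, b != 0 & exists c, a * h b = h c) ->
  skew_field_of_fractions A F -> skew_field_of_fractions B F.
Proof.
move=> hK hI hL hR [uF [i [iK iI iR iL]]]; split=> //.
exists (i \o h); split=> /=.
- by move=> a; rewrite hK iK.
- exact: inj_comp.
- move=> q; have [a [b [b0 ->]]] := iR q.
  (* The factor d brings b into B and d' brings a d into B, so d d' brings both there. *)
  have [d d0 [c ec]] := hR b; have [d' d0' [c' ec']] := hR (a * h d).
  have i0 x : x != 0 -> i (h x) \is a GRing.unit.
    by move=> x0; rewrite uF // -(raddf0 (i \o h)) (inj_eq (inj_comp iI hI)).
  have bdd : b * h d * h d' = h (c * d') by rewrite ec rmorphM.
  have ucd : i (h (c * d')) \is a GRing.unit.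
    by rewrite -bdd !rmorphM !unitrMr ?i0 // uF.
  exists c', (c * d'); split.
    by apply: contraTneq ucd => ->; rewrite unitr0.
  apply: (mulIr ucd); rewrite mulrVK // -bdd -ec' !rmorphM !mulrA mulrVK //.
  by rewrite uF.
- move=> q; have [a [b [b0 ->]]] := iL q.
  have [d d0 [c ec]] := hL b; have [d' d0' [c' ec']] := hL (h d * a).
  have i0 x : x != 0 -> i (h x) \is a GRing.unit.
    by move=> x0; rewrite uF // -(raddf0 (i \o h)) (inj_eq (inj_comp iI hI)).
  have bdd : h d' * (h d * b) = h (d' * c) by rewrite ec rmorphM.
  have ucd : i (h (d' * c)) \is a GRing.unit.
    by rewrite -bdd !rmorphM !unitrMl ?i0 // uF.
  exists c', (d' * c); split.
    by apply: contraTneq ucd => ->; rewrite unitr0.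
  apply: (mulrI ucd); rewrite mulVKr // -bdd -ec' !rmorphM -!mulrA mulVKr //.
  by rewrite uF.
Qed.

Lemma isomorphic_fractions_embed (K : fieldType) (A B : pzAlgType K)
    (h : {rmorphism B -> A}) :
  ore_domain A ->
  (forall a : K, h (scalar_of a) = scalar_of a) -> injective h ->
  (forall a, exists2 b, b != 0 & exists c, h b * a = h c) ->
  (forall a, exists2 b, b != 0 & exists c, a * h b = h c) ->
  isomorphic_fractions B A.
Proof.
move=> oreA hK hI hL hR.
have [F FA] := ore_frac_exists oreA.
split; first by exists F; apply: fractions_restrict FA.
  by exists F.
move=> D G DB GA; apply: fractions_unique DB _.
exact: fractions_restrict GA.
Qed.

(** * Algebras given by generators and relations *)

Section Endomorphisms.
Variables (K : fieldType) (n : nat).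
Local Notation M := {mpoly K[n]}.

(** Linear endomorphisms of the whole polynomial ring, the common target of the representations of
    the Weyl and Cherednik algebras. *)
Record endo := Endo { endo_fun :> M -> M; endo_linear : linear endo_fun }.

HB.instance Definition _ (f : endo) :=
  GRing.isLinear.Build K M M *:%R (endo_fun f) (endo_linear f).

Lemma endoP (f g : endo) : f =1 g -> f = g.
Proof.
case: f g => f fl [g gl] /= /funext e; subst g.
by rewrite (Prop_irrelevance fl gl).
Qed.

HB.instance Definition _ := gen_eqMixin endo.
HB.instance Definition _ := gen_choiceMixin endo.

Definition endo_zero : endo :=
  @Endo \0%R (fun a u v => esym (etrans (addr0 _) (scaler0 _ a))).

Fact endo_add_linear (f g : endo) : linear (f \+ g).
Proof. by move=> a u v /=; rewrite !linearP scalerDr addrACA. Qed.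
Definition endo_add (f g : endo) : endo := Endo (endo_add_linear f g).

Fact endo_opp_linear (f : endo) : linear (\- f).
Proof. by move=> a u v /=; rewrite linearP opprD scalerN. Qed.
Definition endo_opp (f : endo) : endo := Endo (endo_opp_linear f).

Fact endo_mul_linear (f g : endo) : linear (f \o g).
Proof. by move=> a u v /=; rewrite !linearP. Qed.
Definition endo_mul (f g : endo) : endo := Endo (endo_mul_linear f g).

Definition endo_one : endo := @Endo idfun (fun _ _ _ => erefl).

Fact endo_addA : associative endo_add.
Proof. by move=> f g h; apply: endoP => u /=; rewrite addrA. Qed.
Fact endo_addC : commutative endo_add.
Proof. by move=> f g; apply: endoP => u /=; rewrite addrC. Qed.
Fact endo_add0 : left_id endo_zero endo_add.
Proof. by move=> f; apply: endoP => u /=; rewrite add0r. Qed.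
Fact endo_addN : left_inverse endo_zero endo_opp endo_add.
Proof. by move=> f; apply: endoP => u /=; rewrite addNr. Qed.

HB.instance Definition _ :=
  GRing.isZmodule.Build endo endo_addA endo_addC endo_add0 endo_addN.

Fact endo_mulA : associative endo_mul.
Proof. by move=> f g h; apply: endoP. Qed.
Fact endo_mul1 : left_id endo_one endo_mul.
Proof. by move=> f; apply: endoP. Qed.
Fact endo_mulr1 : right_id endo_one endo_mul.
Proof. by move=> f; apply: endoP. Qed.
Fact endo_mulDl : left_distributive endo_mul +%R.
Proof. by move=> f g h; apply: endoP. Qed.
Fact endo_mulDr : right_distributive endo_mul +%R.
Proof. by move=> f g h; apply: endoP => u /=; rewrite raddfD. Qed.
Fact endo_one_neq0 : endo_one != 0.
Proof.
apply/eqP => /(congr1 (fun f : endo => f 1)) /= /eqP; apply/negP.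
exact: oner_neq0.
Qed.

HB.instance Definition _ := GRing.Zmodule_isNzRing.Build endo
  endo_mulA endo_mul1 endo_mulr1 endo_mulDl endo_mulDr endo_one_neq0.

Lemma endoD (f g : endo) u : (f + g) u = f u + g u. Proof. by []. Qed.
Lemma endoN (f : endo) u : (- f) u = - f u. Proof. by []. Qed.
Lemma endoM (f g : endo) u : (f * g) u = f (g u). Proof. by []. Qed.
Lemma endo0 u : (0 : endo) u = 0. Proof. by []. Qed.
Lemma endo_sum I (r : seq I) (P : pred I) (F : I -> endo) u :
  (\sum_(i <- r | P i) F i) u = \sum_(i <- r | P i) F i u.
Proof. exact: (big_morph (fun f : endo => f u) (fun f g => endoD f g u)). Qed.

Fact endo_scalar_linear (a : K) : linear (fun u : M => a *: u).
Proof. by move=> b u v; rewrite scalerDr !scalerA mulrC. Qed.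
Definition endo_scalar (a : K) : endo := Endo (endo_scalar_linear a).

Fact endo_scalarB : {morph endo_scalar : a b / a - b}.
Proof. by move=> a b; apply: endoP => u /=; rewrite scalerBl. Qed.
Fact endo_scalarM : endo_scalar 1 = 1 /\ {morph endo_scalar : a b / a * b}.
Proof.
split=> [|a b]; apply: endoP => u /=; first by rewrite scale1r.
by rewrite scalerA.
Qed.
HB.instance Definition _ := GRing.isZmodMorphism.Build K endo endo_scalar endo_scalarB.
HB.instance Definition _ :=
  GRing.isMonoidMorphism.Build K endo endo_scalar (endo_scalarM.1, endo_scalarM.2).

Section FreeEval.
Variables (G : choiceType) (g : G -> endo).

Definition word_eval (m : monalg.fmonom G) : endo :=
  \prod_(x <- monalg.fmonom_val m) g x.

Fact word_eval_mmorphism : monalg.mmorphism word_eval.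
Proof.
split=> [x y|]; rewrite /word_eval; first by rewrite monalg.fmM big_cat.
by rewrite monalg.fm1 big_nil.
Qed.
HB.instance Definition _ := monalg.isMultiplicative.Build _ endo word_eval
  word_eval_mmorphism.

Definition free_eval : (monalg.malg (monalg.fmonom G) K) -> endo :=
  monalg.mmap endo_scalar word_eval.

Fact free_eval_comm (u : (monalg.malg (monalg.fmonom G) K)) m m' :
  GRing.comm (endo_scalar (monalg.mcoeff m u)) (word_eval m').
Proof. by apply: endoP => p; rewrite !endoM /= linearZ. Qed.

Fact free_eval_monoid : free_eval 1 = 1 /\ {morph free_eval : u v / u * v}.
Proof.
by case: (monalg.commr_mmap_is_multiplicative free_eval_comm) => h h1; split.
Qed.

HB.instance Definition _ :=
  GRing.isZmodMorphism.Build (monalg.malg (monalg.fmonom G) K) endo free_eval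
    (@monalg.mmap_is_additive _ _ _ _ _).
HB.instance Definition _ :=
  GRing.isMonoidMorphism.Build (monalg.malg (monalg.fmonom G) K) endo free_eval
    free_eval_monoid.

Lemma free_eval_gen x : free_eval (fgen x) = g x.
Proof.
rewrite /free_eval /fgen monalg.mmapU /= endo_scalarM.1 mul1r /word_eval.
by rewrite monalg.fmU big_seq1.
Qed.

Lemma free_evalB u v : free_eval (u - v) = free_eval u - free_eval v.
Proof. exact: raddfB. Qed.

Lemma free_evalD u v : free_eval (u + v) = free_eval u + free_eval v.
Proof. exact: raddfD. Qed.

Lemma free_eval_sum I (r : seq I) (P : pred I) F :
  free_eval (\sum_(i <- r | P i) F i) = \sum_(i <- r | P i) free_eval (F i).
Proof. exact: raddf_sum. Qed.

Lemma free_evalM u v : free_eval (u * v) = free_eval u * free_eval v.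
Proof. exact: rmorphM. Qed.

Lemma free_evalBM u v u' v' : free_eval (u * v - u' * v') =
  free_eval u * free_eval v - free_eval u' * free_eval v'.
Proof. by rewrite free_evalB !free_evalM. Qed.

Lemma free_evalM3 u v w : free_eval (u * v * w) = free_eval u * free_eval v * free_eval w.
Proof. by rewrite !free_evalM. Qed.

Lemma free_eval0 : free_eval 0 = 0.
Proof. exact: raddf0. Qed.

Lemma free_eval_nat k : free_eval k%:R = k%:R.
Proof. exact: rmorph_nat. Qed.

Lemma free_eval1 : free_eval 1 = 1.
Proof. exact: rmorph1. Qed.

Lemma free_evalZ a u : free_eval (a *: u) = endo_scalar a * free_eval u.
Proof. exact: monalg.mmapZ. Qed.

Lemma free_evalC a : free_eval (monalg.mkmalgU monalg.mone a) = endo_scalar a.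
Proof. exact: monalg.mmapC. Qed.

Lemma free_eval_lin k c a b : g c = endo_scalar k * g a + g b ->
  free_eval (fgen c) = free_eval (k *: fgen a + fgen b).
Proof. by rewrite free_evalD free_evalZ !free_eval_gen. Qed.

Lemma free_eval_gen1 a : g a = 1 -> free_eval (fgen a) = free_eval 1.
Proof. by rewrite free_eval1 free_eval_gen. Qed.

Lemma free_eval_genM a b c : g a * g b = g c ->
  free_eval (fgen a * fgen b) = free_eval (fgen c).
Proof. by rewrite free_evalM !free_eval_gen. Qed.

Lemma free_eval_genM3 a b c d : g a * g b * g c = g d ->
  free_eval (fgen a * fgen b * fgen c) = free_eval (fgen d).
Proof. by rewrite free_evalM3 !free_eval_gen. Qed.

Lemma free_eval_commutator a b u : g a * g b - g b * g a = free_eval u ->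
  free_eval (fgen a * fgen b - fgen b * fgen a) = free_eval u.
Proof. by rewrite free_evalBM !free_eval_gen. Qed.

Lemma free_eval_comm_gen a b : g a * g b = g b * g a ->
  free_eval (fgen a * fgen b - fgen b * fgen a) = free_eval 0.
Proof. by move=> e; apply: free_eval_commutator; rewrite e subrr free_eval0. Qed.

End FreeEval.

Section PresentedEval.
Variables (G : choiceType) (g : G -> endo).
Variable rel : (monalg.malg (monalg.fmonom G) K) -> (monalg.malg (monalg.fmonom G) K) -> Prop.
Hypothesis relP : forall u v, rel u v -> free_eval g u = free_eval g v.

Lemma free_eval_ideal u : two_sided_ideal rel u -> free_eval g u = 0.
Proof.
elim=> [{}u v /relP e||{}u v _ e1 _ e2|{}u v _ e|{}u v _ e].
- by rewrite raddfB /= e subrr.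
- exact: raddf0.
- by rewrite raddfB /= e1 e2 subrr.
- by rewrite rmorphM /= e mulr0.
- by rewrite rmorphM /= e mul0r.
Qed.

(** The universal property of a presentation, for representations on polynomials. *)
Lemma presented_lift : exists F : {rmorphism presented rel -> endo},
  forall u, F (presented_pi rel u) = free_eval g u.
Proof.
pose F (x : presented rel) := free_eval g (generic_quotient.repr x).
have FE u : F (presented_pi rel u) = free_eval g u.
  apply/eqP; rewrite -subr_eq0 -raddfB; apply/eqP/free_eval_ideal/presented_piP.
  by rewrite presented_reprK.
have FB : {morph F : x y / x - y}.
  move=> x y; rewrite -[x]presented_reprK -[y]presented_reprK -presented_piB.
  by rewrite !FE raddfB.
have FM : F 1 = 1 /\ {morph F : x y / x * y}.
  split=> [|x y]; first by rewrite -(rmorph1 (presented_pi rel)) FE rmorph1.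
  rewrite -[x]presented_reprK -[y]presented_reprK.
  by rewrite -(rmorphM (presented_pi rel)) !FE rmorphM.
pose m1 := GRing.isZmodMorphism.Build (presented rel) endo F FB.
pose m2 := GRing.isMonoidMorphism.Build (presented rel) endo F FM.
by pose F' : {rmorphism presented rel -> endo} := HB.pack F m1 m2; exists F'.
Qed.

End PresentedEval.
End Endomorphisms.

Section PresentedInduction.
Variables (K : fieldType) (G : choiceType).
Variable rel : (monalg.malg (monalg.fmonom G) K) -> (monalg.malg (monalg.fmonom G) K) -> Prop.
Local Notation A := (presented rel).
Local Notation gen x := (presented_pi rel (fgen x)).

Lemma presented_rel u v : rel u v -> presented_pi rel u = presented_pi rel v.
Proof. by move=> h; apply/presented_piP/ideal_rel. Qed.

Lemma presented_pi_commutator u v u' v' w : rel (u * v - u' * v') w ->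
  presented_pi rel u * presented_pi rel v =
  presented_pi rel u' * presented_pi rel v' + presented_pi rel w.
Proof.
move=> /presented_rel <-; rewrite (raddfB (presented_pi rel)) /=.
by rewrite !(rmorphM (presented_pi rel)) /= addrC subrK.
Qed.

Lemma presented_piZ a u : presented_pi rel (a *: u) = scalar_of a * presented_pi rel u.
Proof. by rewrite -monalg.mul_malgC rmorphM. Qed.

Lemma presented_pi_lin w a u v : rel w (a *: u + v) ->
  presented_pi rel w = scalar_of a * presented_pi rel u + presented_pi rel v.
Proof. by move=> /presented_rel->; rewrite presented_piD presented_piZ. Qed.

Lemma presented_pi_mul u v w : rel (u * v) w ->
  presented_pi rel u * presented_pi rel v = presented_pi rel w.
Proof. by move=> /presented_rel <-; rewrite (rmorphM (presented_pi rel)). Qed.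

Lemma presented_pi_mul3 u v u' w : rel (u * v * u') w ->
  presented_pi rel u * presented_pi rel v * presented_pi rel u' = presented_pi rel w.
Proof. by move=> /presented_rel <-; rewrite !(rmorphM (presented_pi rel)). Qed.

Lemma presented_pi_comm u v : rel (u * v - v * u) 0 ->
  presented_pi rel u * presented_pi rel v = presented_pi rel v * presented_pi rel u.
Proof. by move=> /presented_pi_commutator ->; rewrite raddf0 addr0. Qed.

Lemma presented_pi_eq1 u : rel u 1 -> presented_pi rel u = 1.
Proof. by move=> /presented_rel ->. Qed.

Lemma presented_pi_sum I (r : seq I) (P : pred I) F :
  presented_pi rel (\sum_(i <- r | P i) F i) =
  \sum_(i <- r | P i) presented_pi rel (F i).
Proof. exact: (raddf_sum (presented_pi rel)). Qed.

Lemma presented_words (x : A) : exists r : seq (K * seq G),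
  x = \sum_(t <- r) scalar_of t.1 * \prod_(y <- t.2) gen y.
Proof.
rewrite -[x]presented_reprK; move: (generic_quotient.repr x) => {x} u.
exists [seq (monalg.mcoeff k u, monalg.fmonom_val k) | k <- finmap.enum_fset (monalg.msupp u)].
rewrite big_map {1}[u]monalg.monalgE rmorph_sum; apply: eq_bigr => m _ /=.
have -> : monalg.mkmalgU m (monalg.mcoeff m u) =
    monalg.mcoeff m u *: monalg.mkmalgU m 1.
  by apply/monalg.malgP => k; rewrite monalg.mcoeffZ !monalg.mcoeffU mulr_natr.
rewrite presented_piZ; congr (_ * _); case: m => s.
elim: s => [|y s IHs] /=.
  by rewrite big_nil -(rmorph1 (presented_pi rel)) -monalg.fmoneE.
rewrite big_cons -IHs -rmorphM /fgen; congr (presented_pi rel _).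
rewrite monalg.malgM_def monalg.fgmulUU mulr1; congr (monalg.mkmalgU _ _).
by rewrite -[RHS]/(monalg.fmmul _ _) monalg.fmmulE monalg.fmuE.
Qed.

(** Words are built by adding generators on the left of a fixed z. With z = 1 this is induction on
    A; with z = e it will be induction on the left ideal He. *)
Lemma presented_ind_l (P : A -> Prop) (z : A) :
  P z -> (forall x y, P x -> P y -> P (x + y)) ->
  (forall a x, P x -> P (scalar_of a * x)) ->
  (forall g x, P x -> P (gen g * x)) -> forall x, P (x * z).
Proof.
move=> Pz PD PZ PG x; have [r ->] := presented_words x.
elim: r => [|[a s] r IHr].
  by rewrite big_nil -(@scalar_of0 K A); refine (PZ 0 _ Pz).
rewrite big_cons mulrDl; refine (PD _ _ _ IHr) => {IHr}; rewrite -mulrA.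
refine (PZ a _ _); elim: s => [|y s IHs] /=; first by rewrite big_nil mul1r.
by rewrite big_cons -mulrA; exact: (PG y _ IHs).
Qed.

Lemma presented_ind_r (P : A -> Prop) (z : A) :
  P z -> (forall x y, P x -> P y -> P (x + y)) ->
  (forall a x, P x -> P (scalar_of a * x)) ->
  (forall g x, P x -> P (x * gen g)) -> forall x, P (z * x).
Proof.
move=> Pz PD PZ PG x; have [r ->] := presented_words x.
elim: r => [|[a s] r IHr].
  by rewrite big_nil mulr0 -(mul0r z) -(@scalar_of0 K A); refine (PZ 0 _ Pz).
rewrite big_cons mulrDr; refine (PD _ _ _ IHr) => {IHr}.
rewrite mulrA -scalar_of_central -mulrA; refine (PZ a _ _) => /=.
elim/last_ind: s => [|s y IHs]; first by rewrite big_nil mulr1.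
by rewrite -cats1 big_cat /= big_seq1 mulrA; exact: (PG y _ IHs).
Qed.

End PresentedInduction.

Section CommutingEval.
Variables (K : fieldType) (n : nat) (A : pzAlgType K) (h : 'I_n -> A).
Hypothesis hC : forall i j, h i * h j = h j * h i.

Lemma commuting_eval : exists F : {rmorphism {mpoly K[n]} -> A},
  (forall a, F a%:MP = scalar_of a) /\ forall i, F 'X_i = h i.
Proof.
(* An algebra given by a presentation may be zero, while [mmap] needs a nonzero target ring. *)
have [A0|A1] := eqVneq (1 : A) 0.
  have z (x y : A) : x = y by rewrite -[x]mul1r -[y]mul1r A0 !mul0r.
  pose F (p : {mpoly K[n]}) : A := 0.
  pose m1 := GRing.isZmodMorphism.Build {mpoly K[n]} A F (fun _ _ => z _ _).
  pose m2 := GRing.isMonoidMorphism.Build {mpoly K[n]} A F (z _ _, fun _ _ => z _ _).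
  pose F' : {rmorphism {mpoly K[n]} -> A} := HB.pack F m1 m2.
  by exists F'; split=> *; apply: z.
pose mx := GRing.PzSemiRing_isNonZero.Build A A1.
pose A' : nzRingType := HB.pack A mx.
pose sc : K -> A' := @scalar_of K A.
pose s1 := GRing.isZmodMorphism.Build K A' sc (@scalar_of_is_zmod_morphism K A).
pose s2 := GRing.isMonoidMorphism.Build K A' sc
  (let: conj a b := @scalar_of_is_monoid_morphism K A in (a, b)).
pose f : {rmorphism K -> A'} := HB.pack sc s1 s2.
pose F : {mpoly K[n]} -> A' := mmap f (h : 'I_n -> A').
have hC' (i j : 'I_n) : GRing.comm (h i : A') (h j) by apply: hC.
have fC (p : {mpoly K[n]}) m m' : GRing.comm (f p@_m) (mmap1 (h : 'I_n -> A') m').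
  by rewrite /GRing.comm; apply: (@scalar_of_central K A).
have hM m m' : mmap1 (h : 'I_n -> A') (m + m') = mmap1 (h : 'I_n -> A') m * mmap1 (h : 'I_n -> A') m'.
  rewrite /mmap1 -prodrM_comm => [|i j _ _]; last by apply/commrX/commr_sym/commrX.
  by apply: eq_bigr => i _; rewrite mnmDE exprD.
have FD : {morph F : p q / p + q} by apply: mmapD.
have FS (r : seq 'X_{1..n}) G : F (\sum_(m <- r) G m) = \sum_(m <- r) F (G m).
  by apply: (big_morph F FD); apply: mmap0.
have FZ c m : F (c *: 'X_[m]) = f c * mmap1 (h : 'I_n -> A') m.
  by rewrite /F mmapZ mmapX.
have FM : F 1 = 1 /\ {morph F : p q / p * q}.
  split=> [|p q]; first by rewrite -mpolyC1 /F mmapC; apply: (@scalar_of1 K A).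
  rewrite [p in LHS]mpolyE [q in LHS]mpolyE mulr_suml FS mulr_suml.
  apply: eq_bigr => m _; rewrite mulr_sumr FS mulr_sumr; apply: eq_bigr => m' _.
  rewrite -scalerAl -scalerAr scalerA -mpolyXD FZ rmorphM hM -!mulrA.
  by congr (_ * _); rewrite !mulrA fC.
pose m1 := GRing.isZmodMorphism.Build {mpoly K[n]} A F (@mmap_is_additive _ _ _ _ f).
pose m2 := GRing.isMonoidMorphism.Build {mpoly K[n]} A F FM.
pose F' : {rmorphism {mpoly K[n]} -> A} := HB.pack F m1 m2.
exists F'; split=> [a|i] /=; first exact: (@mmapC _ _ _ (h : 'I_n -> A') f a).
by rewrite /F mmapX mmap1U.
Qed.

End CommutingEval.

Lemma mpoly_ring_ind (R : nzRingType) n (P : {mpoly R[n]} -> Prop) :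
  (forall c, P c%:MP) -> (forall p q, P p -> P q -> P (p + q)) ->
  (forall i p, P p -> P ('X_i * p)) -> forall p, P p.
Proof.
move=> PC PD PX; elim/mpolyind => [|c m p _ _ IHp]; first by rewrite -mpolyC0.
apply: PD => // {p IHp}; elim: {m}(mdeg m) {-2}m (erefl (mdeg m)) => [|d IHd] m.
  by move/eqP; rewrite mdeg_eq0 => /eqP ->; rewrite mpolyX0 alg_mpolyC.
move=> md; have [i mi] : exists i, m i != 0%N.
  apply/existsP; apply: contraT; rewrite negb_exists => /forallP m0.
  have : mdeg m = 0%N by rewrite mdegE big1 // => i _; apply/eqP; rewrite -[_ == _]negbK.
  by rewrite md.
have e : m = (U_(i) + (m - U_(i)))%MM by rewrite addmC submK // lep1mP.
have -> : c *: 'X_[m] = 'X_i * (c *: 'X_[m - U_(i)]) :> {mpoly R[n]}.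
  rewrite {1}e mpolyXD -!mul_mpolyC !mulrA; congr (_ * _).
  exact: commr_mpolyX.
apply/PX/IHd; have := congr1 mdeg e.
by rewrite mdegD mdeg1 md add1n => -[].
Qed.

(** * Linear substitutions in polynomials *)

Lemma subUU n (i : 'I_n) : (U_(i) - U_(i) = 0)%MM.
Proof. by rewrite -{1}[U_(i)%MM]add0m addmK. Qed.

Section MultivariatePolynomials.
Variable R : idomainType.
Implicit Types (n k d : nat).

Lemma msize_leP n (p : {mpoly R[n]}) d :
  (forall m, m \in msupp p -> mdeg m < d)%N -> (msize p <= d)%N.
Proof. by move=> h; rewrite msizeE; apply/bigmax_leqP_seq => m /h. Qed.

Lemma dhomog_msize_le n (p : {mpoly R[n]}) d : p \is d.-homog -> (msize p <= d.+1)%N.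
Proof. by move=> /dhomogP h; apply: msize_leP => m /h ->. Qed.

Lemma dhomog_bigprod n I (r : seq I) (F : I -> {mpoly R[n]}) (e : I -> nat) :
  (forall i, F i \is (e i).-homog) ->
  \prod_(i <- r) F i \is (\sum_(i <- r) e i).-homog.
Proof.
move=> h; elim: r => [|i r IHr]; first by rewrite !big_nil dhomog1.
by rewrite !big_cons dhomogM.
Qed.

Lemma comp_mpolyX_homog n k (lq : n.-tuple {mpoly R[k]}) m :
  (forall i, tnth lq i \is 1.-homog) -> 'X_[m] \mPo lq \is (mdeg m).-homog.
Proof.
move=> h; rewrite comp_mpolyX mdegE; apply: dhomog_bigprod => i.
by have := dhomogMn (m i) (h i); rewrite mul1n.
Qed.

Lemma comp_mpoly_homog n k (lq : n.-tuple {mpoly R[k]}) d p :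
  (forall i, tnth lq i \is 1.-homog) -> p \is d.-homog -> p \mPo lq \is d.-homog.
Proof.
move=> h /dhomogP pd; rewrite comp_mpolyEX big_seq; apply: rpred_sum => m mp.
by apply: rpredZ; rewrite -(pd _ mp); apply: comp_mpolyX_homog.
Qed.

Lemma msize_sum_le n I (r : seq I) (P : pred I) (F : I -> {mpoly R[n]}) d :
  (forall i, P i -> msize (F i) <= d)%N -> (msize (\sum_(i <- r | P i) F i) <= d)%N.
Proof.
move=> h; apply: (big_ind (fun p => msize p <= d)%N) => //; first by rewrite msize0.
by move=> p q pd qd; rewrite (leq_trans (msizeD_le _ _)) // geq_max pd.
Qed.

Lemma msizeB_le n (p q : {mpoly R[n]}) d :
  (msize p <= d -> msize q <= d -> msize (p - q) <= d)%N.
Proof.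
move=> pd qd; rewrite (leq_trans (msizeD_le _ _)) // geq_max msizeN.
by apply/andP.
Qed.

Lemma msize_comp_mpoly n k (lq : n.-tuple {mpoly R[k]}) p :
  (forall i, tnth lq i \is 1.-homog) -> (msize (p \mPo lq) <= msize p)%N.
Proof.
move=> h; rewrite comp_mpolyEX big_seq; apply: msize_sum_le => m mp.
apply: leq_trans (msizeZ_le _ _) _; apply: leq_trans (msize_mdeg_lt mp).
exact/dhomog_msize_le/comp_mpolyX_homog.
Qed.

Lemma mderiv_comp n k (lq : n.-tuple {mpoly R[k]}) (l : 'I_k) p :
  (p \mPo lq)^`M(l) = \sum_(i < n) (p^`M(i) \mPo lq) * (tnth lq i)^`M(l).
Proof.
have FM a b : (a * b) \mPo lq = (a \mPo lq) * (b \mPo lq) by exact: rmorphM.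
elim/mpoly_ring_ind: p => [c|p q IHp IHq|j p IHp].
- rewrite comp_mpolyC mderivC big1 // => i _.
  by rewrite mderivC raddf0 mul0r.
- rewrite raddfD mderivD IHp IHq -big_split; apply: eq_bigr => i _.
  by rewrite mderivD raddfD mulrDl.
- rewrite FM mderivM IHp comp_mpolyXU -tnth_nth.
  under [RHS]eq_bigr => i _ do
    rewrite mderivM mderivX mnm1E comp_mpolyD !FM comp_mpolyXU -tnth_nth mulrDl.
  rewrite big_split; congr (_ + _); last first.
    by rewrite mulr_sumr; apply: eq_bigr => i _; rewrite mulrA.
  rewrite (bigD1 j) //= eqxx scale1r subUU mpolyX0 comp_mpoly1 mul1r.
  rewrite big1 => [|i ij]; first by rewrite addr0 mulrC.
  by rewrite eq_sym (negPf ij) scale0r raddf0 !mul0r.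
Qed.

Lemma mpoly_euler n d (p : {mpoly R[n]}) : p \is d.-homog ->
  \sum_(i < n) 'X_i * p^`M(i) = d%:R *: p.
Proof.
move=> /dhomogP pd; rewrite {2}[p]mpolyE scaler_sumr.
under eq_bigr => i _ do rewrite {1}[p]mpolyE raddf_sum mulr_sumr.
rewrite exchange_big /= big_seq [RHS]big_seq; apply: eq_bigr => m mp.
rewrite -(pd _ mp) /= mdegE natr_sum scaler_suml; apply: eq_bigr => i _.
rewrite mderivZ mderivX -!scalerAr scalerA mulrC -scalerA.
have [->|mi] := eqVneq (m i) 0%N; first by rewrite !scale0r.
by rewrite -mpolyXD addmC submK // lep1mP.
Qed.

End MultivariatePolynomials.

Lemma mcoeff0M (R : nzRingType) n (p q : {mpoly R[n]}) :
  (p * q)@_0%MM = p@_0%MM * q@_0%MM.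
Proof. exact: rmorphM. Qed.

Section LinearSubstitution.
Variables (C : idomainType) (n : nat).
Local Notation S := {mpoly C[n]}.

Definition linear_form (v : 'rV[C]_n) : S := \sum_j v 0 j *: 'X_j.

Fact lsub_key : unit. Proof. exact: tt. Qed.

Definition lsub (A : 'M[C]_n) : S -> S :=
  locked_with lsub_key (comp_mpoly [tuple linear_form (row i A) | i < n]).

Lemma lsubE A : lsub A = comp_mpoly [tuple linear_form (row i A) | i < n].
Proof. exact: unlock. Qed.

Fact lsub_is_zmod_morphism A : {morph lsub A : p q / p - q}.
Proof. by move=> p q; rewrite lsubE raddfB. Qed.

Fact lsub_is_monoid_morphism A : lsub A 1 = 1 /\ {morph lsub A : p q / p * q}.
Proof. by rewrite lsubE; split=> [|p q]; rewrite ?comp_mpoly1 // rmorphM. Qed.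

Fact lsub_is_scalable A : scalable (lsub A).
Proof. by move=> c p; rewrite lsubE comp_mpolyZ. Qed.

HB.instance Definition _ A :=
  GRing.isZmodMorphism.Build S S (lsub A) (lsub_is_zmod_morphism A).
HB.instance Definition _ A :=
  GRing.isMonoidMorphism.Build S S (lsub A) (lsub_is_monoid_morphism A).
HB.instance Definition _ A :=
  GRing.isScalable.Build C S S *:%R (lsub A) (lsub_is_scalable A).

Lemma lsubC A c : lsub A c%:MP = c%:MP.
Proof. by rewrite lsubE comp_mpolyC. Qed.

Lemma linear_form_homog v : linear_form v \is 1.-homog.
Proof. by apply: rpred_sum => j _; apply: rpredZ; rewrite dhomogX /= mdeg1. Qed.

Fact linear_form_is_linear : linear linear_form.
Proof.
move=> a u v; rewrite scaler_sumr -big_split; apply: eq_bigr => j _ /=.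
by rewrite !mxE scalerDl scalerA.
Qed.
HB.instance Definition _ :=
  GRing.isLinear.Build C 'rV[C]_n S *:%R linear_form linear_form_is_linear.

Lemma linear_form_coef v j : (linear_form v)@_U_(j) = v 0 j.
Proof.
rewrite raddf_sum (bigD1 j) //= mcoeffZ mcoeffXU eqxx mulr1 big1 ?addr0 // => i ij.
by rewrite mcoeffZ mcoeffXU (negPf ij) mulr0.
Qed.

Lemma linear_form_inj : injective linear_form.
Proof. by move=> u v e; apply/rowP => j; rewrite -!linear_form_coef e. Qed.

Lemma lsubX A i : lsub A 'X_i = linear_form (row i A).
Proof. by rewrite lsubE comp_mpolyXU -tnth_nth tnth_mktuple. Qed.

Lemma lsub_form A v : lsub A (linear_form v) = linear_form (v *m A).
Proof.
rewrite raddf_sum /=.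
under eq_bigr => i _ do rewrite linearZ /= lsubX -linearZ.
rewrite -raddf_sum /=; congr linear_form; apply/rowP => j.
by rewrite summxE mxE; apply: eq_bigr => i _; rewrite !mxE.
Qed.

Lemma lsub_ext (f g : {lrmorphism S -> S}) : (forall i, f 'X_i = g 'X_i) -> f =1 g.
Proof.
move=> h; elim/mpoly_ring_ind => [c|p q e1 e2|i p e].
- by rewrite -alg_mpolyC !linearZ /= !rmorph1.
- by rewrite !raddfD /= e1 e2.
- by rewrite !rmorphM /= h e.
Qed.

Lemma linear_formX i : linear_form (delta_mx 0 i) = 'X_i.
Proof.
rewrite /linear_form (bigD1 i) //= mxE !eqxx scale1r big1 ?addr0 // => j ji.
by rewrite mxE (negPf ji) andbF scale0r.
Qed.

(** Substitution reverses products. This is why the matrices of a group are later required to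
    satisfy M (g h) = M h M g: the substitutions then form a left action. *)
Lemma lsubM A B p : lsub A (lsub B p) = lsub (B *m A) p.
Proof.
apply: (lsub_ext (f := lsub A \o lsub B) (g := lsub (B *m A))) => i /=.
by rewrite -linear_formX !lsub_form mulmxA.
Qed.

Lemma lsub1 p : lsub 1%:M p = p.
Proof.
by apply: (lsub_ext (f := lsub 1%:M) (g := idfun)) => i /=; rewrite -linear_formX lsub_form mulmx1.
Qed.

Lemma lsub_homog A p d : p \is d.-homog -> lsub A p \is d.-homog.
Proof.
by rewrite lsubE; apply: comp_mpoly_homog => i; rewrite tnth_mktuple linear_form_homog.
Qed.

Lemma msize_lsub A p : (msize (lsub A p) <= msize p)%N.
Proof.
by rewrite lsubE; apply: msize_comp_mpoly => i; rewrite tnth_mktuple linear_form_homog.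
Qed.

Lemma mderiv_form v l : (linear_form v)^`M(l) = (v 0 l)%:MP.
Proof.
rewrite raddf_sum (bigD1 l) //= mderivZ mderivX mnm1E eqxx scale1r.
rewrite subUU mpolyX0 alg_mpolyC big1 ?addr0 // => i il.
by rewrite mderivZ mderivX mnm1E (negPf il) scale0r scaler0.
Qed.

Lemma mderiv_lsub A p l : (lsub A p)^`M(l) = \sum_i A i l *: lsub A p^`M(i).
Proof.
rewrite lsubE mderiv_comp; apply: eq_bigr => i _.
by rewrite tnth_mktuple mderiv_form mulrC mul_mpolyC mxE.
Qed.

Lemma lsub_const A p : (lsub A p)@_0%MM = p@_0%MM.
Proof.
elim/mpoly_ring_ind: p => [c|p q e1 e2|i p _]; first by rewrite lsubC.
  by rewrite !raddfD /= e1 e2.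
rewrite [lsub A _]rmorphM /= !mcoeff0M lsubX mcoeffX mnm1_eq0 mul0r.
rewrite raddf_sum /= big1 ?mul0r // => j _.
by rewrite mcoeffZ mcoeffX mnm1_eq0 mulr0.
Qed.

End LinearSubstitution.

(** * Flatness over the invariants *)

Section Invariants.
Variables (C : numFieldType) (n : nat) (W : finGroupType) (M : W -> 'M[C]_n).
Hypothesis M1 : M 1%g = 1%:M.
Hypothesis MM : forall g h, M (g * h)%g = M h *m M g.
Local Notation S := {mpoly C[n]}.
Local Notation act w := (lsub (M w)).

Definition invariant (p : S) : Prop := forall w, act w p = p.

(** The Reynolds operator. *)
Definition average (p : S) : S := #|W|%:R^-1 *: \sum_w act w p.

Lemma act1 p : act 1%g p = p. Proof. by rewrite M1 lsub1. Qed.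

Lemma actM g h p : act (g * h)%g p = act g (act h p).
Proof. by rewrite MM lsubM. Qed.

Lemma act_inj w : injective (act w).
Proof.
by move=> p q /(congr1 (act w^-1%g)); rewrite -!actM mulVg !act1.
Qed.

Lemma cardW_neq0 : #|W|%:R != 0 :> C.
Proof. by rewrite pnatr_eq0 -lt0n; apply/card_gt0P; exists 1%g. Qed.

Lemma invariantZ c p : invariant p -> invariant (c *: p).
Proof. by move=> hp w; rewrite linearZ /= hp. Qed.

Lemma invariantC c : invariant c%:MP.
Proof. by move=> w; rewrite lsubC. Qed.

Lemma invariant_sum I (r : seq I) (P : pred I) (F : I -> S) :
  (forall i, P i -> invariant (F i)) -> invariant (\sum_(i <- r | P i) F i).
Proof.
by move=> h w; rewrite raddf_sum; apply: eq_bigr => i Pi; apply: (h i Pi w).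
Qed.

Fact average_is_linear : linear average.
Proof.
move=> a p q; rewrite /average scalerA mulrC -scalerA -scalerDr; congr (_ *: _).
by rewrite scaler_sumr -big_split; apply: eq_bigr => w _; rewrite linearP.
Qed.
HB.instance Definition _ := GRing.isLinear.Build C S S *:%R average average_is_linear.

Lemma average_inv p : invariant (average p).
Proof.
move=> w; rewrite /average linearZ raddf_sum /=; congr (_ *: _).
rewrite [RHS](reindex_inj (mulgI w)).
by apply: eq_bigr => g _; rewrite actM.
Qed.

Lemma average_id p : invariant p -> average p = p.
Proof.
move=> hp; rewrite /average (eq_bigr (fun=> p)) => [|w _]; last exact: hp.
by rewrite sumr_const -scaler_nat scalerA mulVf ?scale1r // cardW_neq0.
Qed.

Lemma averageM p q : invariant p -> average (p * q) = p * average q.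
Proof.
move=> hp; rewrite /average -scalerAr mulr_sumr; congr (_ *: _).
by apply: eq_bigr => w _; rewrite rmorphM /= hp.
Qed.

Lemma average_const p : (average p)@_0%MM = p@_0%MM.
Proof.
rewrite mcoeffZ raddf_sum (eq_bigr (fun=> p@_0%MM)) => [|w _]; last exact: lsub_const.
by rewrite sumr_const -[p@_0%MM *+ _]mulr_natl mulrA mulVf ?mul1r // cardW_neq0.
Qed.

Lemma norm_neq0 p : p != 0 -> \prod_w act w p != 0.
Proof.
move=> p0; apply/prodf_neq0 => w _.
by rewrite -(raddf0 (act w)) (inj_eq (@act_inj w)).
Qed.

Lemma norm_inv p : invariant (\prod_w act w p).
Proof.
move=> w; rewrite rmorph_prod /= [RHS](reindex_inj (mulgI w)).
by apply: eq_bigr => g _; rewrite actM.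
Qed.

(** The square R_+^2 of the ideal R_+ of invariants without constant term. *)
Inductive decomposable : S -> Prop :=
| decomposableM u v : invariant u -> invariant v -> u@_0%MM = 0 -> v@_0%MM = 0 ->
    decomposable (u * v)
| decomposableD p q : decomposable p -> decomposable q -> decomposable (p + q).

Lemma decomposable0 : decomposable 0.
Proof.
by rewrite -(mul0r 0); apply: decomposableM; rewrite ?mcoeff0 // -mpolyC0; apply: invariantC.
Qed.

Lemma decomposableZ c p : decomposable p -> decomposable (c *: p).
Proof.
elim=> [u v hu hv u0 v0|{}p q _ hp _ hq]; last first.
  by rewrite scalerDr; apply: decomposableD.
rewrite scalerAl; apply: decomposableM => //; first exact: invariantZ.
by rewrite mcoeffZ u0 mulr0.
Qed.

Lemma decomposable_sum I (r : seq I) (F : I -> S) :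
  (forall i, decomposable (F i)) -> decomposable (\sum_(i <- r) F i).
Proof.
move=> h; elim: r => [|i r IHr]; first by rewrite big_nil; apply: decomposable0.
by rewrite big_cons; apply: decomposableD.
Qed.

Section Flatness.
Variables (Refl : {set W}).
Hypothesis genW : <<Refl>>%g = [set: W].
Hypothesis reflP : forall s, s \in Refl ->
  exists2 v : 'rV[C]_n, v != 0 & forall i, exists c,
    act s 'X_i - 'X_i = c *: linear_form v.

(** Divided differences: s p - p is divisible by the linear form that spans the moved line, and the
    quotient has smaller degree. *)
Lemma refl_divides s : s \in Refl -> exists a : S, a != 0 /\
  forall p, exists2 q, act s p - p = a * q & (msize q <= (msize p).-1)%N.
Proof.
move=> /reflP[v v0 vX]; have a0 : linear_form v != 0.
  by rewrite -(raddf0 (@linear_form C n)) (inj_eq (@linear_form_inj _ _)).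
exists (linear_form v); split=> // p.
have [q e] : exists q, act s p - p = linear_form v * q.
  elim/mpoly_ring_ind: p => [c|p p' [q e] [q' e']|i p [q e]].
  - by exists 0; rewrite mulr0 lsubC subrr.
  - by exists (q + q'); rewrite raddfD /= opprD addrACA e e' mulrDr.
  - have [c ec] := vX i; exists (c *: act s p + 'X_i * q).
    rewrite mulrDr -scalerAr scalerAl -ec mulrBl mulrCA -e mulrBr.
    by rewrite rmorphM /= addrA subrK.
exists q => //; have [->|q0] := eqVneq q 0; first by rewrite msize0.
have a2 : msize (linear_form v) = 2.
  apply/eqP; rewrite eqn_leq dhomog_msize_le ?linear_form_homog //=.
  rewrite ltnNge; apply/negP => a1.
  have h : linear_form v \is 0.-homog by rewrite (msize1_polyC a1) -alg_mpolyC rpredZ ?dhomog1.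
  by have := dhomog_uniq a0 h (linear_form_homog v).
have : (msize (act s p - p) <= msize p)%N by apply: msizeB_le (msize_lsub _ _) (leqnn _).
by rewrite e msizeM // a2 add2n /=; case: (msize p).
Qed.

Variables (m : nat) (h : 'I_m -> S).
Hypothesis h_inv : forall i, invariant (h i).

(* Flatness of S over the invariants, in the form used here: every relation   *)
(* between the invariants [h i] is in [relation_span].                        *)
Inductive relation_span : 'rV[S]_m -> Prop :=
| relation_span_inv (r : 'rV[S]_m) : (forall i, invariant (r 0 i)) ->
    \sum_i h i * r 0 i = 0 -> relation_span r
| relation_spanD (r r' : 'rV[S]_m) : relation_span r -> relation_span r' -> relation_span (r + r')
| relation_spanZ (c : S) (r : 'rV[S]_m) : relation_span r -> relation_span (c *: r).

Lemma relation_span0 : relation_span 0.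
Proof.
apply: relation_span_inv => [i|]; first by rewrite mxE -mpolyC0; apply: invariantC.
by rewrite big1 // => i _; rewrite mxE mulr0.
Qed.

Lemma relation_span_sum I (r : seq I) (F : I -> 'rV[S]_m) :
  (forall i, relation_span (F i)) -> relation_span (\sum_(i <- r) F i).
Proof.
move=> hF; elim: r => [|i r IHr]; first by rewrite big_nil; apply: relation_span0.
by rewrite big_cons; apply: relation_spanD.
Qed.

Local Notation vact w g := (map_mx (act w) g).

Lemma relation_span_act w (r : 'rV[S]_m) : relation_span r -> relation_span (vact w r).
Proof.
elim=> [{}r rI rR|{}r r' _ hr _ hr'|c {}r _ hr].
- have -> : vact w r = r by apply/rowP => i; rewrite mxE rI.
  exact: relation_span_inv.
- by rewrite map_mxD; apply: relation_spanD.
- by rewrite map_mxZ; apply: relation_spanZ.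
Qed.

(** Induction on the degree of g. Since the [h i] are invariant, the divided difference of g along a
    reflection is a relation of smaller degree, so s g = g modulo the span. As reflections generate
    W, g equals its average modulo the span, and the average is an invariant relation. *)
Lemma relation_flat d (g : 'rV[S]_m) : (forall i, (msize (g 0%R i) <= d)%N) ->
  \sum_i h i * g 0 i = 0 -> relation_span g.
Proof.
elim: d g => [|d IHd] g gd gR.
  have -> : g = 0.
    apply/rowP => i; rewrite mxE; apply/eqP.
    by rewrite -msize_poly_eq0 -leqn0 gd.
  exact: relation_span0.
have hs s : s \in Refl -> relation_span (vact s g - g).
  move=> /refl_divides[a [a0 aP]].
  have q_ i : {q | act s (g 0 i) - g 0 i = a * q & (msize q <= (msize (g 0%R i)).-1)%N}.
    by apply: cid2; apply: aP.
  pose q := \row_i s2val (q_ i).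
  have qE : vact s g - g = a *: q.
    by apply/rowP => i; rewrite !mxE; case: (q_ i).
  rewrite qE; apply/relation_spanZ/IHd => [i|].
    rewrite mxE; case: (q_ i) => /= x _ hx; apply: leq_trans hx _.
    by have := gd i; case: (msize _).
  apply: (mulfI a0); rewrite mulr0 mulr_sumr.
  transitivity (act s (\sum_i h i * g 0 i) - \sum_i h i * g 0 i).
    rewrite (raddf_sum (act s)) -sumrB; apply: eq_bigr => i _ /=.
    rewrite (rmorphM (act s)) /= h_inv -mulrBr mulrCA; congr (_ * _).
    by have /rowP/(_ i) := qE; rewrite !mxE => <-.
  by rewrite gR raddf0 subrr.
(* A general w is a product of reflections, and u v g - g = u (v g - g) + (u g - g). *)
have hw w : relation_span (vact w g - g).
  have : w \in <<Refl>>%g by rewrite genW inE.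
  case/gen_prodgP => k [c cR ->].
  apply: (big_ind (fun w => relation_span (vact w g - g))) => [|u v hu hv|i _].
  - have -> : vact 1%g g = g by apply/rowP => i; rewrite mxE act1.
    by rewrite subrr; apply: relation_span0.
  - have -> : vact (u * v)%g g - g = vact u (vact v g - g) + (vact u g - g).
      rewrite map_mxB addrA subrK; congr (_ - _); apply/rowP => i.
      by rewrite [LHS]mxE [RHS]mxE [in RHS]mxE actM.
    by apply: relation_spanD => //; apply: relation_span_act.
  - exact: hs.
have gE : g = map_mx average g - (#|W|%:R^-1)%:MP *: \sum_w (vact w g - g).
  apply/rowP => i; rewrite mxE [X in X + _]mxE [X in _ + X]mxE [X in _ - X]mxE.
  rewrite mul_mpolyC summxE.
  under eq_bigr => w _ do rewrite !mxE.
  rewrite sumrB scalerBr sumr_const -scaler_nat scalerA mulVf ?cardW_neq0 //.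
  by rewrite scale1r opprB addrC subrK.
rewrite gE -scaleNr; apply: relation_spanD; last first.
  by apply/relation_spanZ/relation_span_sum.
apply: relation_span_inv => [i|]; first by rewrite mxE; apply: average_inv.
transitivity (average (\sum_i h i * g 0 i)); last by rewrite gR raddf0.
rewrite (raddf_sum average); apply: eq_bigr => i _ /=.
by rewrite mxE averageM.
Qed.

End Flatness.
End Invariants.

(** * Linear independence of the gradients of indecomposable invariants *)

Section Gradients.
Variables (C : numFieldType) (n : nat) (W : finGroupType) (M : W -> 'M[C]_n).
Hypothesis M1 : M 1%g = 1%:M.
Hypothesis MM : forall g h, M (g * h)%g = M h *m M g.
Local Notation S := {mpoly C[n]}.
Local Notation act w := (lsub (M w)).
Local Notation invariant := (invariant M).
Local Notation average := (average M).
Local Notation decomposable := (decomposable M).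
Variables (Refl : {set W}).
Hypothesis genW : <<Refl>>%g = [set: W].
Hypothesis reflP : forall s, s \in Refl ->
  exists2 v : 'rV[C]_n, v != 0 & forall i, exists c,
    act s 'X_i - 'X_i = c *: linear_form v.

(** Homogeneous invariants of positive degree whose classes in R_+ / R_+^2 are linearly
    independent. *)
Record indecomposable_family m (f : 'I_m -> S) (deg : 'I_m -> nat) : Prop :=
  IndecomposableFamily {
    family_inv : forall i, invariant (f i);
    family_homog : forall i, f i \is (deg i).-homog;
    family_deg : forall i, (0 < deg i)%N;
    family_indep : forall c : 'I_m -> C,
      decomposable (\sum_i c i *: f i) -> forall i, c i = 0
  }.

Section Family.
Variables (m : nat) (f : 'I_m -> S) (deg : 'I_m -> nat).
Hypothesis fP : indecomposable_family f deg.

Section InvariantRelation.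
Variable h : 'I_m -> S.
Hypothesis h_inv : forall i, invariant (h i).
Hypothesis h_rel : forall l, \sum_i h i * (f i)^`M(l) = 0.

(* If all invariant relations r between the h_i satisfied the linear condition *)
(* c r(0) = 0, then by flatness and Euler's identity sum_i c_i deg_i f_i would *)
(* be decomposable.                                                            *)
Lemma relation_const_span (c : 'I_m -> C) : (exists i, c i != 0) ->
  exists r : 'rV[S]_m, [/\ forall i, invariant (r 0 i),
    \sum_i h i * r 0 i = 0 & \sum_i c i * (r 0 i)@_0%MM != 0].
Proof.
case=> i0 ci0; apply: contrapT => nor.
have r0 (r : 'rV[S]_m) : (forall i, invariant (r 0 i)) ->
    \sum_i h i * r 0 i = 0 -> \sum_i c i * (r 0 i)@_0%MM = 0.
  move=> rI rR; apply/eqP; apply: contraT => rc; case: nor; exists r; split=> //.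
(* For an invariant relation r the sum of the c_i r_i is invariant with zero constant term, so
   averaging its product with x leaves a product of two elements of R_+. The claim passes to the
   whole span because x is arbitrary without constant term. *)
have dec (g : 'rV[S]_m) : relation_span M h g -> forall x : S, x@_0%MM = 0 ->
    decomposable (average (x * \sum_i c i *: g 0 i)).
  elim=> [r rI rR|r r' _ hr _ hr'|a r _ hr] x x0.
  - have cI : invariant (\sum_i c i *: r 0 i).
      by apply: invariant_sum => i _; apply/invariantZ/rI.
    rewrite mulrC averageM //; apply: decomposableM => //.
    + exact: average_inv.
    + by rewrite -[RHS](r0 r rI rR) (raddf_sum (mcoeff 0%MM)); apply: eq_bigr => i _; apply: mcoeffZ.
    + by rewrite average_const.
  - have -> : x * \sum_i c i *: (r + r') 0 i =
        x * (\sum_i c i *: r 0 i) + x * (\sum_i c i *: r' 0 i).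
      rewrite -mulrDr -big_split; congr (_ * _); apply: eq_bigr => i _.
      by rewrite mxE scalerDr.
    by rewrite raddfD; apply: decomposableD; [apply: hr|apply: hr'].
  - have -> : x * \sum_i c i *: (a *: r) 0 i = (x * a) * \sum_i c i *: r 0 i.
      rewrite -mulrA; congr (_ * _); rewrite mulr_sumr; apply: eq_bigr => i _.
      by rewrite mxE scalerAr.
    by apply: hr; rewrite mcoeff0M x0 mul0r.
have span l : relation_span M h (\row_i (f i)^`M(l)).
  apply: (relation_flat M1 MM genW reflP h_inv (d := \max_i msize (f i)^`M(l))).
    by move=> i; rewrite mxE; apply: (leq_bigmax i).
  by rewrite -[RHS](h_rel l); apply: eq_bigr => i _; rewrite mxE.
have E : \sum_l average ('X_l * \sum_i c i *: (\row_i (f i)^`M(l)) 0 i) =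
    \sum_i (c i * (deg i)%:R) *: f i.
  rewrite -(raddf_sum average) /=.
  under eq_bigr => l _ do rewrite mulr_sumr.
  rewrite exchange_big /= (raddf_sum average) /=; apply: eq_bigr => i _.
  under eq_bigr => l _ do rewrite mxE -scalerAr.
  rewrite -scaler_sumr (mpoly_euler (family_homog fP i)) scalerA average_id //.
  exact/invariantZ/(family_inv fP).
have : decomposable (\sum_i (c i * (deg i)%:R) *: f i).
  rewrite -E; apply: decomposable_sum => l; apply: dec => //.
  by rewrite mcoeffX mnm1_eq0.
move/(family_indep fP)/(_ i0)/eqP; rewrite mulf_eq0 (negPf ci0) pnatr_eq0 /=.
by rewrite -leqn0 leqNgt (family_deg fP).
Qed.

(** The relations are added one at a time, keeping their vectors of constant terms linearly
    independent. *)
Lemma relation_matrix k : (k <= m)%N -> exists r : 'M[S]_(k, m),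
  [/\ forall i j, invariant (r i j), forall i, \sum_j h j * r i j = 0 &
      row_free (map_mx (mcoeff 0%MM) r)].
Proof.
elim: k => [_|k IHk km].
  exists 0; split=> [[]//|[]//|]; rewrite -row_leq_rank //.
have [r [rI rR rF]] := IHk (ltnW km).
set A : 'M[C]_(k, m) := map_mx _ r in rF.
have [i0 [j0 c0]] : exists i j, cokermx A i j != 0.
  apply: contrapT => no; have c0 : cokermx A = 0.
    apply/matrixP => i j; rewrite [RHS]mxE; apply/eqP; apply: contraT => ij.
    by case: no; exists i, j.
  have := mxrank_coker A; rewrite c0 mxrank0 (eqP rF) => /esym/eqP.
  by rewrite subn_eq0 leqNgt km.
(* The coefficients form a nonzero column of the cokernel: they annihilate the earlier constant
   vectors but not the new one, which is therefore independent of them. *)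
have [r' [rI' rR' rc]] := @relation_const_span (fun i => cokermx A i j0) (ex_intro _ i0 c0).
rewrite -addn1; exists (col_mx r r'); split.
- move=> i j; rewrite mxE; case: (split i) => u; first exact: rI.
  by rewrite (ord1 u); apply: rI'.
- move=> i; under eq_bigr => j _ do rewrite mxE.
  by case: (split i) => u; rewrite ?(ord1 u); [apply: rR|apply: rR'].
rewrite map_col_mx -/A; apply/inj_row_free => v.
rewrite -[v]hsubmxK mul_row_col; set v1 := lsubmx v; set v2 := rsubmx v => e.
set b := map_mx _ r' in e.
have Ac : A *m col j0 (cokermx A) = 0 by rewrite colE mulmxA mulmx_coker mul0mx.
have bc : (b *m col j0 (cokermx A)) 0 0 != 0.
  apply: contraNneq rc => e0; apply/eqP; rewrite -[RHS]e0 mxE; apply: eq_bigr => i _.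
  by rewrite !mxE mulrC.
have v20 : v2 = 0.
  have := congr1 (mulmx^~ (col j0 (cokermx A))) e.
  rewrite /= mulmxDl mul0mx -!mulmxA Ac mulmx0 add0r => /rowP/(_ 0).
  rewrite [LHS]mxE big_ord1 [RHS]mxE => /eqP; rewrite mulf_eq0 (negPf bc) orbF => /eqP v0.
  by apply/rowP => i; rewrite (ord1 i) [RHS]mxE v0.
move: e; rewrite v20 mul0mx addr0 => /eqP; rewrite mulmx_free_eq0 // => /eqP ->.
by rewrite row_mx0.
Qed.

(** A square matrix of relations whose constant terms form an invertible matrix has nonzero
    determinant; its adjugate then kills h. *)
Lemma invariant_relation0 i : h i = 0.
Proof.
have [r [rI rR rF]] := relation_matrix (leqnn m).
have d0 : \det r != 0.
  apply: contraTneq rF => e; rewrite row_free_unit unitmxE det_map_mx /= e.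
  by rewrite mcoeff0 unitr0.
have : r *m (\col_j h j) = 0.
  apply/colP => j; rewrite !mxE -[RHS](rR j); apply: eq_bigr => l _.
  by rewrite mxE mulrC.
move/(congr1 (mulmx (\adj r))); rewrite mulmx0 mulmxA mul_adj_mx => /colP/(_ i).
rewrite mul_scalar_mx !mxE => /eqP; rewrite mulf_eq0 (negPf d0).
by move/eqP.
Qed.

End InvariantRelation.

(** The group carries relations between the gradients to relations, so averages of multiples of a
    relation are invariant relations, hence zero by [invariant_relation0]. *)
Lemma gradients_free (g : 'I_m -> S) :
  (forall l, \sum_i g i * (f i)^`M(l) = 0) -> forall i, g i = 0.
Proof.
move=> gR i.
have wgR w l : \sum_i act w (g i) * (f i)^`M(l) = 0.
  pose w' := w^-1%g.
  have e j : (f j)^`M(l) = \sum_k M w k l *: act w (f j)^`M(k).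
    by rewrite -{1}(family_inv fP j w) mderiv_lsub.
  under eq_bigr => j _ do rewrite e mulr_sumr.
  rewrite exchange_big big1 //= => k _.
  under eq_bigr => j _ do rewrite -scalerAr -rmorphM.
  by rewrite -scaler_sumr -raddf_sum gR raddf0 scaler0.
have avg p : average (p * g i) = 0.
  apply: (@invariant_relation0 (fun i => average (p * g i))) => [j|l].
    exact: average_inv.
  transitivity (#|W|%:R^-1 *: \sum_w act w p * \sum_j act w (g j) * (f j)^`M(l)).
    under eq_bigr => j _ do rewrite /(average _) -scalerAl mulr_suml.
    rewrite -scaler_sumr exchange_big; congr (_ *: _); apply: eq_bigr => w _ /=.
    by rewrite mulr_sumr; apply: eq_bigr => j _; rewrite rmorphM mulrA.
  by rewrite big1 ?scaler0 // => w _; rewrite wgR mulr0.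
apply/eqP; apply: contraT => gi0.
(* With the product of the other conjugates as multiplier, the average is the norm of [g i], which
   is nonzero as soon as [g i] is. *)
have := avg (\prod_(w | w != 1%g) act w (g i)).
have -> : \prod_(w | w != 1%g) act w (g i) * g i = \prod_w act w (g i).
  by rewrite [RHS](bigD1 1%g) //= act1 // mulrC.
rewrite average_id; last exact: norm_inv.
by move/eqP; rewrite (negPf (norm_neq0 M1 MM gi0)).
Qed.

(** More than n vectors with n coordinates cannot be linearly independent over S. *)
Lemma family_size : (m <= n)%N.
Proof.
rewrite leqNgt; apply/negP => nm.
(* The Jacobian matrix padded with zero columns to a square one, so that its determinant vanishes
   and yields a relation. *)
pose J : 'M[S]_m := \matrix_(i, j)
  if insub (j : nat) is Some l then (f i)^`M(l : 'I_n) else 0.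
have /det0P[v v0 vJ] : \det J == 0.
  rewrite -det_tr; apply/det0P; exists (delta_mx 0 (Ordinal nm)).
    apply/eqP => /rowP/(_ (Ordinal nm))/eqP; rewrite !mxE !eqxx.
    by rewrite oner_eq0.
  by apply/rowP => i; rewrite -rowE !mxE insubF ?ltnn.
move: v0; suff -> : v = 0 by rewrite eqxx.
apply/rowP => i; rewrite mxE; move: i.
apply: gradients_free => l; have lm : (l < m)%N by apply: ltn_trans nm.
have /rowP/(_ (Ordinal lm)) := vJ; rewrite [LHS]mxE [RHS]mxE => e.
rewrite -[RHS]e; apply: eq_bigr => i _; rewrite [J _ _]mxE /= insubT //= => ?.
by congr (_ * (f i)^`M(_)); apply: val_inj.
Qed.

End Family.
End Gradients.

(** * Chevalley's theorem *)

Section DerivativeSupport.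
Variables (C : numFieldType) (n : nat).
Local Notation S := {mpoly C[n]}.

Lemma msize_mderiv (p : S) i : (msize p^`M(i) <= (msize p).-1)%N.
Proof.
apply: msize_leP => m; rewrite mcoeff_msupp mcoeff_deriv => h.
have : (m + U_(i))%MM \in msupp p.
  by rewrite mcoeff_msupp; apply: contraNneq h => ->; rewrite mul0rn.
by move/msize_mdeg_lt; rewrite mdegD mdeg1 addn1; case: (msize p).
Qed.

Lemma mderiv_eq0_const (p : S) : (forall i, p^`M(i) = 0) -> p = (p@_0%MM)%:MP.
Proof.
move=> h; apply/mpolyP => m; rewrite mcoeffC; have [->|m0] := eqVneq m 0%MM.
  by rewrite mulr1.
have [i mi] : exists i, m i != 0%N.
  apply/existsP; apply: contraR m0; rewrite negb_exists => /forallP mz.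
  by apply/eqP/mnmP => i; rewrite mnm0E; apply/eqP; rewrite -[_ == _]negbK.
have := congr1 (mcoeff (m - U_(i))%MM) (h i).
rewrite mcoeff_deriv mcoeff0 submK ?lep1mP // => /eqP.
by rewrite mulrn_eq0 mulr0 => /eqP.
Qed.

End DerivativeSupport.

Section AlgebraicIndependence.
Variables (C : numFieldType) (n m : nat) (f : 'I_m -> {mpoly C[n]}).
Hypothesis free : forall g : 'I_m -> {mpoly C[n]},
  (forall l, \sum_i g i * (f i)^`M(l) = 0) -> forall i, g i = 0.

(** Differentiating q(f) = 0 gives a relation between the gradients with coefficients (d_i q)(f).
    These vanish, so by induction on the degree all d_i q vanish and q is constant. *)
Lemma gradients_free_comp_inj (q : {mpoly C[m]}) : q \mPo [tuple f i | i < m] = 0 -> q = 0.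
Proof.
elim: {q}(msize q) {-2}q (leqnn (msize q)) => [|d IHd] q qd q0.
  by apply/eqP; rewrite -msize_poly_eq0 -leqn0.
have dq i : q^`M(i) = 0.
  apply: IHd.
    by apply: leq_trans (msize_mderiv q i) _; move: qd; case: (msize q).
  move: i; apply: free => l.
  transitivity ((q \mPo [tuple f i | i < m])^`M(l)); last by rewrite q0 raddf0.
  by rewrite mderiv_comp; apply: eq_bigr => i _; rewrite tnth_mktuple.
move: q0; rewrite (mderiv_eq0_const dq) comp_mpolyC => /eqP.
by rewrite mpolyC_eq0 => /eqP ->.
Qed.

End AlgebraicIndependence.

Section Derivation.
Variables (C : numFieldType) (n : nat) (D : {mpoly C[n]} -> {mpoly C[n]}).
Local Notation S := {mpoly C[n]}.
Hypothesis DD : {morph D : p q / p + q}.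
Hypothesis DM : forall p q, D (p * q) = D p * q + p * D q.

Lemma derivation_horner (F : {poly S}) p : (forall i, D F`_i = 0) ->
  D F.[p] = F^`().[p] * D p.
Proof.
have D0 : D 0 = 0 by apply: (addIr (D 0)); rewrite -DD !add0r.
elim/poly_ind: F => [|F c IHF] hF.
  by rewrite deriv0 !horner0 D0 mul0r.
have hF' i : D F`_i = 0.
  by have := hF i.+1; rewrite coefD coefMX coefC /= addr0.
have hc : D c = 0 by have := hF 0%N; rewrite coefD coefMX coefC /= add0r.
rewrite derivD derivM derivX derivC addr0 mulr1 !hornerE DD DM hc addr0 (IHF hF').
by rewrite mulrDl mulrAC.
Qed.

(** An element algebraic over the constants of D is a constant: D (F(p)) = F'(p) D p forces D p = 0
    unless F'(p) = 0, and then F' replaces F. It is nonzero in characteristic zero. *)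
Lemma derivation_separable k (F : {poly S}) p : (size F <= k)%N -> F != 0 ->
  (forall i, D F`_i = 0) -> F.[p] = 0 -> D p = 0.
Proof.
have D0 : D 0 = 0 by apply: (addIr (D 0)); rewrite -DD !add0r.
have Dn x j : D (x *+ j) = D x *+ j.
  by elim: j => [|j IHj]; rewrite ?mulr0n // !mulrS DD IHj.
elim: k F => [|k IHk] F Fk F0 hF Fp.
  by move: F0; rewrite -size_poly_eq0 -leqn0 Fk.
have := derivation_horner p hF; rewrite Fp D0 => /esym/eqP.
rewrite mulf_eq0 => /orP[/eqP F'p|/eqP //].
have [s1|s1] := leqP (size F) 1.
  by move: F0 Fp; rewrite (size1_polyC s1) hornerC polyC_eq0 => /eqP.
apply: (IHk F^`()) => //.
- by rewrite -ltnS (leq_trans _ Fk) // lt_size_deriv.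
- have [k' sk] : exists k', size F = k'.+2 by case: (size F) s1 => [|[|k']] // _; exists k'.
  apply: contraNneq F0 => /(congr1 (fun q : {poly S} => q`_k')).
  rewrite coef_deriv coef0 -scaler_nat => /eqP; rewrite scaler_eq0 pnatr_eq0 /=.
  by rewrite -lead_coef_eq0 /lead_coef sk.
- by move=> i; rewrite coef_deriv Dn hF mul0rn.
Qed.

End Derivation.

Section Chevalley.
Variables (C : numFieldType) (n : nat) (W : finGroupType) (M : W -> 'M[C]_n).
Hypothesis M1 : M 1%g = 1%:M.
Hypothesis MM : forall g h, M (g * h)%g = M h *m M g.
Local Notation S := {mpoly C[n]}.
Local Notation act w := (lsub (M w)).
Local Notation invariant := (invariant M).
Local Notation decomposable := (decomposable M).
Local Notation family := (indecomposable_family M).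
Local Notation pih d p := (pihomog mdeg d p).
Variables (Refl : {set W}).
Hypothesis genW : <<Refl>>%g = [set: W].
Hypothesis reflP : forall s, s \in Refl ->
  exists2 v : 'rV[C]_n, v != 0 & forall i, exists c,
    act s 'X_i - 'X_i = c *: linear_form v.

(** Linear substitutions keep degrees, so homogeneous components of invariants are invariant. *)
Lemma lsub_pihomog A (p : S) d : lsub A (pih d p) = pih d (lsub A p).
Proof.
elim/mpolyind: p => [|c m p _ _ IHp]; first by rewrite pihomog0 raddf0 pihomog0.
rewrite pihomogD !(raddfD (lsub A)) /= pihomogD IHp; congr (_ + _).
rewrite !linearZ /=; congr (_ *: _); rewrite pihomogX.
have h : lsub A 'X_[m] \is (mdeg m).-homog by apply: lsub_homog; rewrite dhomogX.
case: eqP => [<-|/eqP md]; first by rewrite pihomog_dE.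
by rewrite raddf0 (pihomog_ne0 md h).
Qed.

Lemma invariant_pihomog p d : invariant p -> invariant (pih d p).
Proof. by move=> pI w; rewrite lsub_pihomog pI. Qed.

(** [family_size] bounds the size, so a largest family exists. A homogeneous invariant of positive
    degree that is not a combination of its members modulo R_+^2 could be adjoined to it. *)
Lemma maximal_family : exists m (f : 'I_m -> S) deg, family f deg /\
  forall p d, invariant p -> p \is d.-homog -> (0 < d)%N ->
    exists c : 'I_m -> C, decomposable (p - \sum_i c i *: f i).
Proof.
pose P m := `[< exists (f : 'I_m -> S) deg, family f deg >].
have P0 : exists m, P m.
  by exists 0%N; apply/asboolP; exists (fun=> 0), (fun=> 0%N); split=> [[]|[]|[]|c _ []].
have Pn m : P m -> (m <= n)%N.
  by move=> /asboolP[f [deg fP]]; apply: (family_size M1 MM genW reflP fP).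
case: (ex_maxnP P0 Pn) => m /asboolP[f [deg fP]] mmax.
exists m, f, deg; split=> // p d pI pd d0; apply: contrapT => nop.
suff /mmax : P m.+1 by rewrite ltnn.
apply/asboolP.
exists (fun i => if unlift ord0 i is Some j then f j else p).
exists (fun i => if unlift ord0 i is Some j then deg j else d).
split=> [i|i|i|c].
- by case: unlift => [j|//]; apply: (family_inv fP).
- by case: unlift => [j|//]; apply: (family_homog fP).
- by case: unlift => [j|//]; apply: (family_deg fP).
rewrite big_ord_recl unlift_none.
under eq_bigr => i _ do rewrite liftK.
have [c0|c0] := eqVneq (c ord0) 0.
  rewrite c0 scale0r add0r => /(family_indep fP) h i.
  by case: (unliftP ord0 i) => [j ->|->//]; apply: h.
move=> h; case: nop; exists (fun i => - (c ord0)^-1 * c (lift ord0 i)).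
have -> : p - \sum_i (- (c ord0)^-1 * c (lift ord0 i)) *: f i =
    (c ord0)^-1 *: (c ord0 *: p + \sum_i c (lift ord0 i) *: f i).
  rewrite scalerDr scalerA mulVf // scale1r; congr (_ + _).
  rewrite -sumrN scaler_sumr; apply: eq_bigr => i _.
  by rewrite mulNr scaleNr opprK scalerA.
exact: decomposableZ.
Qed.

Section Generators.
Variables (m : nat) (f : 'I_m -> S) (deg : 'I_m -> nat).
Hypothesis fP : family f deg.
Hypothesis fmax : forall p d, invariant p -> p \is d.-homog -> (0 < d)%N ->
  exists c : 'I_m -> C, decomposable (p - \sum_i c i *: f i).

Local Notation phi := (comp_mpoly [tuple f i | i < m]).
Definition generated (p : S) : Prop := exists q, p = phi q.

Lemma generatedD p q : generated p -> generated q -> generated (p + q).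
Proof. by move=> [a ->] [b ->]; exists (a + b); rewrite raddfD. Qed.

Lemma generatedM p q : generated p -> generated q -> generated (p * q).
Proof. by move=> [a ->] [b ->]; exists (a * b); rewrite rmorphM. Qed.

Lemma generatedC c : generated c%:MP.
Proof. by exists c%:MP; rewrite comp_mpolyC. Qed.

Lemma generated_gen i : generated (f i).
Proof. by exists 'X_i; rewrite comp_mpolyXU -tnth_nth tnth_mktuple. Qed.

Lemma generatedZ c p : generated p -> generated (c *: p).
Proof. by rewrite -mul_mpolyC; apply/generatedM/generatedC. Qed.

Lemma generated_sum I (r : seq I) (F : I -> S) :
  (forall i, generated (F i)) -> generated (\sum_(i <- r) F i).
Proof.
move=> h; elim: r => [|i r IHr]; first by rewrite big_nil -mpolyC0; apply: generatedC.
by rewrite big_cons; apply: generatedD.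
Qed.

Lemma pihomog_const (p : S) : pih 0%N p = (p@_0%MM)%:MP.
Proof.
elim/mpolyind: p => [|c k p _ _ IHp]; first by rewrite pihomog0 mcoeff0 mpolyC0.
rewrite pihomogD IHp mcoeffD mpolyCD; congr (_ + _).
rewrite linearZ /= pihomogX mcoeffZ mcoeffX mdeg_eq0.
case: eqP => [->|_]; last by rewrite scaler0 mulr0 mpolyC0.
by rewrite mpolyX0 mulr1 alg_mpolyC.
Qed.

(** In the degree d part of a product of two invariants without constant term both factors have
    degree below d, where generation is already known. *)
Lemma generated_decomposable d p :
  (forall e, (e < d)%N -> forall q, invariant q -> q \is e.-homog -> generated q) ->
  decomposable p -> generated (pih d p).
Proof.
move=> IH; elim=> [u v uI vI u0 v0|{}p q _ hp _ hq]; last first.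
  by rewrite pihomogD; apply: generatedD.
rewrite (pihomog_partitionE (leqnn (msize u))) (pihomog_partitionE (leqnn (msize v))).
rewrite mulr_suml (raddf_sum (pihomog _ _)); apply: generated_sum => -[a _] /=.
rewrite mulr_sumr (raddf_sum (pihomog _ _)); apply: generated_sum => -[b _] /=.
have ab : pih a u * pih b v \is (a + b).-homog by apply: dhomogM; apply: pihomogP.
have [e|ne] := eqVneq (a + b)%N d; last first.
  by rewrite (pihomog_ne0 ne ab) -mpolyC0; apply: generatedC.
rewrite -e (pihomog_dE ab).
case: a ab e => [|a] ab e.
  by rewrite pihomog_const u0 mpolyC0 mul0r -mpolyC0; apply: generatedC.
case: b ab e => [|b] ab e.
  by rewrite [pih 0%N v]pihomog_const v0 mpolyC0 mulr0 -mpolyC0; apply: generatedC.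
apply: generatedM.
  by apply: (IH a.+1); [rewrite -e addnS ltnS leq_addr|exact: invariant_pihomog|exact: pihomogP].
by apply: (IH b.+1); [rewrite -e addSn ltnS leq_addl|exact: invariant_pihomog|exact: pihomogP].
Qed.

Lemma generated_homog d p : invariant p -> p \is d.-homog -> generated p.
Proof.
elim/ltn_ind: d p => d IHd p pI pd.
case: d IHd pd => [|d] IHd pd.
  by rewrite -(pihomog_dE pd) pihomog_const; apply: generatedC.
have [c hc] := fmax pI pd (ltn0Sn d).
have -> : p = pih d.+1 (p - \sum_i c i *: f i) + pih d.+1 (\sum_i c i *: f i).
  by rewrite -pihomogD subrK pihomog_dE.
apply: generatedD.
  by apply: generated_decomposable => // e ed q qI qe; apply: IHd qe.
rewrite (raddf_sum (pihomog _ _)); apply: generated_sum => i /=.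
rewrite linearZ /=; apply: generatedZ.
have [e|ne] := eqVneq (deg i) d.+1.
  by rewrite -e (pihomog_dE (family_homog fP i)); apply: generated_gen.
by rewrite (pihomog_ne0 ne (family_homog fP i)) -mpolyC0; apply: generatedC.
Qed.

Lemma generated_invariant p : invariant p -> generated p.
Proof.
move=> pI; rewrite (pihomog_partitionE (leqnn (msize p))).
apply: generated_sum => i; apply: (@generated_homog i); last exact: pihomogP.
exact: invariant_pihomog.
Qed.

(* If m < n, some nonzero derivation of S kills the [f i], hence all invariants; *)
(* it then kills S, which is algebraic over the invariants.                      *)
Lemma family_size_ge : (n <= m)%N.
Proof.
rewrite leqNgt; apply/negP => mn.
pose J : 'M[S]_n := \matrix_(l, i)
  if insub (i : nat) is Some j then (f (j : 'I_m))^`M(l) else 0.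
have /det0P[v v0 vJ] : \det J == 0.
  rewrite -det_tr; apply/det0P; exists (delta_mx 0 (Ordinal mn)).
    apply/eqP => /rowP/(_ (Ordinal mn))/eqP; rewrite !mxE !eqxx.
    by rewrite oner_eq0.
  by apply/rowP => i; rewrite -rowE !mxE insubF ?ltnn.
pose D (p : S) := \sum_l v 0 l * p^`M(l).
have DD : {morph D : p q / p + q}.
  by move=> p q; rewrite -big_split; apply: eq_bigr => l _; rewrite mderivD mulrDr.
have DM p q : D (p * q) = D p * q + p * D q.
  rewrite mulr_suml mulr_sumr -big_split; apply: eq_bigr => l _.
  by rewrite mderivM mulrDr mulrA [v 0 l * (p * _)]mulrCA.
have Df i : D (f i) = 0.
  have im : (i < n)%N by apply: ltn_trans mn.
  have /rowP/(_ (Ordinal im)) := vJ; rewrite [LHS]mxE [RHS]mxE => e.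
  rewrite -[RHS]e; apply: eq_bigr => l _; rewrite [J _ _]mxE /= insubT //= => ?.
  by congr (_ * (f _)^`M(l)); apply: val_inj.
have Dphi q : D (phi q) = 0.
  rewrite /D; under eq_bigr => l _ do rewrite mderiv_comp mulr_sumr.
  rewrite exchange_big big1 //= => i _.
  under eq_bigr => l _ do rewrite tnth_mktuple mulrCA.
  by rewrite -mulr_sumr -/(D (f i)) Df mulr0.
have DI p : invariant p -> D p = 0.
  by move=> /generated_invariant[q ->]; apply: Dphi.
have Dall p : D p = 0.
  (* This monic polynomial has invariant coefficients, killed by D, and p is one of its roots. *)
  pose F : {poly S} := \prod_(w : W) ('X - (act w p)%:P).
  apply: (derivation_separable DD DM (leqnn (size F))).
  - by rewrite monic_neq0 // monic_prod_XsubC.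
  - move=> i; apply: DI => w; rewrite -coef_map.
    have -> // : map_poly (act w) F = F.
    rewrite /F rmorph_prod [RHS](reindex_inj (mulgI w)); apply: eq_bigr => g _ /=.
    by rewrite rmorphB /= map_polyX map_polyC /= (actM MM).
  - by rewrite /F (bigD1 1%g) //= hornerM (act1 M1) !hornerE subrr mul0r.
move: v0; suff -> : v = 0 by rewrite eqxx.
apply/rowP => l; rewrite [RHS]mxE -[RHS](Dall 'X_l) /D (bigD1 l) //=.
rewrite mderivX mnm1E eqxx scale1r subUU mpolyX0 mulr1 big1 ?addr0 // => i il.
by rewrite mderivX mnm1E eq_sym (negPf il) scale0r mulr0.
Qed.

End Generators.

(** The maximal indecomposable family generates the invariants and has exactly n members. Algebraic
    independence and the nonzero Jacobian both come from [gradients_free]. *)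
Lemma chevalley : exists f : 'I_n -> S,
  [/\ forall i, invariant (f i),
      forall p, invariant p -> exists q, p = q \mPo [tuple f i | i < n],
      injective (comp_mpoly [tuple f i | i < n]) &
      \det (\matrix_(i, l) (f i)^`M(l)) != 0].
Proof.
have [m [f [deg [fP fmax]]]] := maximal_family.
have mn : m = n.
  apply/eqP; rewrite eqn_leq (family_size M1 MM genW reflP fP).
  exact: family_size_ge fP fmax.
subst m; have free := gradients_free M1 MM genW reflP fP.
exists f; split.
- exact: family_inv fP.
- by move=> p /(generated_invariant fP fmax).
- move=> p q e; apply/eqP; rewrite -subr_eq0; apply/eqP.
  by apply: (gradients_free_comp_inj free); rewrite raddfB /= e subrr.
apply/negP => /det0P[v v0 vJ]; move: v0; suff -> : v = 0 by rewrite eqxx.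
apply/rowP => i; rewrite [RHS]mxE; move: i; apply: free => l.
have /rowP/(_ l) := vJ; rewrite [LHS]mxE [RHS]mxE => e.
by rewrite -[RHS]e; apply: eq_bigr => i _; rewrite mxE.
Qed.

End Chevalley.

(** * Differential operators along a ring morphism *)

Section Fold.
Variables (R : nzRingType) (n : nat) (V : zmodType).
Variable psi : 'X_{1..n} -> {additive R -> V}.

Definition mfold (F : {mpoly R[n]}) : V := \sum_(b <- msupp F) psi b F@_b.

(** Summing over all monomials of bounded degree, a range that does not depend on F, makes
    additivity visible; monomials outside the support contribute zero. *)
Lemma mfoldwE k F : (msize F <= k)%N ->
  mfold F = \sum_(b : 'X_{1..n < k}) psi b F@_b.
Proof.
move=> Fk; pose I : subFinType _ := 'X_{1..n < k}.
rewrite /mfold (ssrcomplements.big_mksub I) ?msupp_uniq //=; first last.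
  by move=> x /msize_mdeg_lt /leq_trans; apply.
by rewrite big_rmcond //= => j /memN_msupp_eq0 ->; rewrite raddf0.
Qed.

Fact mfold_is_zmod_morphism : {morph mfold : F G / F - G}.
Proof.
move=> F G; pose k := maxn (msize F) (msize G).
have Fk : (msize F <= k)%N by rewrite leq_maxl.
have Gk : (msize G <= k)%N by rewrite leq_maxr.
rewrite !(mfoldwE (k := k)) //; last first.
  by rewrite (leq_trans (msizeD_le _ _)) // msizeN.
by rewrite -sumrB; apply: eq_bigr => b _; rewrite !raddfB.
Qed.
HB.instance Definition _ :=
  GRing.isZmodMorphism.Build {mpoly R[n]} V mfold mfold_is_zmod_morphism.

Lemma mfoldZX c b : mfold (c *: 'X_[b]) = psi b c.
Proof.
have [->|c0] := eqVneq c 0; first by rewrite scale0r !raddf0.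
by rewrite /mfold msuppMCX // big_seq1 mcoeffZ mcoeffX eqxx mulr1.
Qed.

End Fold.

Section SizeOfProducts.
Variables (R : idomainType) (n : nat).
Local Notation P := {mpoly R[n]}.

(** Here and below, [msize] is the degree plus one, and 0 for the zero polynomial. *)
Lemma msizeM_leS (p q : P) a b :
  (msize p <= a.+1)%N -> (msize q <= b.+1)%N -> (msize (p * q) <= (a + b).+1)%N.
Proof.
have [->|p0] := eqVneq p 0; first by rewrite mul0r msize0.
have [->|q0] := eqVneq q 0; first by rewrite mulr0 msize0.
move=> pa qb; rewrite msizeM // -ltnS prednK.
  by rewrite -addnS -addSn leq_add.
by rewrite addn_gt0 lt0n msize_poly_eq0 p0.
Qed.

Lemma msizeM_form (p q : P) a : p \is 1.-homog -> (msize q <= a)%N ->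
  (msize (p * q) <= a.+1)%N.
Proof.
move=> ph; case: a => [|a] qa.
  have -> : q = 0 by apply/eqP; rewrite -msize_poly_eq0 -leqn0.
  by rewrite mulr0 msize0.
exact: (@msizeM_leS p q 1 a (dhomog_msize_le ph) qa).
Qed.

Lemma msizeD_leP (p q : P) a : (msize p <= a)%N -> (msize q <= a)%N ->
  (msize (p + q) <= a)%N.
Proof.
by move=> pa qa; rewrite (leq_trans (msizeD_le _ _)) // geq_max pa.
Qed.

Lemma msize_map_mpoly (f : {additive R -> R}) (p : P) : (msize (map_mpoly f p) <= msize p)%N.
Proof.
apply: msize_leP => m; rewrite mcoeff_msupp mcoeff_map_mpoly => h.
by apply: msize_mdeg_lt; rewrite mcoeff_msupp; apply: contraNneq h => ->; rewrite raddf0.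
Qed.

Lemma lsub_scalar (c : R) (F : P) m : (lsub c%:M F)@_m = c ^+ mdeg m * F@_m.
Proof.
elim/mpolyind: F => [|a k p _ _ IHp]; first by rewrite raddf0 !mcoeff0 mulr0.
rewrite raddfD /= !mcoeffD IHp mulrDr; congr (_ + _).
rewrite linearZ /= !mcoeffZ mulrCA; congr (_ * _).
have -> : lsub c%:M 'X_[k] = c ^+ mdeg k *: 'X_[k] :> P.
  rewrite lsubE comp_mpolyX (eq_bigr (fun i => c ^+ k i *: 'X_i ^+ k i)) => [|i _].
    by rewrite scaler_prod prodrXr mpolyXE_id mdegE.
  rewrite tnth_mktuple -exprZn; congr (_ ^+ _); rewrite -linear_formX -linearZ.
  congr linear_form; apply/rowP => j.
  by rewrite !mxE eqxx mulr_natr eq_sym.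
rewrite mcoeffZ mcoeffX; case: eqP => [->|_]; first by rewrite mulr1.
by rewrite !mulr0.
Qed.

(** A need not be invertible over R. Composing with its adjugate gives the substitution by the
    scalar \det A, which multiplies each coefficient by a nonzero power of it. *)
Lemma msize_lsub_det (A : 'M[R]_n) (F : P) : \det A != 0 -> msize (lsub A F) = msize F.
Proof.
move=> dA; apply/eqP; rewrite eqn_leq msize_lsub /=.
have [->|F0] := eqVneq F 0; first by rewrite msize0.
apply: leq_trans (msize_lsub (\adj A) _).
rewrite lsubM mul_mx_adj -(mlead_deg F0); apply: msize_mdeg_lt.
rewrite mcoeff_msupp lsub_scalar mulf_neq0 ?expf_neq0 //.
by rewrite mleadc_eq0.
Qed.

End SizeOfProducts.

Section DifferentialOperators.
Variables (C : numFieldType) (n : nat).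
Local Notation S := {mpoly C[n]}.
Variable phi : {lrmorphism S -> S}.

(* [diffop G] is the operator [q |-> \sum_I G_I phi (d^I q)].                  *)
Definition diffop (G : {mpoly S[n]}) (q : S) : S :=
  mfold (fun I => GRing.mulr_fun (phi q^`M[I]) idfun : {additive S -> S}) G.

Lemma diffopD G H q : diffop (G + H) q = diffop G q + diffop H q.
Proof. exact: raddfD. Qed.

Lemma diffopB G H q : diffop (G - H) q = diffop G q - diffop H q.
Proof. exact: raddfB. Qed.

Lemma diffop_sum I (r : seq I) (F : I -> {mpoly S[n]}) q :
  diffop (\sum_(i <- r) F i) q = \sum_(i <- r) diffop (F i) q.
Proof. exact: raddf_sum. Qed.

Lemma diffop0 q : diffop 0 q = 0. Proof. exact: raddf0. Qed.

Lemma diffopZX g I q : diffop (g *: 'X_[I]) q = g * phi q^`M[I].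
Proof. exact: mfoldZX. Qed.

Lemma diffopZ g G q : diffop (g *: G) q = g * diffop G q.
Proof.
elim/mpolyind: G => [|c m p _ _ IHp]; first by rewrite scaler0 !diffop0 mulr0.
by rewrite scalerDr !diffopD IHp scalerA !diffopZX mulrDr mulrA.
Qed.

Lemma diffop1 q : diffop 1 q = phi q.
Proof. by rewrite -mpolyX0 -[X in diffop X]scale1r diffopZX mul1r mderivm0m. Qed.

(** Tested on X^m, for m the least monomial of G in an order refining the degree. The derivative d^m
    turns X^m into a nonzero constant. *)
Lemma diffop_inj G : (forall q, diffop G q = 0) -> G = 0.
Proof.
move=> h; apply/eqP; apply: contraT => G0.
have := h 'X_[mlast G]; set m := mlast G.
rewrite [G in LHS]mpolyE diffop_sum (bigD1_seq m) ?mlast_supp ?msupp_uniq //=.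
rewrite big_seq_cond big1 ?addr0 => [|I /andP[IG Im]]; rewrite diffopZX.
  have mm : (m - m = 0)%MM by rewrite -{1}[m]add0m addmK.
  rewrite mderivmX mm mpolyX0 linearZ rmorph1 /=.
  move/eqP; rewrite mulf_eq0 mcoeff_eq0 mlast_supp //=.
  rewrite scaler_eq0 oner_eq0 orbF pnatr_eq0 => /eqP e.
  have : (0 < \prod_(i < n) m i ^_ m i)%N.
    by rewrite prodn_gt0 // => i; rewrite ffactnn fact_gt0.
  by rewrite e.
(* Any other monomial I of G has at least the degree of m, so it exceeds m in some variable and d^I
   kills X^m. *)
have [i mi] : exists i, (m i < I i)%N.
  apply/existsP; apply: contraR Im; rewrite negb_exists => /forallP le.
  have /mnm_lepP lem : forall i, (I i <= m i)%N by move=> i; rewrite leqNgt.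
  have := submK lem; have := lemc_mdeg (mlast_lemc IG); rewrite -/m.
  move=> d e; have := congr1 mdeg e; rewrite mdegD => e'.
  have : mdeg (m - I) = 0%N by apply/eqP; rewrite -leqn0 -(leq_add2r (mdeg I)) e'.
  by move/eqP; rewrite mdeg_eq0 => /eqP z; rewrite -{1}e z add0m.
rewrite mderivmX (bigD1 i) //= ffact_small // mul0n scale0r.
by rewrite raddf0 mulr0.
Qed.

Section Leading.
Variables (J : 'M[S]_n) (tau : 'I_n -> {additive S -> S}).
Hypothesis tauP : forall j g q,
  tau j (g * phi q) = tau j g * phi q + g * \sum_i J j i * phi q^`M(i).

(** The rule [tauP] on symbols: differentiating [phi q] multiplies G by a linear form, while acting
    on the coefficients does not raise the degree. *)
Lemma diffop_tau j G q :
  tau j (diffop G q) = diffop (linear_form (row j J) * G + map_mpoly (tau j) G) q.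
Proof.
elim/mpolyind: G => [|g I G _ _ IHG].
  by rewrite mulr0 (raddf0 (map_mpoly (tau j))) addr0 !diffop0 raddf0.
rewrite diffopD (raddfD (tau j)) /= IHG mulrDr (raddfD (map_mpoly (tau j))) /=.
rewrite addrACA [RHS]diffopD; congr (_ + _).
rewrite diffopZX tauP addrC diffopD; congr (_ + _).
  have -> : map_mpoly (tau j) (g *: 'X_[I]) = tau j g *: 'X_[I].
    apply/mpolyP => m; rewrite mcoeff_map_mpoly !mcoeffZ !mcoeffX.
    by case: eqP => _; rewrite ?mulr1 // !mulr0 raddf0.
  by rewrite diffopZX.
rewrite /linear_form mulr_suml diffop_sum mulr_sumr; apply: eq_bigr => i _.
rewrite mxE -scalerAl -scalerAr scalerA -mpolyXD diffopZX addmC.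
by rewrite mderivmDm mderivmU1m mulrCA mulrA.
Qed.

Variable op : 'X_{1..n} -> S -> S.
Hypothesis op0 : forall p, op 0%MM p = p.
Hypothesis opS : forall j b p, op (U_(j) + b)%MM p = tau j (op b p).

(** Iterating [diffop_tau]: the top part of the symbol is multiplied by X^b after the change of
    variables J. The bound says that the error lies below degree [mdeg b + s], the largest degree of
    the product. *)
Lemma diffop_op b G s : (msize G <= s.+1)%N -> exists G',
  (forall q, op b (diffop G q) = diffop G' q) /\
  (msize (G' - lsub J 'X_[b] * G) <= mdeg b + s)%N.
Proof.
move=> Gs; elim: {b}(mdeg b) {-2}b (erefl (mdeg b)) => [|d IHd] b bd.
  have -> : b = 0%MM by apply/eqP; rewrite -mdeg_eq0 bd.
  exists G; split=> [q|]; first by rewrite op0.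
  by rewrite mpolyX0 rmorph1 mul1r subrr msize0.
have [j bj] : exists j, b j != 0%N.
  apply/existsP; apply: contraT; rewrite negb_exists => /forallP b0.
  suff : mdeg b = 0%N by rewrite bd.
  by rewrite mdegE big1 // => i _; apply/eqP; rewrite -[_ == _]negbK.
have e : b = (U_(j) + (b - U_(j)))%MM by rewrite addmC submK // lep1mP.
have b'd : mdeg (b - U_(j)) = d.
  by have := congr1 mdeg e; rewrite mdegD mdeg1 bd add1n => -[].
have [G' [opG' sG']] := IHd _ b'd; rewrite e.
move: {e bj bd} (b - U_(j))%MM b'd opG' sG' => b' b'd opG' sG'.
exists (linear_form (row j J) * G' + map_mpoly (tau j) G'); split=> [q|].
  by rewrite opS opG' diffop_tau.
rewrite mpolyXD rmorphM /= lsubX addrAC -mulrA -mulrBr mdegD mdeg1 add1n addSn.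
apply: msizeD_leP.
  by apply: msizeM_form => //; apply: linear_form_homog.
apply: leq_trans (msize_map_mpoly _ _) _.
rewrite -[G'](subrK (lsub J 'X_[b'] * G)); apply: msizeD_leP.
  by rewrite (leq_trans sG').
apply: msizeM_leS => //; apply: leq_trans (msize_lsub _ _) _.
by rewrite msizeX.
Qed.

Definition opfold (F : {mpoly S[n]}) p := \sum_(b <- msupp F) F@_b * op b p.

Lemma diffop_opfold (F G : {mpoly S[n]}) r s :
  (msize F <= r.+1)%N -> (msize G <= s.+1)%N -> exists G',
  (forall q, opfold F (diffop G q) = diffop G' q) /\
  (msize (G' - lsub J F * G) <= r + s)%N.
Proof.
move=> Fr Gs; have H_ b := cid (diffop_op b Gs).
pose G_ b := projT1 (H_ b); exists (\sum_(b <- msupp F) F@_b *: G_ b); split=> [q|].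
  rewrite diffop_sum; apply: eq_bigr => b _; rewrite diffopZ.
  by rewrite /G_; case: (H_ b) => G' [/= ->].
have -> : lsub J F = \sum_(b <- msupp F) F@_b *: lsub J 'X_[b].
  rewrite {1}[F]mpolyE (raddf_sum (lsub J)); apply: eq_bigr => b _.
  exact: linearZ.
rewrite mulr_suml -sumrB big_seq.
apply: msize_sum_le => b bF; rewrite -scalerAl -scalerBr.
apply: leq_trans (msizeZ_le _ _) _; rewrite /G_; case: (H_ b) => G' [/= _ h].
by apply: leq_trans h _; rewrite leq_add2r -ltnS (leq_trans _ Fr) // msize_mdeg_lt.
Qed.

(** A nonsingular J keeps the degree of F, and degrees add over a domain, so the leading product
    cannot be cancelled by the error. Used with J the Jacobian for the embedding and with J = 1 for
    the Weyl algebra. *)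
Lemma diffop_opfold_neq0 (F G G' : {mpoly S[n]}) : \det J != 0 -> F != 0 -> G != 0 ->
  (forall q, opfold F (diffop G q) = diffop G' q) -> G' != 0.
Proof.
move=> dJ F0 G0 hG'.
have [r rF] : exists r, msize F = r.+1 by exists (msize F).-1; rewrite -mpolySpred.
have [s sG] : exists s, msize G = s.+1 by exists (msize G).-1; rewrite -mpolySpred.
have [|G'' [hG'' sG'']] := @diffop_opfold F G r s _ (eq_leq sG); first by rewrite rF.
have -> : G' = G''.
  apply/eqP; rewrite -subr_eq0; apply/eqP/diffop_inj => q.
  by rewrite diffopB -hG' -hG'' subrr.
apply: contraTneq sG'' => ->; rewrite sub0r msizeN -ltnNge.
have lF0 : lsub J F != 0 by rewrite -msize_poly_eq0 (msize_lsub_det F dJ) rF.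
by rewrite msizeM // (msize_lsub_det F dJ) rF sG addSn addnS /=.
Qed.

End Leading.
End DifferentialOperators.

(** * The Weyl algebra *)

Lemma mderivXE (C : nzRingType) n (i j : 'I_n) : ('X_j : {mpoly C[n]})^`M(i) = (i == j)%:R.
Proof.
rewrite mderivX mnm1E eq_sym; case: eqP => [->|_]; last by rewrite scale0r.
by rewrite subUU mpolyX0 scale1r.
Qed.

Lemma mnm_ind n (P : 'X_{1..n} -> Prop) :
  P 0%MM -> (forall j b, P b -> P (U_(j) + b)%MM) -> forall b, P b.
Proof.
move=> P0 PS b; elim: {b}(mdeg b) {-2}b (erefl (mdeg b)) => [|d IHd] b bd.
  by have /eqP -> : b == 0%MM by rewrite -mdeg_eq0 bd.
have [j bj] : exists j, b j != 0%N.
  apply/existsP; apply: contraT; rewrite negb_exists => /forallP b0.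
  suff : mdeg b = 0%N by rewrite bd.
  by rewrite mdegE big1 // => i _; apply/eqP; rewrite -[_ == _]negbK.
have e : b = (U_(j) + (b - U_(j)))%MM by rewrite addmC submK // lep1mP.
rewrite e; apply/PS/IHd.
by have := congr1 mdeg e; rewrite mdegD mdeg1 bd add1n => -[].
Qed.

Section BasicOperators.
Variables (C : numFieldType) (n : nat).
Local Notation S := {mpoly C[n]}.

Fact mult_endo_linear (p : S) : linear ( *%R p).
Proof. by move=> a u v; rewrite mulrDr scalerAr. Qed.
Definition mult_endo (p : S) : endo C n := Endo (mult_endo_linear p).

Definition mderiv_endo i : endo C n := @Endo C n (mderiv i) (mderiv_is_linear i).

End BasicOperators.

Section NormalForms.
Variables (C : numFieldType) (n : nat) (A : pzAlgType C).
Local Notation S := {mpoly C[n]}.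
Variables X D : {rmorphism S -> A}.

Definition monomial_map (z : A) (b : 'X_{1..n}) (p : S) : A := X p * D 'X_[b] * z.

Fact monomial_map_zmod z b : {morph monomial_map z b : p q / p - q}.
Proof. by move=> p q; rewrite /monomial_map raddfB !mulrBl. Qed.
HB.instance Definition _ z b :=
  GRing.isZmodMorphism.Build S A (monomial_map z b) (monomial_map_zmod z b).

(* The normally ordered element [\sum_b X(F_b) D^b z].                         *)
Definition normal_form (z : A) (F : {mpoly S[n]}) : A :=
  mfold (monomial_map z) F.

Lemma normal_formZX z p b : normal_form z (p *: 'X_[b]) = X p * D 'X_[b] * z.
Proof. exact: mfoldZX. Qed.

Lemma normal_formD z F G : normal_form z (F + G) = normal_form z F + normal_form z G.
Proof. exact: raddfD. Qed.

Lemma normal_form0 z : normal_form z 0 = 0.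
Proof. exact: raddf0. Qed.

Lemma normal_formMn z F k : normal_form z (F *+ k) = normal_form z F *+ k.
Proof. exact: raddfMn. Qed.

Lemma normal_form_mulX z p F : X p * normal_form z F = normal_form z (p *: F).
Proof.
elim/mpolyind: F => [|q b F _ _ IHF]; first by rewrite scaler0 normal_form0 mulr0.
rewrite scalerDr !normal_formD mulrDr IHF; congr (_ + _).
by rewrite scalerA !normal_formZX rmorphM !mulrA.
Qed.

Hypothesis XC : forall a, X a%:MP = scalar_of a.
Hypothesis DC : forall a, D a%:MP = scalar_of a.
Hypothesis DX : forall i j, D 'X_i * X 'X_j = X 'X_j * D 'X_i + (i == j)%:R.

Lemma normal_form_scalar z a F : scalar_of a * normal_form z F = normal_form z (a%:MP *: F).
Proof. by rewrite -XC normal_form_mulX. Qed.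

Lemma commutator_DX i p : D 'X_i * X p = X p * D 'X_i + X p^`M(i).
Proof.
elim/mpoly_ring_ind: p => [c|p q ep eq|j p ep].
- by rewrite XC mderivC raddf0 addr0 scalar_of_central.
- by rewrite mderivD !raddfD /= mulrDr mulrDl ep eq addrACA.
- rewrite mderivM mderivXE (raddfD X) /= !(rmorphM X) /=.
  rewrite mulrA DX mulrDl -mulrA ep mulrDr mulrA -!addrA; congr (_ + _).
  by rewrite addrC rmorph_nat.
Qed.

Lemma commutator_XD i q : D q * X 'X_i = X 'X_i * D q + D q^`M(i).
Proof.
elim/mpoly_ring_ind: q => [c|p q ep eq|j p ep].
- by rewrite DC mderivC raddf0 addr0 scalar_of_central.
- by rewrite mderivD !raddfD /= mulrDr mulrDl ep eq addrACA.
- rewrite mderivM mderivXE (raddfD D) /= !(rmorphM D) /=.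
  rewrite -mulrA ep mulrDr !mulrA DX mulrDl -addrA.
  by rewrite rmorph_nat eq_sym.
Qed.

Lemma normal_form_Dmul i F :
  D 'X_i * normal_form 1 F = normal_form 1 (map_mpoly (mderiv i) F + 'X_i * F).
Proof.
elim/mpolyind: F => [|q b F _ _ IHF].
  by rewrite mulr0 (raddf0 (map_mpoly (mderiv i))) addr0 normal_form0 mulr0.
rewrite (raddfD (map_mpoly (mderiv i))) /= mulrDr addrACA [RHS]normal_formD.
rewrite normal_formD mulrDr IHF; congr (_ + _).
have -> : map_mpoly (mderiv i) (q *: 'X_[b]) = q^`M(i) *: 'X_[b].
  apply/mpolyP => m; rewrite mcoeff_map_mpoly !mcoeffZ !mcoeffX.
  by case: eqP => _; rewrite ?mulr1 // !mulr0 raddf0.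
rewrite -scalerAr -mpolyXD normal_formD !normal_formZX !mulr1.
by rewrite mulrA commutator_DX mpolyXD rmorphM mulrDl addrC mulrA.
Qed.

Lemma normal_form_mulD i F : normal_form 1 F * D 'X_i = normal_form 1 ('X_i * F).
Proof.
elim/mpolyind: F => [|q b F _ _ IHF]; first by rewrite mulr0 normal_form0 mul0r.
rewrite mulrDr !normal_formD mulrDl IHF; congr (_ + _).
rewrite -scalerAr -mpolyXD !normal_formZX !mulr1 -mulrA; congr (_ * _).
by rewrite -rmorphM mulrC mpolyXD.
Qed.

(** Moving X_i to the left across the D's differentiates F in its own variables, which stand for the
    D's. The scalar ['X_i] is a coefficient, unlike the variable ['X_i] in [normal_form_mulD]. *)
Lemma normal_form_mulXr i F :
  normal_form 1 F * X 'X_i = normal_form 1 ('X_i *: F + F^`M(i)).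
Proof.
elim/mpolyind: F => [|q b F _ _ IHF].
  by rewrite scaler0 raddf0 addr0 normal_form0 mul0r.
rewrite scalerDr mderivD addrACA !normal_formD mulrDl IHF normal_formD; congr (_ + _).
rewrite normal_formZX mulr1 -mulrA commutator_XD mulrDr; congr (_ + _).
  by rewrite scalerA normal_formZX mulr1 mulrA [in RHS]mulrC rmorphM.
rewrite mderivZ !mderivX !scaler_nat -scalerMnr normal_formMn normal_formZX mulr1.
by rewrite raddfMn mulrnAr.
Qed.

End NormalForms.

Section WeylPresentation.
Variables (C : numFieldType) (n : nat) (A : pzAlgType C).
Local Notation S := {mpoly C[n]}.
Variables X D : {rmorphism S -> A}.
Hypothesis XC : forall a, X a%:MP = scalar_of a.
Hypothesis DC : forall a, D a%:MP = scalar_of a.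
Hypothesis DX : forall i j, D 'X_i * X 'X_j = X 'X_j * D 'X_i + (i == j)%:R.
Hypothesis gen_ind : forall P : A -> Prop, P 1 ->
  (forall x y, P x -> P y -> P (x + y)) ->
  (forall a x, P x -> P (scalar_of a * x)) ->
  (forall i x, P x -> P (X 'X_i * x)) ->
  (forall i x, P x -> P (D 'X_i * x)) -> forall x, P x.
Variable act : {rmorphism A -> endo C n}.
Hypothesis act_scalar : forall a q, act (scalar_of a) q = a *: q.
Hypothesis act_Xi : forall i q, act (X 'X_i) q = 'X_i * q.
Hypothesis act_Di : forall i q, act (D 'X_i) q = q^`M(i).

Local Notation nf := (normal_form X D 1).

Lemma weyl_act_X p q : act (X p) q = p * q.
Proof.
elim/mpoly_ring_ind: p => [c|p p' e e'|i p e].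
- by rewrite XC act_scalar mul_mpolyC.
- by rewrite !raddfD /= e e' mulrDl.
- by rewrite !rmorphM /= act_Xi e mulrA.
Qed.

Lemma weyl_act_D b q : act (D 'X_[b]) q = q^`M[b].
Proof.
elim/mnm_ind: b => [|j b IHb]; first by rewrite mpolyX0 !rmorph1 mderivm0m.
by rewrite mpolyXD !rmorphM /= act_Di IHb addmC mderivmDm mderivmU1m.
Qed.

Definition idS : {lrmorphism S -> S} := idfun.

Lemma weyl_act_nf F q : act (nf F) q = diffop idS F q.
Proof.
elim/mpolyind: F => [|p b F _ _ IHF].
  by rewrite normal_form0 diffop0 raddf0.
rewrite normal_formD (raddfD act) /= IHF diffopD; congr (_ + _).
by rewrite normal_formZX mulr1 (rmorphM act) /= weyl_act_X weyl_act_D diffopZX.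
Qed.

Lemma weyl_nf_inj F : nf F = 0 -> F = 0.
Proof.
move=> e; apply: (@diffop_inj C n idS) => q.
by rewrite -weyl_act_nf e raddf0.
Qed.

Lemma weyl_nf1 : nf 1 = 1.
Proof.
rewrite -mpolyX0 -[X in nf X]scale1r normal_formZX.
by rewrite mpolyX0 !rmorph1 !mulr1.
Qed.

Lemma weyl_nf_surj P : exists F, P = nf F.
Proof.
elim/gen_ind: P => [|P Q [F ->] [G ->]|a P [F ->]|i P [F ->]|i P [F ->]].
- by exists 1; rewrite weyl_nf1.
- by exists (F + G); rewrite normal_formD.
- by exists (a%:MP *: F); rewrite (normal_form_scalar D XC).
- by exists ('X_i *: F); rewrite -normal_form_mulX.
- exists (map_mpoly (mderiv i) F + 'X_i * F).
  by rewrite -(normal_form_Dmul XC DX).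
Qed.

Lemma weyl_faithful P : (forall q, act P q = 0) -> P = 0.
Proof.
have [F ->] := weyl_nf_surj P => h.
have -> : F = 0 by apply: (@diffop_inj C n idS) => q; rewrite -weyl_act_nf.
exact: normal_form0.
Qed.

Lemma weyl_one_neq0 : 1 != 0 :> A.
Proof.
apply/eqP => /(congr1 (fun P => act P 1)).
by rewrite rmorph1 raddf0 /= => /eqP; rewrite oner_eq0.
Qed.

Lemma mderiv_product_rule j (g q : S) :
  mderiv j (g * idS q) = mderiv j g * idS q + g * \sum_i 1%:M j i * idS q^`M(i).
Proof.
rewrite mderivM (bigD1 j) //= mxE eqxx mul1r big1 ?addr0 // => i ij.
by rewrite mxE eq_sym (negPf ij) mul0r.
Qed.

(** The leading symbol of a product of differential operators is the product of the leading
    symbols. *)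
Lemma weyl_integral (P Q : A) : P * Q = 0 -> P = 0 \/ Q = 0.
Proof.
have [F ->] := weyl_nf_surj P; have [G ->] := weyl_nf_surj Q => e.
have [->|F0] := eqVneq F 0; first by left; apply: normal_form0.
have [->|G0] := eqVneq G 0; first by right; apply: normal_form0.
have opS j b (p : S) : p^`M[U_(j) + b] = (p^`M[b])^`M(j).
  by rewrite addmC mderivmDm mderivmU1m.
have d1 : \det (1%:M : 'M[S]_n) != 0 by rewrite det1 oner_neq0.
suff : (0 : {mpoly S[n]}) != 0 by rewrite eqxx.
apply: (diffop_opfold_neq0 mderiv_product_rule (@mderivm0m n C) opS d1 F0 G0) => q.
rewrite diffop0 -weyl_act_nf; transitivity (act (nf F * nf G) q).
  by rewrite (rmorphM act) /= !weyl_act_nf.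
by rewrite e raddf0.
Qed.

End WeylPresentation.

Section WeylAlgebra.
Variables (C : numFieldType) (n : nat).
Local Notation S := {mpoly C[n]}.
Local Notation A := (weyl C n).
Local Notation pi := (presented_pi (@weyl_rel C n)).
Local Notation x_ i := (pi (weyl_x C i)).
Local Notation d_ i := (pi (weyl_d C i)).

Definition weyl_gen (g : 'I_n + 'I_n) : endo C n :=
  match g with inl i => mult_endo 'X_i | inr i => mderiv_endo C i end.

Lemma weyl_relP u v : weyl_rel u v -> free_eval weyl_gen u = free_eval weyl_gen v.
Proof.
have ex i : free_eval weyl_gen (weyl_x C i) = mult_endo 'X_i by exact: free_eval_gen.
have ed i : free_eval weyl_gen (weyl_d C i) = mderiv_endo C i by exact: free_eval_gen.
case=> i j; rewrite free_evalBM ?ex ?ed.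
- by rewrite free_eval0; apply: endoP => q /=; rewrite mulrCA subrr.
- by rewrite free_eval0; apply: endoP => q /=; rewrite mderiv_comm subrr.
- rewrite free_eval_nat; apply: endoP => q /=; rewrite mderivM addrK mderivXE.
  by case: (i == j); rewrite ?mul1r ?mul0r.
Qed.

Definition weyl_act : {rmorphism A -> endo C n} := projT1 (cid (presented_lift weyl_relP)).

Lemma weyl_actE u : weyl_act (pi u) = free_eval weyl_gen u.
Proof. by rewrite /weyl_act; case: cid => F /= ->. Qed.

Lemma weyl_act_x i q : weyl_act (x_ i) q = 'X_i * q.
Proof. by rewrite weyl_actE free_eval_gen. Qed.

Lemma weyl_act_d i q : weyl_act (d_ i) q = q^`M(i).
Proof. by rewrite weyl_actE free_eval_gen. Qed.

Lemma weyl_act_scalar a q : weyl_act (scalar_of a) q = a *: q.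
Proof. by rewrite weyl_actE free_evalC. Qed.

Lemma weyl_comm_x i j : x_ i * x_ j = x_ j * x_ i.
Proof. by rewrite (presented_pi_commutator (weyl_xx C i j)) raddf0 addr0. Qed.

Lemma weyl_comm_d i j : d_ i * d_ j = d_ j * d_ i.
Proof. by rewrite (presented_pi_commutator (weyl_dd C i j)) raddf0 addr0. Qed.

Lemma weyl_comm_dx i j : d_ i * x_ j = x_ j * d_ i + (i == j)%:R.
Proof. by rewrite (presented_pi_commutator (weyl_dx C i j)) rmorph_nat. Qed.

Definition weyl_X : {rmorphism S -> A} :=
  projT1 (cid (commuting_eval weyl_comm_x)).
Definition weyl_D : {rmorphism S -> A} :=
  projT1 (cid (commuting_eval weyl_comm_d)).

Lemma weyl_XC a : weyl_X a%:MP = scalar_of a.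
Proof. by rewrite /weyl_X; case: cid => F /= [h _]; rewrite h. Qed.
Lemma weyl_XX i : weyl_X 'X_i = x_ i.
Proof. by rewrite /weyl_X; case: cid => F /= [_ h]; rewrite h. Qed.
Lemma weyl_DC a : weyl_D a%:MP = scalar_of a.
Proof. by rewrite /weyl_D; case: cid => F /= [h _]; rewrite h. Qed.
Lemma weyl_DX i : weyl_D 'X_i = d_ i.
Proof. by rewrite /weyl_D; case: cid => F /= [_ h]; rewrite h. Qed.

Lemma weyl_relDX i j :
  weyl_D 'X_i * weyl_X 'X_j = weyl_X 'X_j * weyl_D 'X_i + (i == j)%:R.
Proof. by rewrite weyl_XX weyl_DX weyl_comm_dx. Qed.

Lemma weyl_ind (P : A -> Prop) : P 1 ->
  (forall x y, P x -> P y -> P (x + y)) ->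
  (forall a x, P x -> P (scalar_of a * x)) ->
  (forall i x, P x -> P (weyl_X 'X_i * x)) ->
  (forall i x, P x -> P (weyl_D 'X_i * x)) -> forall x, P x.
Proof.
move=> P1 PD PZ PX PDi x; rewrite -[x]mulr1.
apply: (presented_ind_l P1 PD PZ) => -[i|i] y Py.
  by have := PX i y Py; rewrite weyl_XX.
by have := PDi i y Py; rewrite weyl_DX.
Qed.

End WeylAlgebra.

(** * The Ore condition by growth *)

Lemma linear_dependence (K : fieldType) (I J : finType) (T : I -> J -> K) :
  (#|J| < #|I|)%N ->
  exists c : I -> K, (exists i, c i != 0) /\ forall j, \sum_i c i * T i j = 0.
Proof.
move=> JI; pose M : 'M[K]_(#|I|, #|J|) := \matrix_(i, j) T (enum_val i) (enum_val j).
have /rowV0Pn[v /sub_kermxP vM v0] : kermx M != 0.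
  rewrite -mxrank_eq0 mxrank_ker -lt0n subn_gt0.
  exact: leq_ltn_trans (rank_leq_col _) JI.
exists (fun i => v 0 (enum_rank i)); split=> [|j].
  apply: contrapT => no; case/eqP: v0; apply/rowP => i; rewrite [RHS]mxE.
  by apply/eqP; apply: contraT => vi; case: no; exists (enum_val i); rewrite enum_valK.
have /rowP/(_ (enum_rank j)) := vM; rewrite [LHS]mxE [RHS]mxE => e.
rewrite -[RHS]e (reindex (@enum_val I I)) /=; last exact: onW_bij (enum_val_bij _).
by apply: eq_bigr => i _; rewrite mxE enum_valK enum_rankK.
Qed.

Section Growth.
Variables (K : fieldType) (A : pzAlgType K) (Ix : nat -> finType).
Variable mon : forall N, Ix N -> A.
Arguments mon : clear implicits.

(** The N-th filtration piece. The operation [mu] below will be multiplication on the left or on the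
    right, so that one count serves both Ore conditions. *)
Definition mon_span N (P : A) : Prop :=
  exists c : Ix N -> K, P = \sum_e scalar_of (c e) * mon N e.

Hypothesis mon_free : forall N (c : Ix N -> K),
  \sum_e scalar_of (c e) * mon N e = 0 -> forall e, c e = 0.
Hypothesis slow_growth : forall d, exists N, (#|Ix (N + d)| < #|Ix N| + #|Ix N|)%N.

Variable mu : A -> A -> A.
Hypothesis muD : forall a x y, mu a (x + y) = mu a x + mu a y.
Hypothesis muZ : forall a c x, mu a (scalar_of c * x) = scalar_of c * mu a x.
Hypothesis mu_filtered : forall a, exists d0, forall d, (d0 <= d)%N ->
  forall N e, mon_span (N + d) (mu a (mon N e)).

Lemma mu_sum a N (c : Ix N -> K) :
  mu a (\sum_e scalar_of (c e) * mon N e) = \sum_e scalar_of (c e) * mu a (mon N e).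
Proof.
have mu0 : mu a 0 = 0 by rewrite -(mul0r 0) -(scalar_of0 A) muZ scalar_of0 !mul0r.
by rewrite (big_morph (mu a) (muD a) mu0); apply: eq_bigr => e _; rewrite muZ.
Qed.

(* Dimension count: a A_N and b A_N cannot be independent inside A_(N + d).    *)
Lemma growth_common_multiple a b :
  exists u v, (u != 0 \/ v != 0) /\ mu a u = mu b v.
Proof.
have [da ha] := mu_filtered a; have [db hb] := mu_filtered b.
pose d := maxn da db; have [N hN] := slow_growth d.
have ca e := cid (ha d (leq_maxl _ _) N e); have cb e := cid (hb d (leq_maxr _ _) N e).
have [T TE] : exists T : (Ix N + Ix N)%type -> Ix (N + d) -> K,
    forall i, match i with inl e => mu a (mon N e) | inr e => mu b (mon N e) end =
    \sum_e' scalar_of (T i e') * mon (N + d) e'.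
  exists (fun i => match i with inl e => projT1 (ca e) | inr e => projT1 (cb e) end).
  by case=> e; [case: (ca e)|case: (cb e)].
have [|c [[i0 c0] cT]] := @linear_dependence _ _ _ T; first by rewrite card_sum.
exists (\sum_e scalar_of (c (inl e)) * mon N e).
exists (\sum_e scalar_of (- c (inr e)) * mon N e); split.
  case: i0 c0 => e c0; [left|right]; apply: contra_neqN c0 => /eqP z.
    by have /= -> := @mon_free N (fun e => c (inl e)) z e.
  by have /= /eqP := @mon_free N (fun e => - c (inr e)) z e; rewrite oppr_eq0 => /eqP.
have TEl e : mu a (mon N e) = \sum_e' scalar_of (T (inl e) e') * mon (N + d) e' := TE (inl e).
have TEr e : mu b (mon N e) = \sum_e' scalar_of (T (inr e) e') * mon (N + d) e' := TE (inr e).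
apply/eqP; rewrite -subr_eq0 !mu_sum; apply/eqP.
transitivity (\sum_(i : Ix N + Ix N) \sum_e' scalar_of (c i * T i e') * mon (N + d) e').
  rewrite big_sumType /= -sumrN; congr (_ + _); apply: eq_bigr => e _.
    by rewrite TEl mulr_sumr; apply: eq_bigr => e' _; rewrite scalar_ofM mulrA.
  rewrite scalar_ofN mulNr opprK TEr mulr_sumr; apply: eq_bigr => e' _.
  by rewrite scalar_ofM mulrA.
rewrite exchange_big big1 //= => e' _; rewrite -mulr_suml.
rewrite -(big_morph (@scalar_of K A) (@scalar_ofD K A) (scalar_of0 A)).
by rewrite cT scalar_of0 mul0r.
Qed.

End Growth.

Lemma exponential_growth k d : exists j, ((1 + j * d) ^ k < 2 ^ j)%N.
Proof.
(* For j = 2^(2u), 1 + j d is at most 2^(2u + c). Its k-th power has exponent (2u + c) k, which is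
   at most u^2 and so below 2^(2u) = j. *)
pose c := d.+1; pose u := ((2 + c) * k).+1; exists (2 ^ (u + u))%N.
have h1 : (1 + 2 ^ (u + u) * d <= 2 ^ (u + u + c))%N.
  rewrite [leqRHS]expnD; apply: (@leq_trans (2 ^ (u + u) * c)%N).
    have : (0 < 2 ^ (u + u))%N by rewrite expn_gt0.
    by move: (2 ^ (u + u))%N => X X0; rewrite [leqRHS]mulnS leq_add2r.
  by rewrite leq_mul2l; apply/orP; right; apply/ltnW/ltn_expl.
apply: (@leq_ltn_trans (2 ^ ((u + u + c) * k))%N).
  have mono a b e : (a <= b -> a ^ e <= b ^ e)%N.
    by move=> ab; elim: e => // e IHe; rewrite !expnS leq_mul.
  by rewrite expnM mono.
rewrite ltn_exp2l // expnD; apply: (@leq_ltn_trans (u * u)%N); last first.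
  by apply: ltn_mul; apply: ltn_expl.
apply: (@leq_trans (u * (2 + c) * k)%N); last by rewrite -mulnA leq_mul.
rewrite leq_mul2r mulnDr muln2 addnn leq_add2l.
by rewrite leq_pmull ?orbT.
Qed.

(** If every shift by d at least doubled D, then D (1 + j d) would be at least 2^j, against the
    polynomial bound. *)
Lemma polynomial_slow_growth (D : nat -> nat) k d :
  (forall N, D N <= N ^ k)%N -> (0 < D 1)%N -> exists N, (D (N + d) < D N + D N)%N.
Proof.
move=> Dk D1; apply: contrapT => no.
have h N : (D N + D N <= D (N + d))%N.
  by rewrite leqNgt; apply/negP => lt; apply: no; exists N.
have hj j : (2 ^ j <= D (1 + j * d))%N.
  elim: j => [|j IHj]; first by rewrite mul0n addn0.
  rewrite expnS mul2n -addnn mulSn [(d + _)%N]addnC addnA.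
  by apply: leq_trans (h _); rewrite leq_add.
have [j] := exponential_growth k d; rewrite ltnNge => /negP; apply.
exact: leq_trans (hj j) (Dk _).
Qed.

Lemma card_bmultinom_le n N : (#|{: 'X_{1..n < N}}| <= N ^ n)%N.
Proof.
case: N => [|N].
  by rewrite (@eq_card0 _ {: 'X_{1..n < 0}}) // => -[].
pose f (m : 'X_{1..n < N.+1}) : {ffun 'I_n -> 'I_N.+1} := [ffun i => inord ((m : 'X_{1..n}) i)].
have finj : injective f.
  move=> a b /ffunP e; apply/val_inj/mnmP => i; have := e i; rewrite !ffunE.
  have lt (m : 'X_{1..n < N.+1}) : ((m : 'X_{1..n}) i < N.+1)%N.
    by apply: leq_ltn_trans (bmdeg m); rewrite mdegE (bigD1 i) //= leq_addr.
  by move/(congr1 val); rewrite /= !inordK.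
by have := leq_card f finj; rewrite card_ffun !card_ord.
Qed.

Section WeylOre.
Variables (C : numFieldType) (n : nat) (A : pzAlgType C).
Local Notation S := {mpoly C[n]}.
Variables X D : {rmorphism S -> A}.
Hypothesis XC : forall a, X a%:MP = scalar_of a.
Hypothesis DC : forall a, D a%:MP = scalar_of a.
Hypothesis DX : forall i j, D 'X_i * X 'X_j = X 'X_j * D 'X_i + (i == j)%:R.
Hypothesis gen_ind : forall P : A -> Prop, P 1 ->
  (forall x y, P x -> P y -> P (x + y)) ->
  (forall a x, P x -> P (scalar_of a * x)) ->
  (forall i x, P x -> P (X 'X_i * x)) ->
  (forall i x, P x -> P (D 'X_i * x)) -> forall x, P x.
Local Notation nf := (normal_form X D 1).
Hypothesis nf_inj : forall F, nf F = 0 -> F = 0.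
Hypothesis A_neq0 : 1 != 0 :> A.
Hypothesis A_integral : forall P Q : A, P * Q = 0 -> P = 0 \/ Q = 0.

(** Degree in the D's and degree in the X's are both below N. The corresponding piece has at most
    N^(2n) basis monomials. *)
Definition weyl_bounded N (F : {mpoly S[n]}) : Prop :=
  (msize F <= N)%N /\ forall b, (msize F@_b <= N)%N.

Lemma weyl_bounded_le N N' F : (N <= N')%N -> weyl_bounded N F -> weyl_bounded N' F.
Proof. by move=> NN [h hc]; split=> [|b]; apply: leq_trans NN. Qed.

Lemma weyl_boundedD N F G : weyl_bounded N F -> weyl_bounded N G -> weyl_bounded N (F + G).
Proof.
move=> [hF cF] [hG cG]; split=> [|b]; first exact: msizeD_leP.
by rewrite mcoeffD msizeD_leP.
Qed.

Lemma weyl_boundedC N c F : weyl_bounded N F -> weyl_bounded N (c%:MP *: F).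
Proof.
move=> [hF cF]; split=> [|b]; first exact: leq_trans (msizeZ_le _ _) hF.
by rewrite mcoeffZ mul_mpolyC; apply: leq_trans (msizeZ_le _ _) _.
Qed.

Lemma weyl_bounded_x N i F : weyl_bounded N F -> weyl_bounded N.+1 ('X_i *: F).
Proof.
move=> [hF cF]; split=> [|b]; first by apply: leq_trans (msizeZ_le _ _) (leqW hF).
by rewrite mcoeffZ; apply: msizeM_form (cF b); rewrite dhomogX /= mdeg1.
Qed.

Lemma weyl_bounded_d N i F : weyl_bounded N F -> weyl_bounded N.+1 ('X_i * F).
Proof.
move=> [hF cF]; split=> [|b]; first by apply: msizeM_form hF; rewrite dhomogX /= mdeg1.
apply: leqW; have [bi|bi] := eqVneq (b i) 0%N; last first.
  have e : b = ((b - U_(i)) + U_(i))%MM by rewrite submK // lep1mP.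
  by rewrite e mulrC addmC mcoeffMX.
rewrite memN_msupp_eq0 ?msize0 // mulrC (perm_mem (msuppMX _ _)).
apply/negP => /mapP[m _ e]; move: bi; rewrite e mnmDE mnm1E eqxx.
by [].
Qed.

Lemma weyl_bounded_dc N i F : weyl_bounded N F -> weyl_bounded N (map_mpoly (mderiv i) F).
Proof.
move=> [hF cF]; split=> [|b]; first exact: leq_trans (msize_map_mpoly _ _) hF.
rewrite mcoeff_map_mpoly; apply: leq_trans (msize_mderiv _ _) _.
exact: leq_trans (leq_pred _) (cF b).
Qed.

Lemma weyl_bounded_dz N i F : weyl_bounded N F -> weyl_bounded N F^`M(i).
Proof.
move=> [hF cF]; split=> [|b].
  apply: msize_leP => m; rewrite mcoeff_msupp mcoeff_deriv => h.
  have : (m + U_(i))%MM \in msupp F.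
    by rewrite mcoeff_msupp; apply: contraNneq h => ->; rewrite mul0rn.
  move/msize_mdeg_lt; rewrite mdegD mdeg1 addn1 => /ltnW lt.
  exact: leq_trans lt hF.
rewrite mcoeff_deriv -scaler_nat; apply: leq_trans (msizeZ_le _ _) _.
exact: cF.
Qed.

Definition weyl_index N : finType := ('X_{1..n < N} * 'X_{1..n < N})%type.
Definition weyl_mon N (e : weyl_index N) : A :=
  X 'X_[(e.1 : 'X_{1..n})] * D 'X_[(e.2 : 'X_{1..n})].
Local Notation span := (mon_span weyl_mon).

Lemma weyl_bounded_span N F : weyl_bounded N F -> span N (nf F).
Proof.
move=> [hF cF]; exists (fun e : weyl_index N => F@_(e.2 : 'X_{1..n})@_(e.1 : 'X_{1..n})).
rewrite /normal_form (mfoldwE _ hF).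
transitivity (\sum_(b : 'X_{1..n < N}) \sum_(a : 'X_{1..n < N})
    scalar_of (F@_b@_a) * (X 'X_[a] * D 'X_[b])).
  apply: eq_bigr => b _; rewrite /= /monomial_map mulr1 [in LHS](mpolywE (cF b)).
  rewrite (raddf_sum X) mulr_suml; apply: eq_bigr => a _ /=.
  by rewrite -mul_mpolyC rmorphM XC mulrA.
by rewrite exchange_big pair_bigA; apply: eq_bigr => -[a b] _.
Qed.

Lemma weyl_mon_free N (c : weyl_index N -> C) :
  \sum_e scalar_of (c e) * weyl_mon e = 0 -> forall e, c e = 0.
Proof.
pose F : {mpoly S[n]} := \sum_(e : weyl_index N)
  (c e *: 'X_[(e.1 : 'X_{1..n})]) *: 'X_[(e.2 : 'X_{1..n})].
have -> : \sum_e scalar_of (c e) * weyl_mon e = nf F.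
  rewrite /F /normal_form (raddf_sum (mfold (monomial_map X D 1))) /=.
  apply: eq_bigr => e _.
  by rewrite mfoldZX /= /monomial_map mulr1 -mul_mpolyC rmorphM XC mulrA.
move=> /nf_inj F0 e.
have := congr1 (fun G : {mpoly S[n]} => G@_(e.2 : 'X_{1..n})@_(e.1 : 'X_{1..n})) F0.
rewrite /= !mcoeff0 /F raddf_sum raddf_sum (bigD1 e) //= !mcoeffZ !mcoeffX eqxx !mulr1.
rewrite mcoeffZ mcoeffX eqxx mulr1.
rewrite big1 ?addr0 // => -[a b] ne; rewrite !mcoeffZ mcoeffX /=.
have [eb|_] := eqVneq (b : 'X_{1..n}) (e.2 : 'X_{1..n}); last by rewrite mulr0 mcoeff0.
rewrite mulr1 mcoeffZ mcoeffX; have [ea|_] := eqVneq (a : 'X_{1..n}) (e.1 : 'X_{1..n}); last by rewrite mulr0.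
by case/eqP: ne; case: e ea eb {F0} => /= e1 e2 /val_inj -> /val_inj ->.
Qed.

Lemma weyl_slow_growth d :
  exists N, (#|weyl_index (N + d)| < #|weyl_index N| + #|weyl_index N|)%N.
Proof.
apply: (@polynomial_slow_growth (fun N => #|weyl_index N|) (n + n)) => [N|].
  by rewrite card_prod expnD leq_mul // card_bmultinom_le.
by apply/card_gt0P; exists (@bm0 n 0, @bm0 n 0).
Qed.

(** Each generator raises the filtration by at most one. The claim covers all d from d0 on so that
    two elements can share a shift. *)
Lemma weyl_left_filtered (x : A) : exists d0, forall d, (d0 <= d)%N -> forall N F,
  weyl_bounded N F -> exists G, x * nf F = nf G /\ weyl_bounded (N + d) G.
Proof.
elim/gen_ind: x => [|x y [dx hx] [dy hy]|a x [d0 hx]|i x [d0 hx]|i x [d0 hx]].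
- exists 0%N => d _ N F hF; exists F; rewrite mul1r; split=> //.
  by apply: weyl_bounded_le hF; rewrite leq_addr.
- exists (maxn dx dy) => d; rewrite geq_max => /andP[dxd dyd] N F hF.
  have [G [eG hG]] := hx d dxd N F hF; have [H [eH hH]] := hy d dyd N F hF.
  exists (G + H); rewrite mulrDl eG eH normal_formD; split=> //.
  exact: weyl_boundedD.
- exists d0 => d dd N F hF; have [G [eG hG]] := hx d dd N F hF.
  exists (a%:MP *: G); rewrite -mulrA eG (normal_form_scalar D XC); split=> //.
  exact: weyl_boundedC.
- exists d0.+1 => -[|d] // dd N F hF; have [G [eG hG]] := hx d dd N F hF.
  exists ('X_i *: G); rewrite -mulrA eG normal_form_mulX addnS; split=> //.
  exact: weyl_bounded_x.
- exists d0.+1 => -[|d] // dd N F hF; have [G [eG hG]] := hx d dd N F hF.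
  exists (map_mpoly (mderiv i) G + 'X_i * G).
  rewrite -mulrA eG (normal_form_Dmul XC DX) addnS; split=> //.
  apply: weyl_boundedD; last exact: weyl_bounded_d.
  exact: weyl_bounded_le (leqnSn _) (weyl_bounded_dc _ hG).
Qed.

Lemma weyl_right_filtered (x : A) : exists d0, forall d, (d0 <= d)%N -> forall N F,
  weyl_bounded N F -> exists G, nf F * x = nf G /\ weyl_bounded (N + d) G.
Proof.
elim/gen_ind: x => [|x y [dx hx] [dy hy]|a x [d0 hx]|i x [d0 hx]|i x [d0 hx]].
- exists 0%N => d _ N F hF; exists F; rewrite mulr1; split=> //.
  by apply: weyl_bounded_le hF; rewrite leq_addr.
- exists (maxn dx dy) => d; rewrite geq_max => /andP[dxd dyd] N F hF.
  have [G [eG hG]] := hx d dxd N F hF; have [H [eH hH]] := hy d dyd N F hF.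
  exists (G + H); rewrite mulrDr eG eH normal_formD; split=> //.
  exact: weyl_boundedD.
- exists d0 => d dd N F hF; have [G [eG hG]] := hx d dd N F hF.
  exists (a%:MP *: G); split; last exact: weyl_boundedC.
  by rewrite mulrA -scalar_of_central -mulrA eG (normal_form_scalar D XC).
- exists d0.+1 => -[|d] // dd N F hF.
  (* On the right the new generator meets the normal form before x does, so the induction hypothesis
     is applied one filtration level higher. *)
  have [] := hx d dd N.+1 ('X_i *: F + F^`M(i)).
    apply: weyl_boundedD; first exact: weyl_bounded_x.
    exact: weyl_bounded_le (leqnSn _) (weyl_bounded_dz _ hF).
  move=> G [eG hG]; exists G; rewrite addnS -addSn; split=> //.
  by rewrite mulrA (normal_form_mulXr DC DX).
- exists d0.+1 => -[|d] // dd N F hF.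
  have [G [eG hG]] := hx d dd N.+1 _ (weyl_bounded_d i hF).
  exists G; rewrite addnS -addSn; split=> //.
  by rewrite mulrA normal_form_mulD.
Qed.

Lemma weyl_mon_nf N (e : weyl_index N) : exists F, weyl_mon e = nf F /\ weyl_bounded N F.
Proof.
case: e => a b; exists ('X_[(a : 'X_{1..n})] *: 'X_[(b : 'X_{1..n})]).
rewrite normal_formZX mulr1; split=> //; split=> [|m].
  by apply: leq_trans (msizeZ_le _ _) _; rewrite msizeX; apply: bmdeg.
rewrite mcoeffZ mcoeffX; case: eqP => _; last by rewrite mulr0 msize0.
by rewrite mulr1 msizeX; apply: bmdeg.
Qed.

(** The growth argument gives a u = b v with u or v nonzero; in a domain, with a and b nonzero, this
    forces u to be nonzero. *)
Lemma weyl_ore : ore_domain A.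
Proof.
have zero_of (u v a b : A) (mu : A -> A -> A) :
    (forall a, mu a 0 = 0) -> (forall x y, mu x y = 0 -> x = 0 \/ y = 0) ->
    a != 0 -> b != 0 -> u != 0 \/ v != 0 -> mu a u = mu b v -> u != 0.
  move=> mu0 muI a0 b0 [//|v0] e; apply/eqP => u0.
  move: e; rewrite u0 mu0 => /esym/muI[z|z]; first by rewrite z eqxx in b0.
  by rewrite z eqxx in v0.
split=> // a b a0 b0.
  have [] := @growth_common_multiple C A weyl_index weyl_mon weyl_mon_free
    weyl_slow_growth *%R _ _ _ a b.
  - by move=> *; rewrite mulrDr.
  - by move=> x c y; rewrite mulrA -scalar_of_central mulrA.
  - move=> x; have [d0 hd] := weyl_left_filtered x; exists d0 => d dd N e.
    have [F [-> hF]] := weyl_mon_nf e; have [G [-> hG]] := hd d dd N F hF.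
    exact: weyl_bounded_span.
  move=> u [v [uv e]]; exists v, u; split=> //.
  by apply: (zero_of u v a b *%R) => // x; rewrite mulr0.
have [] := @growth_common_multiple C A weyl_index weyl_mon weyl_mon_free
  weyl_slow_growth (fun x y => y * x) _ _ _ a b.
- by move=> *; rewrite mulrDl.
- by move=> x c y; rewrite mulrA.
- move=> x; have [d0 hd] := weyl_right_filtered x; exists d0 => d dd N e.
  have [F [-> hF]] := weyl_mon_nf e; have [G [-> hG]] := hd d dd N F hF.
  exact: weyl_bounded_span.
move=> u [v [uv e]]; exists v, u; split=> //.
apply: (zero_of u v a b (fun x y => y * x)) => // [x|x y].
  by rewrite mul0r.
by move=> /A_integral[]; [right|left].
Qed.

End WeylOre.

(** * Dunkl operators *)

Section DunklOperators.
Variables (C : numClosedFieldType) (V : vectType C) (W : finGroupType).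
Variable rho : W -> 'End(V).
Hypothesis rhoP : linear_group rho.
Local Notation n := (\dim {:V}).
Local Notation S := {mpoly C[n]}.
Local Notation form := 'Hom(V, C^o).
Local Notation b := (vbasis {:V}).

Definition coordinate_form (x : form) : S := linear_form (\row_j x b`_j : 'rV[C]_n).
Local Notation lin := coordinate_form.

Definition dir_deriv (xi : V) (p : S) : S := \sum_j coord b j xi *: p^`M(j).

(** The matrix of w^-1, so that substitution is the dual action of w on linear forms. *)
Definition group_matrix (w : W) : 'M[C]_n := \matrix_(i, j) coord b i (rho w^-1%g b`_j).
Local Notation act w := (lsub (group_matrix w)).

Lemma rho1 v : rho 1%g v = v.
Proof. by rewrite (linear_group1 rhoP) id_lfunE. Qed.

Lemma rhoM g h v : rho (g * h)%g v = rho g (rho h v).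
Proof. by rewrite (linear_groupM rhoP) comp_lfunE. Qed.

Lemma rhoK g v : rho g^-1%g (rho g v) = v.
Proof. by rewrite -rhoM mulVg rho1. Qed.

Lemma rhoKV g v : rho g (rho g^-1%g v) = v.
Proof. by rewrite -rhoM mulgV rho1. Qed.

Lemma coord_basisE v : v = \sum_i coord b i v *: b`_i.
Proof. exact: coord_vbasis (memvf v). Qed.

Lemma coord_basis (i j : 'I_n) : coord b i b`_j = (j == i)%:R.
Proof. exact/coord_free/(basis_free (vbasisP _)). Qed.

Lemma group_matrix1 : group_matrix 1%g = 1%:M.
Proof.
by apply/matrixP => i j; rewrite !mxE invg1 rho1 coord_basis [j == i]eq_sym.
Qed.

Lemma group_matrixM g h : group_matrix (g * h)%g = group_matrix h *m group_matrix g.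
Proof.
apply/matrixP => i j; rewrite !mxE invMg rhoM {1}[rho g^-1%g _]coord_basisE.
rewrite raddf_sum raddf_sum; apply: eq_bigr => k _.
by rewrite /= linearZ /= linearZ /= !mxE mulrC.
Qed.

Fact coordinate_form_is_linear : linear lin.
Proof.
move=> a x y; rewrite /coordinate_form -linearP; congr linear_form.
by apply/rowP => j; rewrite !mxE add_lfunE scale_lfunE.
Qed.
HB.instance Definition _ :=
  GRing.isLinear.Build C form S *:%R lin coordinate_form_is_linear.

Lemma coordinate_form_inj : injective lin.
Proof.
move=> x y /linear_form_inj/rowP e; apply/lfunP => v.
rewrite [v]coord_basisE !raddf_sum; apply: eq_bigr => j _.
by rewrite /= !linearZ /=; have := e j; rewrite !mxE => ->.
Qed.

Lemma act_form w x : act w (lin x) = lin (x \o rho w^-1%g)%VF.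
Proof.
rewrite lsub_form; congr linear_form; apply/rowP => j; rewrite !mxE comp_lfunE.
rewrite [rho _ _]coord_basisE raddf_sum; apply: eq_bigr => i _.
by rewrite /= !mxE linearZ mulrC.
Qed.

Lemma dir_deriv_form xi x : dir_deriv xi (lin x) = (x xi : C)%:MP.
Proof.
rewrite /dir_deriv [in RHS](coord_basisE xi) raddf_sum raddf_sum.
apply: eq_bigr => j _; rewrite mderiv_form mxE /= linearZ /= -mul_mpolyC -mpolyCM.
by [].
Qed.

Lemma dir_derivM xi p q :
  dir_deriv xi (p * q) = dir_deriv xi p * q + p * dir_deriv xi q.
Proof.
rewrite /dir_deriv mulr_suml mulr_sumr -big_split; apply: eq_bigr => j _.
by rewrite mderivM scalerDr scalerAl scalerAr.
Qed.

Lemma dir_derivC xi c : dir_deriv xi c%:MP = 0.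
Proof. by rewrite /dir_deriv big1 // => j _; rewrite mderivC scaler0. Qed.

Lemma dir_derivDl a xi xi' p :
  dir_deriv (a *: xi + xi') p = a *: dir_deriv xi p + dir_deriv xi' p.
Proof.
rewrite /dir_deriv scaler_sumr -big_split; apply: eq_bigr => j _.
by rewrite linearP scalerDl scalerA.
Qed.

Lemma act_dir_deriv w xi p :
  act w (dir_deriv xi p) = dir_deriv (rho w xi) (act w p).
Proof.
rewrite /dir_deriv; under [RHS]eq_bigr => l _ do rewrite mderiv_lsub scaler_sumr.
rewrite exchange_big (raddf_sum (act w)); apply: eq_bigr => i _ /=.
under eq_bigr => l _ do rewrite scalerA.
rewrite -scaler_suml linearZ; congr (_ *: _).
rewrite -{1}(rhoK w xi) [rho w xi]coord_basisE !raddf_sum; apply: eq_bigr => l _.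
by rewrite /= !linearZ /= mxE -coord_basisE.
Qed.

Lemma coordinate_formX i : exists x, 'X_i = lin x.
Proof.
exists (linfun (coord b i : V -> C^o)); rewrite -linear_formX; congr linear_form.
by apply/rowP => j; rewrite !mxE lfunE /= coord_free ?(basis_free (vbasisP _)) //.
Qed.

Lemma coordinate_ind (P : S -> Prop) : (forall c, P c%:MP) ->
  (forall p q, P p -> P q -> P (p + q)) -> (forall x p, P p -> P (lin x * p)) ->
  forall p, P p.
Proof.
move=> PC PD PX; elim/mpoly_ring_ind => // i p Pp.
by have [x ->] := coordinate_formX i; apply: PX.
Qed.

Variables (Refl : {set W}) (lambda bcoef : W -> C).
Hypothesis Refl_conj : forall s w : W, s \in Refl -> (w * s * w^-1)%g \in Refl.
Hypothesis Refl_neq1 : forall s, s \in Refl -> s != 1%g.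
Hypothesis Refl_rank1 : forall s, s \in Refl ->
  exists (a : form) (v : V), forall xi, rho s xi - xi = (a xi : C) *: v.
Hypothesis Refl_lambda : forall s xi, s \in Refl ->
  rho s (rho s xi - xi) = lambda s *: (rho s xi - xi).
Hypothesis bcoef_conj : forall s w : W, s \in Refl -> bcoef (w * s * w^-1)%g = bcoef s.

Local Notation one_minus s := (rho s - \1)%VF.

Lemma rho_neq1 s : s \in Refl -> exists xi, rho s xi != xi.
Proof.
move=> sR; apply: contrapT => no; have /negP[] := Refl_neq1 sR.
apply/eqP/(linear_group_inj rhoP)/lfunP => v; rewrite rho1.
by apply/eqP; apply: contraT => h; case: no; exists v.
Qed.

Lemma lambda_neq0 s : s \in Refl -> lambda s != 0.
Proof.
move=> sR; have [xi xi0] := rho_neq1 sR; apply: contra_neq xi0 => l0.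
have := Refl_lambda xi sR; rewrite l0 scale0r => /(congr1 (rho s^-1%g)).
by rewrite rhoK linear0 => /eqP; rewrite subr_eq0 => /eqP.
Qed.

Lemma lambda_conj s w : s \in Refl -> lambda (w * s * w^-1)%g = lambda s.
Proof.
move=> sR; have [xi xi0] := rho_neq1 sR.
have := Refl_lambda (rho w xi) (Refl_conj w sR).
rewrite !rhoM rhoK -linearB /= rhoK Refl_lambda // linearZ /= => /eqP.
rewrite -subr_eq0 -scalerBl scaler_eq0 subr_eq0 => /orP[/eqP-> //|].
move=> /eqP/(congr1 (rho w^-1%g)); rewrite rhoK linear0 => /eqP.
by rewrite subr_eq0 (negPf xi0).
Qed.

(** A multiple of the form defining the hyperplane of s. Letting x vary avoids choosing that
    form. *)
Definition refl_form s (x : form) : S := lin (x \o (rho s - \1))%VF.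

Lemma refl_form_eval s (x : form) xi : (x \o (rho s - \1))%VF xi = x (rho s xi - xi).
Proof. by rewrite comp_lfunE !lfunE /= opp_lfunE id_lfunE. Qed.

Lemma refl_form_neq0 s : s \in Refl -> exists x, refl_form s x != 0.
Proof.
move=> /rho_neq1[xi xi0].
have [i ci] : exists i, coord b i (rho s xi - xi) != 0.
  apply: contrapT => no; move: xi0; rewrite -subr_eq0 [rho s xi - xi]coord_basisE.
  rewrite big1 ?eqxx // => i _; have -> : coord b i (rho s xi - xi) = 0.
    by apply/eqP; apply: contraT => h; case: no; exists i.
  by rewrite scale0r.
exists (linfun (coord b i : V -> C^o)); apply: contra_neq ci => e.
have /lfunP/(_ xi) : (linfun (coord b i : V -> C^o) \o (rho s - \1))%VF = 0.
  by apply: coordinate_form_inj; rewrite [LHS]e raddf0.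
by rewrite refl_form_eval !lfunE.
Qed.

(** The reflection s acts by lambda on the image of s - 1, hence s^-1 v - v = - lambda^-1 (s v -
    v). *)
Lemma act_refl_form s x : s \in Refl ->
  act s (lin x) - lin x = - (lambda s)^-1 *: refl_form s x.
Proof.
move=> sR; rewrite act_form -raddfB -linearZ; congr lin; apply/lfunP => v.
rewrite !lfunE /= opp_lfunE comp_lfunE refl_form_eval -raddfB /=.
have -> : rho s^-1%g v - v = - (lambda s)^-1 *: (rho s v - v).
  rewrite scaleNr -[RHS]opprK; apply: (can_inj (rhoK s)).
  rewrite linearB /= rhoKV !opprK linearN linearZ /= Refl_lambda //.
  by rewrite scalerA mulVf ?lambda_neq0 // scale1r opprB.
by rewrite linearZ.
Qed.

Lemma refl_form_sym s (x y : form) xi : s \in Refl ->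
  (y (rho s xi - xi) : C) *: refl_form s x = (x (rho s xi - xi) : C) *: refl_form s y.
Proof.
move=> /Refl_rank1[a [v av]]; rewrite -!linearZ; congr lin; apply/lfunP => u.
rewrite !scale_lfunE !refl_form_eval !av !linearZ /=.
by rewrite /GRing.scale /= mulrAC.
Qed.

(** The twisted Leibniz rule s(yp) - yp = y (sp - p) + (sy - y) sp for divided differences. It
    supplies the quotient for y p from that for p. *)
Lemma dunkl_term_formE s xi (x y : form) p q : s \in Refl ->
  refl_form s x * q = (x (rho s xi - xi) : C) *: (act s p - p) ->
  refl_form s x * (lin y * q - ((lambda s)^-1 * y (rho s xi - xi)) *: act s p)
  = (x (rho s xi - xi) : C) *: (act s (lin y * p) - lin y * p).
Proof.
move=> sR e; rewrite mulrBr mulrCA e rmorphM /=.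
have -> : act s (lin y) = lin y - (lambda s)^-1 *: refl_form s y.
  by rewrite -scaleNr -act_refl_form // addrC subrK.
have -> : refl_form s x * (((lambda s)^-1 * y (rho s xi - xi)) *: act s p)
    = x (rho s xi - xi) *: ((lambda s)^-1 *: refl_form s y * act s p).
  rewrite -scalerAr -scalerA scalerAl refl_form_sym //.
  by rewrite -!scalerAl !scalerA mulrC.
by rewrite mulrBl -scalerAr -scalerBr mulrBr addrAC.
Qed.

Lemma dunkl_term_subproof s xi p : s \in Refl -> exists q, forall x,
  refl_form s x * q = (x (rho s xi - xi) : C) *: (act s p - p).
Proof.
move=> sR; elim/coordinate_ind: p => [c|p p' [q e] [q' e']|y p [q e]].
- by exists 0 => x; rewrite lsubC subrr scaler0 mulr0.
- by exists (q + q') => x; rewrite mulrDr e e' -scalerDr (raddfD (lsub _)) opprD [in RHS]addrACA.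
- exists (lin y * q - ((lambda s)^-1 * y (rho s xi - xi)) *: act s p) => x.
  exact: dunkl_term_formE.
Qed.

Fact dunkl_term_ex s xi p : exists q, s \in Refl -> forall x,
  refl_form s x * q = (x (rho s xi - xi) : C) *: (act s p - p).
Proof.
have [sR|_] := boolP (s \in Refl); last by exists 0.
by have [q e] := dunkl_term_subproof xi p sR; exists q.
Qed.

(** With s u - u = a(u) v for all u, this is the polynomial a(xi) (s p - p) / a. [dunkl_termE]
    states it without division, for every x at once. *)
Definition dunkl_term s xi p : S := sval (cid (dunkl_term_ex s xi p)).

Lemma dunkl_termE s xi p : s \in Refl -> forall x,
  refl_form s x * dunkl_term s xi p = (x (rho s xi - xi) : C) *: (act s p - p).
Proof. exact: (svalP (cid (dunkl_term_ex s xi p))). Qed.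

Lemma dunkl_term_eq s xi p q : s \in Refl ->
  (forall x, refl_form s x * q = (x (rho s xi - xi) : C) *: (act s p - p)) ->
  dunkl_term s xi p = q.
Proof.
move=> sR e; have [x x0] := refl_form_neq0 sR.
by apply: (mulfI x0); rewrite e dunkl_termE.
Qed.

Lemma dunkl_termD s xi p q : s \in Refl ->
  dunkl_term s xi (p + q) = dunkl_term s xi p + dunkl_term s xi q.
Proof.
move=> sR; apply: dunkl_term_eq => // x.
by rewrite mulrDr !dunkl_termE // -scalerDr (raddfD (lsub _)) opprD [in RHS]addrACA.
Qed.

Lemma dunkl_termDl s a xi xi' p : s \in Refl ->
  dunkl_term s (a *: xi + xi') p = a *: dunkl_term s xi p + dunkl_term s xi' p.
Proof.
move=> sR; apply: dunkl_term_eq => // x.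
rewrite mulrDr -scalerAr !dunkl_termE // scalerA -scalerDl; congr (_ *: _).
by rewrite linearP opprD addrACA -scalerBr linearP.
Qed.

Lemma dunkl_termM s xi g p : s \in Refl -> act s g = g ->
  dunkl_term s xi (g * p) = g * dunkl_term s xi p.
Proof.
move=> sR gs; apply: dunkl_term_eq => // x.
by rewrite mulrCA dunkl_termE // -scalerAr rmorphM /= gs mulrBr.
Qed.

Lemma dunkl_termC s xi c : s \in Refl -> dunkl_term s xi c%:MP = 0.
Proof.
by move=> sR; apply: dunkl_term_eq => // x; rewrite lsubC subrr scaler0 mulr0.
Qed.

Lemma dunkl_term_form s xi y p : s \in Refl -> dunkl_term s xi (lin y * p) =
  lin y * dunkl_term s xi p - ((lambda s)^-1 * y (rho s xi - xi)) *: act s p.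
Proof.
move=> sR; apply: dunkl_term_eq => // x.
exact: (dunkl_term_formE _ sR (dunkl_termE xi p sR x)).
Qed.

Lemma group_actM w w' p : act w (act w' p) = act (w * w')%g p.
Proof. by rewrite lsubM -group_matrixM. Qed.

Lemma act_dunkl_term w s xi p : s \in Refl ->
  act w (dunkl_term s xi p) = dunkl_term (w * s * w^-1)%g (rho w xi) (act w p).
Proof.
move=> sR; apply/esym/dunkl_term_eq => [|x]; first exact: Refl_conj.
have -> : refl_form (w * s * w^-1)%g x = act w (refl_form s (x \o rho w)%VF).
  rewrite [RHS]act_form; congr lin; apply/lfunP => v.
  rewrite refl_form_eval [RHS]comp_lfunE refl_form_eval comp_lfunE.
  by rewrite (raddfB (rho w)) /= rhoKV !rhoM.
rewrite -rmorphM /= dunkl_termE // linearZ /= (raddfB (act w)) /= !group_actM.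
rewrite -!mulgA mulVg mulg1 comp_lfunE !rhoM rhoK.
by rewrite (raddfB (rho w)).
Qed.

(** The Dunkl operator. The factor - lambda s bcoef s is chosen so that s occurs in the commutator
    with a form x with coefficient bcoef s x(s xi - xi); see [dunkl_form]. *)
Definition dunkl : V -> S -> S := locked (fun xi p =>
  dir_deriv xi p + \sum_(s in Refl) (- (lambda s * bcoef s)) *: dunkl_term s xi p).

Lemma dunklE xi p : dunkl xi p = dir_deriv xi p +
  \sum_(s in Refl) (- (lambda s * bcoef s)) *: dunkl_term s xi p.
Proof. by rewrite /dunkl -lock. Qed.

Lemma act_dunkl w xi p : act w (dunkl xi p) = dunkl (rho w xi) (act w p).
Proof.
rewrite !dunklE raddfD /= act_dir_deriv; congr (_ + _).
rewrite (raddf_sum (act w)) /=.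
have ci : injective (fun s => w * s * w^-1)%g by move=> s t /mulIg/mulgI.
rewrite [RHS](reindex_inj ci) /=; apply: eq_big => [s|s sR].
  apply/idP/idP => [/Refl_conj//|/(Refl_conj w^-1%g)].
  by rewrite invgK !mulgA mulVg mul1g -mulgA mulVg mulg1.
by rewrite linearZ /= act_dunkl_term // lambda_conj // bcoef_conj.
Qed.

Lemma dunklD xi p q : dunkl xi (p + q) = dunkl xi p + dunkl xi q.
Proof.
rewrite !dunklE /dir_deriv addrACA -!big_split; congr (_ + _); apply: eq_bigr => i iP.
  by rewrite raddfD scalerDr.
by rewrite dunkl_termD // scalerDr.
Qed.

Lemma dunklDl a xi xi' p : dunkl (a *: xi + xi') p = a *: dunkl xi p + dunkl xi' p.
Proof.
rewrite !dunklE dir_derivDl scalerDr addrACA; congr (_ + _).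
rewrite scaler_sumr -big_split; apply: eq_bigr => s sR.
by rewrite dunkl_termDl // scalerDr !scalerA mulrC.
Qed.

(** Divided differences are linear over invariant factors, so only the directional derivative acts
    on g. Through this rule Dunkl operators become differential operators on invariants. *)
Lemma dunklM xi g p : (forall s, s \in Refl -> act s g = g) ->
  dunkl xi (g * p) = g * dunkl xi p + dir_deriv xi g * p.
Proof.
move=> gs; rewrite !dunklE dir_derivM mulrDr [RHS]addrC addrA; congr (_ + _).
rewrite mulr_sumr; apply: eq_bigr => s sR.
by rewrite dunkl_termM ?gs // scalerAr.
Qed.

Lemma dunklC xi c : dunkl xi c%:MP = 0.
Proof.
rewrite !dunklE dir_derivC add0r big1 // => s sR.
by rewrite dunkl_termC // scaler0.
Qed.

Fact dunkl_linear xi : linear (dunkl xi).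
Proof.
move=> a p q; rewrite dunklD -mul_mpolyC dunklM; first last.
  by move=> s _; rewrite lsubC.
by rewrite dir_derivC mul0r addr0 mul_mpolyC.
Qed.

Lemma dunkl_form xi (x : form) p : dunkl xi (lin x * p) =
  lin x * dunkl xi p + (x xi : C) *: p
  + \sum_(s in Refl) (bcoef s * x (rho s xi - xi)) *: act s p.
Proof.
rewrite !dunklE dir_derivM dir_deriv_form mul_mpolyC mulrDr [_ *: p + _]addrC.
rewrite -!addrA; congr (_ + _); rewrite addrCA; congr (_ + _).
rewrite mulr_sumr -big_split; apply: eq_bigr => s sR.
rewrite dunkl_term_form // scalerBr scalerAr; congr (_ + _).
rewrite scalerA mulNr scaleNr opprK; congr (_ *: _).
by rewrite mulrACA mulfV ?lambda_neq0 // mul1r.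
Qed.

Lemma dunkl0 xi : dunkl xi 0 = 0.
Proof. by rewrite -mpolyC0 dunklC. Qed.

Lemma dunkl_sum xi I (r : seq I) (P : pred I) F :
  dunkl xi (\sum_(i <- r | P i) F i) = \sum_(i <- r | P i) dunkl xi (F i).
Proof. exact: (big_morph _ (dunklD xi) (dunklC xi 0)). Qed.

Lemma dunklZ xi a p : dunkl xi (a *: p) = a *: dunkl xi p.
Proof. by have := dunkl_linear xi a p 0; rewrite !addr0 (dunklC xi 0) addr0. Qed.

Lemma dunkl0l p : dunkl 0 p = 0.
Proof. by have := dunklDl (-1) 0 0 p; rewrite scaler0 addr0 scaleN1r addNr. Qed.

(** By equivariance both commutators are Dunkl operators in directions s xi - xi and s eta - eta,
    which lie on one line, applied to s p. *)
Lemma dunkl_refl_sym s (x : form) xi eta p : s \in Refl ->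
  x (rho s xi - xi) *: (act s (dunkl eta p) - dunkl eta (act s p))
  = x (rho s eta - eta) *: (act s (dunkl xi p) - dunkl xi (act s p)).
Proof.
move=> sR.
have comm zeta : act s (dunkl zeta p) - dunkl zeta (act s p)
    = dunkl (rho s zeta - zeta) (act s p).
  rewrite act_dunkl addrC -scaleN1r -dunklDl scaleN1r addrC.
  by [].
rewrite !comm; have [a [v av]] := Refl_rank1 sR.
have Zl c zeta q : dunkl (c *: zeta) q = c *: dunkl zeta q.
  by have := dunklDl c zeta 0 q; rewrite dunkl0l !addr0.
have xZ c : x (c *: v) = (c * x v : C) by exact: linearZ.
rewrite -!Zl !av !xZ !scalerA; congr (dunkl (_ *: _) _).
by rewrite mulrAC [RHS]mulrAC [a eta * _]mulrC.
Qed.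

(** The commutator of two Dunkl operators kills constants. It also commutes with multiplication by
    forms: its bracket with x is a sum over reflections of the differences that vanish by
    [dunkl_refl_sym]. Hence it kills all polynomials. *)
Lemma dunkl_commute xi eta p : dunkl xi (dunkl eta p) = dunkl eta (dunkl xi p).
Proof.
elim/coordinate_ind: p => [c|p q ep eq|x p e].
- by rewrite !(dunklC, dunkl0).
- by rewrite !dunklD ep eq.
rewrite !dunkl_form !dunklD !dunkl_form !dunkl_sum !dunklZ e.
rewrite -!addrA; congr (_ + _); rewrite [LHS]addrCA [RHS]addrC -!addrA.
rewrite [X in _ + (_ + X) = _]addrC.
rewrite [LHS]addrC [RHS]addrC -!addrA [X in _ + X = _]addrCA; congr (_ + _).
rewrite [RHS]addrCA; congr (_ + _).
rewrite -!big_split; apply: eq_bigr => s sR /=.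
have := dunkl_refl_sym x xi eta p sR.
rewrite !dunklZ -!scalerA -!scalerDr !scalerBr => /eqP.
rewrite subr_eq addrAC eq_sym subr_eq eq_sym => /eqP sym.
by congr (_ *: _); rewrite [LHS]addrC sym addrC.
Qed.

End DunklOperators.

(** * The Dunkl representation of the Cherednik algebra *)

Section ReflectionData.
Variables (C : numClosedFieldType) (V : vectType C) (W : finGroupType).
Variable rho : W -> 'End(V).
Hypothesis rhoP : linear_group rho.
Local Notation Refl := (reflections rho).
Local Notation fix_ s := (fixedSpace (rho s)).

Lemma rho_ker w : lker (rho w) = 0%VS.
Proof.
by apply/eqP/lker0P => u v e; rewrite -[u](rhoK rhoP w) e (rhoK rhoP).
Qed.

Lemma fixed_neq_full s : s != 1%g -> (fix_ s == fullv) = false.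
Proof.
move=> s1; apply: contraNF s1 => /eqP e.
apply/eqP/(linear_group_inj rhoP)/lfunP => v; rewrite (rho1 rhoP).
by apply/fixedSpaceP; rewrite e memvf.
Qed.

Lemma hyperplane_sub (H H' : {vspace V}) :
  hyperplane H -> (H <= H')%VS -> H' != fullv -> H' = H.
Proof.
move=> /eqP hH sub ne; apply/esym/eqP; rewrite eqEdim sub -ltnS hH ltnNge.
by apply: contra ne => le; rewrite eqEdim subvf le.
Qed.

Lemma reflectionsP s : reflect (s != 1%g /\ hyperplane (fix_ s)) (s \in Refl).
Proof.
rewrite inE; apply: (iffP (asboolP _)) => [[_ s1 [H hH Hs]]|[s1 hH]].
  have s1' : s != 1%g by apply/eqP => e; apply: s1; rewrite e (linear_group1 rhoP).
  have sub : (H <= fix_ s)%VS by apply/fixedSpacesP.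
  by split=> //; rewrite (hyperplane_sub hH sub) ?fixed_neq_full.
split; [exact: rho_ker | | by exists (fix_ s) => // v /fixedSpaceP].
by move=> e; move: (fixed_neq_full s1); rewrite e fixedSpace_id eqxx.
Qed.

Lemma fixed_conj s w : fix_ (w * s * w^-1)%g = (rho w @: fix_ s)%VS.
Proof.
apply/vspaceP => v; apply/fixedSpaceP/memv_imgP => [e|[u /fixedSpaceP us ->]].
  exists (rho w^-1%g v); last by rewrite (rhoKV rhoP).
  by apply/fixedSpaceP; rewrite -{2}e -!(rhoM rhoP) !mulgA mulVg mul1g.
by rewrite !(rhoM rhoP) (rhoK rhoP) us.
Qed.

Lemma dim_rho w (U : {vspace V}) : \dim (rho w @: U) = \dim U.
Proof. by apply: limg_dim_eq; rewrite rho_ker capv0. Qed.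

Lemma reflections_conj s w : s \in Refl -> (w * s * w^-1)%g \in Refl.
Proof.
move=> /reflectionsP[s1 hs]; apply/reflectionsP; split; last first.
  by rewrite /hyperplane fixed_conj dim_rho.
by apply: contra s1 => /eqP/(congr1 (fun t => w^-1 * t * w)%g)/eqP; rewrite mulg1 !mulgA mulVg mul1g mulgKV.
Qed.

Lemma mem_hyperplanes s : s \in Refl -> fix_ s \in reflection_hyperplanes rho.
Proof. by move=> sR; rewrite mem_undup; apply/map_f; rewrite mem_enum. Qed.

Lemma hyperplanesP H : H \in reflection_hyperplanes rho ->
  exists2 s, s \in Refl & H = fix_ s.
Proof. by rewrite mem_undup => /mapP[s]; rewrite mem_enum => sR ->; exists s. Qed.

(** The fixed space of a nontrivial element of W_H contains the hyperplane H and is proper, so it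
    equals H. *)
Lemma stabilizer_reflection H s : H \in reflection_hyperplanes rho ->
  (s \in pointwise_stabilizer rho H) && (s != 1%g) = (s \in Refl) && (fix_ s == H).
Proof.
move=> /hyperplanesP[t /reflectionsP[t1 ht] ->]; rewrite inE; apply/andP/andP.
  move=> [sub s1]; have e := hyperplane_sub ht sub (negbT (fixed_neq_full s1)).
  by split; [apply/reflectionsP; rewrite e | rewrite e].
by move=> [/reflectionsP[s1 hs] /eqP->].
Qed.

Lemma stabilizer_conj H w : pointwise_stabilizer rho (rho w @: H)%VS =
  [set (w * s * w^-1)%g | s in pointwise_stabilizer rho H].
Proof.
apply/setP => s; apply/idP/imsetP => [|[t tH ->]]; rewrite !inE.
  move=> sub; exists (w^-1 * s * w)%g; last by rewrite !mulgA mulgV mul1g mulgK.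
  rewrite inE -{2}[w]invgK fixed_conj; apply/subvP => v vH.
  have /(subvP sub)/fixedSpaceP e : rho w v \in (rho w @: H)%VS by apply: memv_img.
  by apply/memv_imgP; exists (rho w v); rewrite ?(rhoK rhoP) //; apply/fixedSpaceP.
by rewrite fixed_conj; apply: limgS; move: tH; rewrite inE.
Qed.

Lemma card_stabilizer_conj H w :
  #|pointwise_stabilizer rho (rho w @: H)%VS| = #|pointwise_stabilizer rho H|.
Proof. by rewrite stabilizer_conj card_imset // => s t /mulIg/mulgI. Qed.

Lemma lfun_detM (f g : 'End(V)) : lfun_det (f \o g)%VF = lfun_det g * lfun_det f.
Proof. by rewrite /lfun_det (passmx.mxof_comp _ _ (vbasisP _)) det_mulmx. Qed.

Lemma lfun_det_conj s w : lfun_det (rho (w * s * w^-1)%g) = lfun_det (rho s).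
Proof.
rewrite !(linear_groupM rhoP) !lfun_detM mulrCA -lfun_detM -(linear_groupM rhoP).
rewrite mulgV (linear_group1 rhoP).
by rewrite [X in _ * X]/lfun_det passmx.mxof1 ?(basis_free (vbasisP _)) // det1 mulr1.
Qed.

Variables (form : V -> V -> C) (alpha : {vspace V} -> 'Hom(V, C^o)).
Variables (vH : {vspace V} -> V) (k : {vspace V} -> nat -> nat).
Hypothesis formP : invariant_hermitian_form rho form.
Hypothesis alphaP : forall H, H \in reflection_hyperplanes rho ->
  lker (alpha H) = H /\ forall u, alpha H u = form (vH H) u.
Hypothesis kP : forall H w i, H \in reflection_hyperplanes rho ->
  (i < #|pointwise_stabilizer rho H|)%N -> k (rho w @: H)%VS i = k H i.

Definition refl_root s : V := vH (fix_ s).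
Definition refl_coroot s : 'Hom(V, C^o) := alpha (fix_ s).
Definition refl_eigenvalue s : C :=
  refl_coroot s (rho s (refl_root s)) / refl_coroot s (refl_root s).
Local Notation lambda := refl_eigenvalue.

Lemma lformZ (x : 'Hom(V, C^o)) a v : x (a *: v) = (a * x v : C).
Proof. exact: linearZ. Qed.

Lemma form_posdef u : form u u = 0 -> u = 0.
Proof.
move=> u0; apply/eqP; apply: contraT => /(hermitian_posdef formP).
by rewrite u0 ltxx.
Qed.

Lemma coroot_root_neq0 s : s \in Refl -> refl_coroot s (refl_root s) != 0.
Proof.
move=> sR; have [ker eva] := alphaP (mem_hyperplanes sR).
have [s1 hs] := reflectionsP _ sR.
apply/eqP => e; have v0 : vH (fix_ s) = 0.
  by apply: form_posdef; rewrite -eva.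
have : fix_ s = fullv.
  rewrite -ker; apply/vspaceP => u; rewrite memvf memv_ker eva v0.
  have := hermitian_linearr formP 0 0 u u; rewrite scale0r add0r.
  have := hermitian_antilinearl formP (-1) 0 0 u.
  by rewrite scaler0 addr0 rmorphN rmorph1 mulN1r addNr => ->; rewrite eqxx.
by move/eqP; rewrite fixed_neq_full.
Qed.

(** Let z be s v - lambda v. It lies in the hyperplane, so it is fixed by s and orthogonal to v; by
    invariance (s v, z) = (s v, s z) = (v, z) = 0. Thus (z, z) = 0. *)
Lemma refl_root_eigen s : s \in Refl ->
  rho s (refl_root s) = lambda s *: refl_root s.
Proof.
move=> sR; have [ker eva] := alphaP (mem_hyperplanes sR).
have a0 := coroot_root_neq0 sR; rewrite /refl_eigenvalue.
set v := refl_root s; set m := _ / _; set z := rho s v - m *: v.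
have z0 : refl_coroot s z = 0.
  by rewrite /z linearB /= lformZ mulfVK ?subrr.
apply/eqP; rewrite -subr_eq0 -/z; apply/eqP/form_posdef.
have fz : rho s z = z.
  by apply/fixedSpaceP; rewrite -ker memv_ker; apply/eqP.
have vz : form v z = 0 by rewrite -z0 /refl_coroot eva.
have -> : form z z = form (- m *: v + rho s v) z by rewrite /z scaleNr addrC.
rewrite (hermitian_antilinearl formP) vz mulr0 add0r -{1}fz.
by rewrite (hermitian_inv formP).
Qed.

(** Split xi into a multiple of the root and a vector of the hyperplane, which s fixes. *)
Lemma refl_sub1 s xi : s \in Refl -> rho s xi - xi =
  ((lambda s - 1) * (refl_coroot s xi / refl_coroot s (refl_root s))) *: refl_root s.
Proof.
move=> sR; have [ker eva] := alphaP (mem_hyperplanes sR).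
have a0 := coroot_root_neq0 sR.
set m := _ / _; set v := refl_root s.
have /fixedSpaceP e : xi - m *: v \in fix_ s.
  by rewrite -ker memv_ker linearB /= lformZ mulfVK ?subrr.
have -> : rho s xi = xi - m *: v + m *: (lambda s *: v).
  by rewrite -e -refl_root_eigen // -linearZ -linearD subrK.
by rewrite mulrBl mul1r scalerBl scalerA [m * _]mulrC addrAC [xi - _]addrC addrK addrC.
Qed.

Lemma refl_eigenvalue_neq1 s : s \in Refl -> lambda s - 1 != 0.
Proof.
move=> sR; have [s1 _] := reflectionsP _ sR; apply: contraNneq s1 => l1.
apply/eqP/(linear_group_inj rhoP)/lfunP => v; rewrite (rho1 rhoP); apply/eqP.
by rewrite -subr_eq0 refl_sub1 // l1 mul0r scale0r.
Qed.

Lemma refl_rank1 s : s \in Refl ->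
  exists (a : 'Hom(V, C^o)) (v : V), forall xi, rho s xi - xi = (a xi : C) *: v.
Proof.
move=> sR; exists (((lambda s - 1) / refl_coroot s (refl_root s)) *: refl_coroot s).
by exists (refl_root s) => xi; rewrite refl_sub1 // scale_lfunE mulrA mulrAC.
Qed.

Lemma refl_eigenvalueE s xi : s \in Refl ->
  rho s (rho s xi - xi) = lambda s *: (rho s xi - xi).
Proof.
by move=> sR; rewrite refl_sub1 // linearZ /= refl_root_eigen // !scalerA mulrC.
Qed.

(* The coefficient of w in the inner sum of the commutator [xi, x]. *)
Definition stab_coef H (w : W) : C :=
  \sum_(i < #|pointwise_stabilizer rho H|)
    ((k H i)%:R - (k H (i.+1 %% #|pointwise_stabilizer rho H|)%N)%:R)
    * lfun_det (rho w) ^- i.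

(** The division by lambda s - 1 cancels that factor in s xi - xi, so that the Dunkl commutator has
    the coefficient prescribed by the defining relation. *)
Definition refl_coef s : C := stab_coef (fix_ s) s / (lambda s - 1).

Lemma refl_coef_conj s w : s \in Refl -> refl_coef (w * s * w^-1)%g = refl_coef s.
Proof.
move=> sR; rewrite /refl_coef; congr (_ / (_ - 1)); last first.
  apply: (lambda_conj rhoP reflections_conj) => //.
  - by move=> t /reflectionsP[].
  - by move=> t xi; apply: refl_eigenvalueE.
rewrite /stab_coef fixed_conj card_stabilizer_conj lfun_det_conj.
apply: eq_bigr => i _; rewrite !kP ?mem_hyperplanes //.
by rewrite ltn_mod; apply: leq_ltn_trans (ltn_ord i).
Qed.

(** The differences of the k_{H,i} telescope around the cycle of indices. *)
Lemma stab_coef1 H : stab_coef H 1%g = 0.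
Proof.
rewrite /stab_coef (linear_group1 rhoP) /lfun_det.
rewrite passmx.mxof1 ?(basis_free (vbasisP _)) // det1.
set m := #|_|; under eq_bigr => i _ do rewrite expr1n invr1 mulr1.
rewrite big_split sumrN /=; apply/eqP; rewrite subr_eq0; apply/eqP/esym.
case: m => [|m]; first by rewrite !big_ord0.
by rewrite [RHS](reindex_inj (@ordS_inj m.+1)).
Qed.

(** A reflection lies in W_H for exactly one hyperplane H, its fixed space, and the identity
    contributes nothing. *)
Lemma big_stabilizers (M : zmodType) (F : {vspace V} -> W -> M) :
  (forall H, F H 1%g = 0) ->
  \sum_(H <- reflection_hyperplanes rho) \sum_(w in pointwise_stabilizer rho H) F H w
  = \sum_(s in Refl) F (fix_ s) s.
Proof.
move=> F1; have uH := undup_uniq [seq fix_ w | w <- enum Refl].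
transitivity (\sum_(H <- reflection_hyperplanes rho)
    \sum_(s in Refl) if fix_ s == H then F H s else 0).
  apply: eq_big_seq => H Hh; rewrite -big_mkcondr /=.
  rewrite (bigID (pred1 1%g)) /= [X in X + _]big1 ?add0r; last by move=> w /andP[_ /eqP->].
  by apply: eq_bigl => s; apply: stabilizer_reflection.
rewrite exchange_big; apply: eq_bigr => s sR.
rewrite (bigD1_seq (fix_ s)) ?mem_hyperplanes //= eqxx big1 ?addr0 // => H.
by rewrite eq_sym => /negPf->.
Qed.

Local Notation n := (\dim {:V}).
Local Notation S := {mpoly C[n]}.
Local Notation act w := (lsub (group_matrix rho w)).

Definition dunkl_endo (xi : V) : endo C n :=
  Endo (dunkl_linear rhoP refl_coef (fun s sR => (reflectionsP s sR).1)
          refl_rank1 refl_eigenvalueE xi).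

Fact act_endo_linear w : linear (act w : S -> S).
Proof. exact: linearP. Qed.

Definition act_endo w : endo C n := Endo (act_endo_linear w).

Definition cherednik_gen (g : ('Hom(V, C^o) + V + W)%type) : endo C n :=
  match g with
  | inl (inl x) => mult_endo (coordinate_form x)
  | inl (inr xi) => dunkl_endo xi
  | inr w => act_endo w
  end.

Local Notation eval := (free_eval cherednik_gen).

Lemma eval_idempotent H i p : eval (stab_idempotent rho H i) p =
  (#|pointwise_stabilizer rho H|%:R^-1) *:
  \sum_(w in pointwise_stabilizer rho H) lfun_det (rho w) ^- i *: act w p.
Proof.
rewrite free_evalZ endoM /= free_eval_sum endo_sum; congr (_ *: _).
apply: eq_bigr => w _; rewrite free_evalZ endoM; congr (_ *: _).
by rewrite (free_eval_gen cherednik_gen (inr w)).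
Qed.

(** The sum over hyperplanes and idempotents, rewritten over reflections: n_H cancels the
    denominator of each idempotent, and [refl_sub1] turns the pairings into x(s xi - xi). *)
Lemma eval_bracket xi (x : 'Hom(V, C^o)) p : eval (cherednik_bracket rho alpha vH k xi x) p =
  (x xi : C) *: p
  + \sum_(s in Refl) (refl_coef s * x (rho s xi - xi)) *: act s p.
Proof.
rewrite free_evalD free_evalC endoD; congr (_ + _).
rewrite free_eval_sum endo_sum.
transitivity (\sum_(H <- reflection_hyperplanes rho)
  \sum_(w in pointwise_stabilizer rho H)
    ((alpha H xi * x (vH H) / alpha H (vH H)) * stab_coef H w) *: act w p).
  apply: eq_big_seq => H Hh; rewrite free_evalZ endoM free_eval_sum endo_sum.
  have [s sR Hs] := hyperplanesP Hh.
  have n0 : #|pointwise_stabilizer rho H|%:R != 0 :> C.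
    rewrite pnatr_eq0 -lt0n; apply/card_gt0P; exists 1%g.
    by rewrite inE (linear_group1 rhoP) fixedSpace_id subvf.
  under eq_bigr => i _.
    rewrite free_evalZ endoM eval_idempotent /= scalerA mulrAC mulfV // mul1r scaler_sumr.
    under eq_bigr => w _ do rewrite scalerA.
    over.
  rewrite exchange_big /= scaler_sumr; apply: eq_bigr => w _.
  by rewrite -scalerA -scaler_suml.
rewrite (big_stabilizers (F := fun H w =>
  ((alpha H xi * x (vH H) / alpha H (vH H)) * stab_coef H w) *: act w p)); last first.
  by move=> H; rewrite stab_coef1 mulr0 scale0r.
apply: eq_bigr => s sR; congr (_ *: _); rewrite refl_sub1 // lformZ /refl_coef.
rewrite -/(refl_root s) -/(refl_coroot s) mulrA mulrA mulrVK //; first last.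
  by rewrite unitfE refl_eigenvalue_neq1.
by rewrite [LHS]mulrC -[RHS]mulrA [_ / _]mulrAC.
Qed.

(** The Dunkl representation. The substantial relations are the commutation of the Dunkl operators
    and their bracket with linear forms. *)
Lemma cherednik_relP u v :
  cherednik_rel rho alpha vH k u v -> eval u = eval v.
Proof.
case=> [a x x'|a xi xi'||w w'|x x'|xi xi'|w x|w xi|xi x].
- refine (free_eval_lin (g := cherednik_gen) (c := inl (inl _)) (a := inl (inl x)) (b := inl (inl x')) _).
  apply: endoP => p /=.
  by rewrite (linearP (@coordinate_form C V)) mulrDl scalerAl.
- refine (free_eval_lin (g := cherednik_gen) (c := inl (inr _)) (a := inl (inr xi)) (b := inl (inr xi')) _).
  by apply: endoP => p /=; exact: dunklDl.
- refine (free_eval_gen1 (g := cherednik_gen) (a := inr 1%g) _).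
  by apply: endoP => p /=; rewrite (group_matrix1 rhoP) lsub1.
- refine (free_eval_genM (g := cherednik_gen) (a := inr w) (b := inr w') (c := inr (w * w')%g) _).
  by apply: endoP => p /=; exact: (group_actM rhoP).
- refine (free_eval_comm_gen (g := cherednik_gen) (a := inl (inl x)) (b := inl (inl x')) _).
  by apply: endoP => p /=; rewrite mulrCA.
- refine (free_eval_comm_gen (g := cherednik_gen) (a := inl (inr xi)) (b := inl (inr xi')) _).
  apply: endoP => p /=; apply: (dunkl_commute rhoP reflections_conj).
  by move=> s w; apply: refl_coef_conj.
- refine (free_eval_genM3 (g := cherednik_gen) (a := inr w) (b := inl (inl x)) (c := inr w^-1%g)
    (d := inl (inl _)) _).
  apply: endoP => p /=.
  rewrite rmorphM /= (group_actM rhoP) mulgV (group_matrix1 rhoP) lsub1.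
  by rewrite act_form.
- refine (free_eval_genM3 (g := cherednik_gen) (a := inr w) (b := inl (inr xi)) (c := inr w^-1%g)
    (d := inl (inr (rho w xi))) _).
  apply: endoP => p /=.
  rewrite (act_dunkl rhoP reflections_conj); last first.
    by move=> s t; apply: refl_coef_conj.
  by rewrite (group_actM rhoP) mulgV (group_matrix1 rhoP) lsub1.
- refine (free_eval_commutator (g := cherednik_gen) (a := inl (inr xi)) (b := inl (inl x)) _).
  apply: endoP => p; rewrite eval_bracket /=.
  by rewrite dunkl_form [LHS]addrC -!addrA addKr.
Qed.

End ReflectionData.

(** * The spherical subalgebra inside the Weyl algebra *)

Section SphericalAction.
Variables (C : numFieldType) (n : nat) (W : finGroupType) (M : W -> 'M[C]_n).
Hypothesis M1 : M 1%g = 1%:M.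
Hypothesis MM : forall g h, M (g * h)%g = M h *m M g.
Local Notation S := {mpoly C[n]}.
Local Notation act w := (lsub (M w)).
Variable f : 'I_n -> S.
Local Notation phi := (comp_mpoly [tuple f i | i < n] : {lrmorphism S -> S}).
Hypothesis f_inv : forall i, invariant M (f i).
Hypothesis phi_surj : forall p, invariant M p -> exists q, p = phi q.
Hypothesis phi_inj : injective phi.
Local Notation J := (\matrix_(j < n, i < n) (f i)^`M(j)).
Hypothesis J_neq0 : \det J != 0.

Variables (H : pzAlgType C) (X Y : {rmorphism S -> H}) (T : W -> H) (e : H).
Hypothesis XC : forall a, X a%:MP = scalar_of a.
Hypothesis YC : forall a, Y a%:MP = scalar_of a.
Hypothesis Te : forall w, T w * e = e.
Hypothesis ee : e * e = e.
Hypothesis TX : forall w p, T w * X p = X (act w p) * T w.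
Hypothesis TY : forall w q, exists q', T w * Y q = Y q' * T w.
Hypothesis YX : forall i p, exists g : W -> S,
  Y 'X_i * X p = X p * Y 'X_i + \sum_w X (g w) * T w.
Hypothesis gen_ind : forall (P : H -> Prop) z, P z ->
  (forall x y, P x -> P y -> P (x + y)) ->
  (forall a x, P x -> P (scalar_of a * x)) ->
  (forall p x, P x -> P (X p * x)) ->
  (forall i x, P x -> P (Y 'X_i * x)) ->
  (forall w x, P x -> P (T w * x)) -> forall x, P (x * z).

Variable F : {rmorphism H -> endo C n}.
Variable tau : 'I_n -> {additive S -> S}.
Hypothesis F_X : forall p q, F (X p) q = p * q.
Hypothesis F_Y : forall i q, F (Y 'X_i) q = tau i q.
Hypothesis F_e : forall q, F e q = average M q.
Hypothesis tau1 : forall i, tau i 1 = 0.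
Hypothesis tauM : forall i g p, invariant M g -> tau i (g * p) = g * tau i p + g^`M(i) * p.

Local Notation nf := (normal_form X Y e).

Lemma phi_invariant q : invariant M (phi q).
Proof.
move=> w; elim/mpoly_ring_ind: q => [c|p q ep eq|i p ep].
- by rewrite /= comp_mpolyC lsubC.
- by rewrite !raddfD /= ep eq.
- by rewrite !rmorphM /= ep comp_mpolyXU -tnth_nth tnth_mktuple f_inv.
Qed.

Lemma nf_product p q : exists G, X p * Y q * e = nf G.
Proof.
elim/mpolyind: q => [|c m q _ _ [G eG]].
  by exists 0; rewrite raddf0 mulr0 mul0r normal_form0.
exists ((p * c%:MP) *: 'X_[m] + G); rewrite normal_formD normal_formZX -eG.
rewrite raddfD /= mulrDr mulrDl; congr (_ + _).
by rewrite -mul_mpolyC !rmorphM /= YC XC mulrA.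
Qed.

Lemma nf_sum I (r : seq I) (G : I -> {mpoly S[n]}) :
  nf (\sum_(i <- r) G i) = \sum_(i <- r) nf (G i).
Proof. exact: (big_morph nf (normal_formD X Y e) (normal_form0 X Y e)). Qed.

(** Reordering moves the X's to the left and the group elements to the right, where e absorbs
    them. *)
Lemma nf_span x : exists G, x * e = nf G.
Proof.
move: x; apply: (gen_ind (P := fun x => exists G, x = nf G) (z := e))
  => [|x y [G ->] [G' ->]|a x [G ->]|p x [G ->]|i x [G ->]|w x [G ->]].
- have [G eG] := nf_product 1 1; exists G.
  by rewrite -eG !rmorph1 !mul1r.
- by exists (G + G'); rewrite normal_formD.
- by exists (a%:MP *: G); rewrite -(normal_form_scalar Y XC).
- by exists (p *: G); rewrite normal_form_mulX.
- elim/mpolyind: G => [|p m G _ _ [G' eG']].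
    by exists 0; rewrite !normal_form0 mulr0.
  (* The commutator of Y_i with X(p) leaves terms X(g) T_w, and T_w is then pushed past the
     remaining Y's into e. *)
  have [g eg] := YX i p.
  have [G1 eG1] := nf_product p ('X_i * 'X_[m]).
  have h w : exists G2, X (g w) * T w * Y 'X_[m] * e = nf G2.
    have [q eq] := TY w 'X_[m]; have [G2 eG2] := nf_product (g w) q; exists G2.
    by rewrite -eG2 -[_ * T w * _]mulrA eq -!mulrA Te.
  exists (G1 + \sum_w sval (cid (h w)) + G').
  rewrite !normal_formD mulrDr eG' -eG1; congr (_ + _).
  rewrite normal_formZX !mulrA eg rmorphM !mulrDl !mulrA; congr (_ + _).
  rewrite nf_sum !mulr_suml; apply: eq_bigr => w _.
  exact: (svalP (cid (h w))).
- elim/mpolyind: G => [|p m G _ _ [G' eG']].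
    by exists 0; rewrite !normal_form0 mulr0.
  have [q eq] := TY w 'X_[m]; have [G2 eG2] := nf_product (act w p) q.
  exists (G2 + G'); rewrite !normal_formD mulrDr eG' -eG2; congr (_ + _).
  by rewrite normal_formZX !mulrA TX -[_ * T w * _]mulrA eq -!mulrA Te.
Qed.

Definition word_op b p := F (Y 'X_[b]) p.

Lemma word_op0 p : word_op 0%MM p = p.
Proof. by rewrite /word_op mpolyX0 !rmorph1. Qed.

Lemma word_opS j b p : word_op (U_(j) + b)%MM p = tau j (word_op b p).
Proof. by rewrite /word_op mpolyXD !rmorphM /= F_Y. Qed.

Lemma action_e_phi q : F e (phi q) = phi q.
Proof. by rewrite F_e average_id //; apply: phi_invariant. Qed.

Lemma action_nf G q : F (nf G) (phi q) = opfold word_op G (phi q).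
Proof.
rewrite /normal_form /mfold /opfold (raddf_sum F) /= endo_sum; apply: eq_bigr => b _.
by rewrite /monomial_map !rmorphM /= F_X action_e_phi.
Qed.

Lemma tau_product_rule j g q : tau j (g * phi q) = tau j g * phi q + g * \sum_i J j i * phi q^`M(i).
Proof.
rewrite [g * _]mulrC tauM; last exact: phi_invariant.
rewrite [LHS]addrC addrC [phi q * _]mulrC; congr (_ + _).
rewrite mulrC; congr (_ * _).
rewrite mderiv_comp; apply: eq_bigr => i _.
by rewrite mxE tnth_mktuple mulrC.
Qed.

(** On invariants phi(q) the action of x is a differential operator in q. A nonzero normal form
    keeps a nonzero symbol because the Jacobian is nonsingular. *)
Lemma action_diffop x G : x * e = nf G ->
  exists G', (forall q, F x (phi q) = diffop phi G' q) /\ (G != 0 -> G' != 0).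
Proof.
move=> xe.
have Fx q : F x (phi q) = opfold word_op G (diffop phi 1 q).
  by rewrite diffop1 -action_nf -xe rmorphM /= action_e_phi.
(* The starting symbol is 1, whose operator is [phi] itself. The bound r is generous, since only the
   existence of G' is taken from here. *)
have [||G' [hG' _]] := diffop_opfold tau_product_rule word_op0 word_opS (F := G) (G := 1)
  (r := msize G) (s := 0); [exact: leqnSn | by rewrite -mpolyC1 msizeC; case: eqP|].
exists G'; split=> [q|G0]; first by rewrite Fx hG'.
exact: (diffop_opfold_neq0 tau_product_rule word_op0 word_opS J_neq0 G0 (oner_neq0 _) hG').
Qed.

Variables (A : pzAlgType C) (wX : {rmorphism S -> A}) (d_ : 'I_n -> A).
Variable wact : {rmorphism A -> endo C n}.
Hypothesis wact_scalar : forall a q, wact (scalar_of a) q = a *: q.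
Hypothesis wact_X : forall p q, wact (wX p) q = p * q.
Hypothesis wact_d : forall i q, wact (d_ i) q = q^`M(i).
Hypothesis wact_nf : forall G, exists P, forall q, wact P q = diffop (idS C n) G q.
Hypothesis wact_faithful : forall P, (forall q, wact P q = 0) -> P = 0.
Hypothesis wdX : forall i p, d_ i * wX p = wX p * d_ i + wX p^`M(i).
Hypothesis weyl_indl : forall (P : A -> Prop), P 1 ->
  (forall x y, P x -> P y -> P (x + y)) ->
  (forall a x, P x -> P (scalar_of a * x)) ->
  (forall i x, P x -> P (wX 'X_i * x)) ->
  (forall i x, P x -> P (d_ i * x)) -> forall x, P x.
Hypothesis weyl_indr : forall (P : A -> Prop), P 1 ->
  (forall x y, P x -> P y -> P (x + y)) ->
  (forall a x, P x -> P (scalar_of a * x)) ->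
  (forall i x, P x -> P (x * wX 'X_i)) ->
  (forall i x, P x -> P (x * d_ i)) -> forall x, P x.

Lemma average_diffop G q :
  average M (diffop phi G q) = diffop phi (map_mpoly (average M) G) q.
Proof.
elim/mpolyind: G => [|c m G _ _ IHG].
  by rewrite (raddf0 (map_mpoly _)) !diffop0 raddf0.
rewrite (raddfD (map_mpoly _)) /= !diffopD (raddfD (average M)) /= IHG; congr (_ + _).
have -> : map_mpoly (average M) (c *: 'X_[m]) = average M c *: 'X_[m].
  apply/mpolyP => l; rewrite mcoeff_map_mpoly !mcoeffZ !mcoeffX.
  by case: eqP => _; rewrite ?mulr1 // !mulr0 raddf0.
rewrite !diffopZX [c * _]mulrC averageM 1?mulrC //.
exact: phi_invariant.
Qed.

(** Averaging does not change u, so by uniqueness of symbols its coefficients are invariant. Each is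
    therefore a polynomial in the f_i, and the operator comes from the Weyl algebra. *)
Lemma spherical_weyl u : e * u = u -> exists P, forall q, F u (phi q) = phi (wact P q).
Proof.
move=> eu; have [G uG] := nf_span u; have [G' [hG' _]] := action_diffop uG.
have aG : map_mpoly (average M) G' = G'.
  apply/eqP; rewrite -subr_eq0; apply/eqP/(diffop_inj (phi := phi)) => q.
  by rewrite diffopB -average_diffop -hG' -F_e -endoM -rmorphM eu subrr.
have inv I : invariant M G'@_I by rewrite -aG mcoeff_map_mpoly; apply: average_inv.
pose g I := sval (cid (phi_surj (inv I))).
have gE I : phi (g I) = G'@_I by rewrite -(svalP (cid (phi_surj (inv I)))).
have [P hP] := wact_nf (\sum_(I <- msupp G') g I *: 'X_[I]).
exists P => q; rewrite hG' hP {1}[G']mpolyE !diffop_sum raddf_sum.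
by apply: eq_bigr => I _; rewrite !diffopZX /= rmorphM /= gE.
Qed.

Local Notation U := (corner ee).

Definition spherical_embed (u : U) : A := sval (cid (spherical_weyl (corner_valE u).1)).

Lemma spherical_embedE u q : F (val u) (phi q) = phi (wact (spherical_embed u) q).
Proof. exact: (svalP (cid (spherical_weyl (corner_valE u).1))). Qed.

Lemma wact_inj P Q : (forall q, phi (wact P q) = phi (wact Q q)) -> P = Q.
Proof.
move=> h; apply/eqP; rewrite -subr_eq0; apply/eqP/wact_faithful => q.
by rewrite (raddfB wact) endoD endoN; apply/eqP; rewrite subr_eq0; apply/eqP/phi_inj.
Qed.

Fact spherical_embed_zmod : {morph spherical_embed : u v / u - v}.
Proof.
move=> u v; apply: wact_inj => q.
rewrite -spherical_embedE corner_valB !(raddfB wact) (raddfB F) !endoD !endoN !spherical_embedE.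
by rewrite -(raddfB phi).
Qed.

Fact spherical_embed_monoid : spherical_embed 1 = 1 /\ {morph spherical_embed : u v / u * v}.
Proof.
split=> [|u v]; apply: wact_inj => q.
  by rewrite -spherical_embedE corner_oneE action_e_phi rmorph1.
by rewrite -spherical_embedE corner_mulE !rmorphM !endoM !spherical_embedE.
Qed.

HB.instance Definition _ := GRing.isZmodMorphism.Build U A spherical_embed spherical_embed_zmod.
HB.instance Definition _ := GRing.isMonoidMorphism.Build U A spherical_embed spherical_embed_monoid.

Lemma spherical_embed_scalar a : spherical_embed (scalar_of a) = scalar_of a.
Proof.
apply: wact_inj => q; rewrite -spherical_embedE corner_scalarE -XC rmorphM endoM F_X action_e_phi.
by rewrite wact_scalar mul_mpolyC -linearZ.
Qed.

(** If u acts as zero then so does its symbol, which forces the normal form of u e = u to vanish. *)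
Lemma spherical_embed_inj : injective spherical_embed.
Proof.
move=> u v /eqP; rewrite -subr_eq0 -raddfB => /eqP w0; apply/eqP; rewrite -subr_eq0.
move: (u - v) w0 => {v}u u0; apply/eqP/val_inj => /=.
have [G uG] := nf_span (val u); have [G' [hG' G0]] := action_diffop uG.
have G'0 : G' = 0.
  by apply: (diffop_inj (phi := phi)) => q; rewrite -hG' spherical_embedE u0 (raddf0 wact) raddf0.
rewrite -(corner_valE u).2 uG; have [->|/G0] := eqVneq G 0; last by rewrite G'0 eqxx.
by rewrite normal_form0.
Qed.

Definition realized P := exists u, spherical_embed u = P.

(** The witness is e x e; its left factor e acts by averaging and its right factor fixes phi(q). *)
Lemma realizedI x P : (forall q, F e (F x (phi q)) = phi (wact P q)) -> realized P.
Proof.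
move=> h; exists (corner_of ee x); apply: wact_inj => q.
by rewrite -spherical_embedE /= !rmorphM !endoM action_e_phi h.
Qed.

Lemma realizedD P Q : realized P -> realized Q -> realized (P + Q).
Proof. by move=> [u <-] [v <-]; exists (u + v); rewrite raddfD. Qed.

Lemma realizedB P Q : realized P -> realized Q -> realized (P - Q).
Proof. by move=> [u <-] [v <-]; exists (u - v); rewrite raddfB. Qed.

Lemma realizedM P Q : realized P -> realized Q -> realized (P * Q).
Proof. by move=> [u <-] [v <-]; exists (u * v); rewrite rmorphM. Qed.

Lemma realized_scalar a : realized (scalar_of a).
Proof. by exists (scalar_of a); rewrite spherical_embed_scalar. Qed.

Lemma realized_X p : realized (wX p).
Proof.
apply: (@realizedI (X (phi p))) => q; rewrite F_X F_e wact_X rmorphM.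
by rewrite average_id // -rmorphM; apply: phi_invariant.
Qed.

(* The adjugate of J expresses \det J times the derivatives in the invariants as *)
(* combinations of the tau_j; the norm makes the factor \det J invariant.       *)
Lemma realized_d : exists2 D, D != 0 & forall i, realized (wX D * d_ i).
Proof.
pose N := \prod_w act w (\det J).
have N0 : N != 0 by apply: norm_neq0.
have [D ND] : exists D, N = phi D by apply: phi_surj; apply: norm_inv.
have [N' NJ] : exists N', N = N' * \det J.
  exists (\prod_(w | w != 1%g) act w (\det J)).
  by rewrite /N (bigD1 1%g) //= M1 lsub1 mulrC.
exists D => [|i]; first by apply: contra_neq N0 => D0; rewrite ND D0 raddf0.
apply: (@realizedI (\sum_j X (N' * \adj J i j) * Y 'X_j)) => q.
have -> : F (\sum_j X (N' * \adj J i j) * Y 'X_j) (phi q) = N * phi q^`M(i).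
  rewrite (raddf_sum F) /= endo_sum.
  transitivity (\sum_l N' * (\adj J *m J) i l * phi q^`M(l)).
    under eq_bigr => j _.
      rewrite rmorphM endoM F_X F_Y -[phi q]mul1r tau_product_rule tau1 mul0r add0r.
      rewrite mul1r mulr_sumr.
      over.
    rewrite exchange_big; apply: eq_bigr => l _; rewrite mxE mulr_sumr mulr_suml.
    by apply: eq_bigr => j _; rewrite !mulrA.
  rewrite mul_adj_mx (bigD1 i) //= big1 => [|l li]; last first.
    by rewrite mxE eq_sym (negPf li) mulr0n mulr0 mul0r.
  by rewrite mxE eqxx mulr1n -NJ addr0.
rewrite ND F_e -rmorphM average_id; last exact: phi_invariant.
by rewrite /= (rmorphM wact) endoM wact_X wact_d.
Qed.

(** Clearing denominators generator by generator, with D of [realized_d] as denominator for the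
    derivations. *)
Lemma realized_left P : exists2 p, p != 0 & realized (wX p * P).
Proof.
have [D D0 rD] := realized_d.
elim/weyl_indl: P => [|P Q [p p0 rp] [q q0 rq]|a P [p p0 rp]|i P [p p0 rp]|i P [p p0 rp]].
- by exists 1; rewrite ?oner_neq0 // rmorph1 mulr1; exists 1; rewrite rmorph1.
- exists (p * q); first exact: mulf_neq0.
  rewrite mulrDr; apply: realizedD; rewrite rmorphM.
    by rewrite -rmorphM mulrC rmorphM -mulrA; apply: realizedM => //; apply: realized_X.
  by rewrite -mulrA; apply: realizedM => //; apply: realized_X.
- exists p => //; rewrite mulrA -scalar_of_central -mulrA.
  by apply: realizedM => //; apply: realized_scalar.
- exists p => //; rewrite mulrA -rmorphM mulrC rmorphM -mulrA.
  by apply: realizedM => //; apply: realized_X.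
(* One factor p is needed next to P. Moving it across d_i costs a derivative of p, corrected by the
   subtracted term. *)
- exists (D * p * p); first by rewrite !mulf_neq0.
  have -> : wX (D * p * p) * (d_ i * P) =
      wX p * (wX D * d_ i) * (wX p * P) - wX (D * p^`M(i)) * (wX p * P).
    rewrite -!mulrA [d_ i * (wX p * P)]mulrA wdX mulrDl !mulrDr.
    rewrite !mulrA -!rmorphM -!mulrA.
    by rewrite [p * (D * p)]mulrCA [p * (D * _)]mulrCA [p^`M(i) * p]mulrC addrK.
  apply: realizedB; apply: realizedM => //; last exact: realized_X.
  by apply: realizedM => //; apply: realized_X.
Qed.

Lemma realized_right P : exists2 p, p != 0 & realized (P * wX p).
Proof.
have [D D0 rD] := realized_d.
elim/weyl_indr: P => [|P Q [p p0 rp] [q q0 rq]|a P [p p0 rp]|i P [p p0 rp]|i P [p p0 rp]].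
- by exists 1; rewrite ?oner_neq0 // rmorph1 mulr1; exists 1; rewrite rmorph1.
- exists (p * q); first exact: mulf_neq0.
  rewrite mulrDl; apply: realizedD.
    by rewrite rmorphM mulrA; apply: realizedM => //; apply: realized_X.
  by rewrite mulrC rmorphM mulrA; apply: realizedM => //; apply: realized_X.
- exists p => //; rewrite -mulrA.
  by apply: realizedM => //; apply: realized_scalar.
- exists p => //; rewrite -mulrA -rmorphM mulrC rmorphM mulrA.
  by apply: realizedM => //; apply: realized_X.
(* The double factor p keeps the derivative of p (p D) divisible by p, so that P p can be split off
   on the left. *)
- exists (p * (p * D)); first by rewrite !mulf_neq0.
  have -> : P * d_ i * wX (p * (p * D)) =
      P * wX p * (wX p * (wX D * d_ i) + wX (p^`M(i) * D + (p * D)^`M(i))).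
    rewrite -[LHS]mulrA -[RHS]mulrA; congr (P * _); rewrite wdX mulrDr; congr (_ + _).
      by rewrite !rmorphM !mulrA.
    by rewrite -rmorphM mderivM mulrDr mulrCA.
  apply: realizedM => //; apply: realizedD; last exact: realized_X.
  by apply: realizedM => //; apply: realized_X.
Qed.

Lemma wX_neq0 p : p != 0 -> wX p != 0.
Proof.
move=> p0; apply: contra_neq p0 => e0.
by have := wact_X p 1; rewrite e0 raddf0 endo0 mulr1.
Qed.

(** The polynomial multipliers lie in the image by [realized_X], so [realized_left] and
    [realized_right] give the multiples that [isomorphic_fractions_embed] asks for. *)
Lemma corner_fractions : ore_domain A -> isomorphic_fractions U A.
Proof.
move=> oreA; apply: (isomorphic_fractions_embed (h := spherical_embed : {rmorphism U -> A})) => //.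
- exact: spherical_embed_scalar.
- exact: spherical_embed_inj.
- move=> P; have [p p0 [u hu]] := realized_left P.
  have [v hv] := realized_X p.
  exists v; last by exists u; rewrite /= hu hv.
  by apply: contra_neq (wX_neq0 p0) => v0; rewrite -hv v0 raddf0.
- move=> P; have [p p0 [u hu]] := realized_right P.
  have [v hv] := realized_X p.
  exists v; last by exists u; rewrite /= hu hv.
  by apply: contra_neq (wX_neq0 p0) => v0; rewrite -hv v0 raddf0.
Qed.

End SphericalAction.

Section ConcreteWeyl.
Variables (C : numFieldType) (n : nat).
Local Notation S := {mpoly C[n]}.
Local Notation A := (weyl C n).
Local Notation wX := (weyl_X C n).
Local Notation wD := (weyl_D C n).
Local Notation wact := (weyl_act C n).

Lemma weyl_act_Xi i q : wact (wX 'X_i) q = 'X_i * q.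
Proof. by rewrite weyl_XX weyl_act_x. Qed.

Lemma weyl_act_Di i q : wact (wD 'X_i) q = q^`M(i).
Proof. by rewrite weyl_DX weyl_act_d. Qed.

Lemma weyl_ind_r (P : A -> Prop) : P 1 ->
  (forall x y, P x -> P y -> P (x + y)) ->
  (forall a x, P x -> P (scalar_of a * x)) ->
  (forall i x, P x -> P (x * wX 'X_i)) ->
  (forall i x, P x -> P (x * wD 'X_i)) -> forall x, P x.
Proof.
move=> P1 PD PZ PX PDi x; rewrite -[x]mul1r.
apply: (presented_ind_r P1 PD PZ) => -[i|i] y Py.
  by have := PX i y Py; rewrite weyl_XX.
by have := PDi i y Py; rewrite weyl_DX.
Qed.

Lemma weyl_ore_domain : ore_domain A.
Proof.
refine (weyl_ore (@weyl_XC C n) (@weyl_DC C n) (@weyl_relDX C n) (@weyl_ind C n) _ _ _).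
- by move=> F; refine (weyl_nf_inj (@weyl_XC C n) (@weyl_act_scalar C n) weyl_act_Xi weyl_act_Di (F := F)).
- exact: (weyl_one_neq0 wact).
- move=> P Q; exact: (weyl_integral (@weyl_XC C n) (@weyl_relDX C n) (@weyl_ind C n)
    (@weyl_act_scalar C n) weyl_act_Xi weyl_act_Di).
Qed.

End ConcreteWeyl.

(** * Polynomial subalgebras and reordering in the Cherednik algebra *)

Section CherednikGenerators.
Variables (C : numClosedFieldType) (V : vectType C) (W : finGroupType).
Variable rho : W -> 'End(V).
Hypothesis rhoP : linear_group rho.
Local Notation n := (\dim {:V}).
Local Notation S := {mpoly C[n]}.
Local Notation form := 'Hom(V, C^o).
Local Notation b := (vbasis {:V}).
Local Notation lin := coordinate_form.
Local Notation act w := (lsub (group_matrix rho w)).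

Variables (H : pzAlgType C) (Xg : form -> H) (Yg : V -> H) (T : W -> H).
Hypothesis XgL : forall a x x', Xg (a *: x + x') = scalar_of a * Xg x + Xg x'.
Hypothesis YgL : forall a x x', Yg (a *: x + x') = scalar_of a * Yg x + Yg x'.
Hypothesis XgC : forall x x', Xg x * Xg x' = Xg x' * Xg x.
Hypothesis YgC : forall x x', Yg x * Yg x' = Yg x' * Yg x.
Hypothesis T1 : T 1%g = 1.
Hypothesis TM : forall w w', T w * T w' = T (w * w')%g.
Hypothesis TXg : forall w x, T w * Xg x * T w^-1%g = Xg (x \o rho w^-1%g)%VF.
Hypothesis TYg : forall w x, T w * Yg x * T w^-1%g = Yg (rho w x).
Hypothesis YXg : forall xi x, exists c : W -> C,
  Yg xi * Xg x = Xg x * Yg xi + \sum_w scalar_of (c w) * T w.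
Hypothesis Hind : forall (P : H -> Prop) z, P z ->
  (forall x y, P x -> P y -> P (x + y)) ->
  (forall a x, P x -> P (scalar_of a * x)) ->
  (forall y x, P x -> P (Xg y * x)) ->
  (forall xi x, P x -> P (Yg xi * x)) ->
  (forall w x, P x -> P (T w * x)) -> forall x, P (x * z).
Variable e : H.
Hypothesis eE : e = scalar_of (#|W|%:R^-1) * \sum_w T w.
Variable ee : e * e = e.

Variable F : {rmorphism H -> endo C n}.
Hypothesis F_scalar : forall a q, F (scalar_of a) q = a *: q.
Hypothesis F_Xg : forall x q, F (Xg x) q = lin x * q.
Hypothesis F_Yg : forall xi g q, invariant (group_matrix rho) g ->
  F (Yg xi) (g * q) = g * F (Yg xi) q + dir_deriv xi g * q.
Hypothesis F_Yg1 : forall xi, F (Yg xi) 1 = 0.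
Hypothesis F_T : forall w q, F (T w) q = act w q.

Definition dual_form i : form := linfun (coord b i : V -> C^o).

Definition Xpoly : {rmorphism S -> H} :=
  projT1 (cid (commuting_eval (fun i j => XgC (dual_form i) (dual_form j)))).
Definition Ypoly : {rmorphism S -> H} :=
  projT1 (cid (commuting_eval (fun i j : 'I_n => YgC b`_i b`_j))).

Lemma XpolyC a : Xpoly a%:MP = scalar_of a.
Proof. by rewrite /Xpoly; case: cid => G /= [h _]; rewrite h. Qed.
Lemma XpolyX i : Xpoly 'X_i = Xg (dual_form i).
Proof. by rewrite /Xpoly; case: cid => G /= [_ h]; rewrite h. Qed.
Lemma YpolyC a : Ypoly a%:MP = scalar_of a.
Proof. by rewrite /Ypoly; case: cid => G /= [h _]; rewrite h. Qed.
Lemma YpolyX (i : 'I_n) : Ypoly 'X_i = Yg b`_i.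
Proof. by rewrite /Ypoly; case: cid => G /= [_ h]; rewrite h. Qed.

Lemma scalar_linear_sum (U : lmodType C) (g : U -> H) :
  (forall a x x', g (a *: x + x') = scalar_of a * g x + g x') ->
  forall (c : 'I_n -> C) (v : 'I_n -> U),
  g (\sum_i c i *: v i) = \sum_i scalar_of (c i) * g (v i).
Proof.
move=> gL c v; elim: (index_enum _) => [|i r IHr].
  have := gL (-1) 0 0; rewrite !big_nil scaler0 addr0 scalar_ofN scalar_of1 mulN1r.
  by rewrite addNr.
by rewrite !big_cons gL IHr.
Qed.

Lemma Xpoly_form (x : form) : Xpoly (lin x) = Xg x.
Proof.
have {1 2}-> : x = \sum_(i < n) (x b`_i : C) *: dual_form i.
  apply/lfunP => v; rewrite sum_lfunE [in LHS](coord_basisE v) raddf_sum.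
  by apply: eq_bigr => i _; rewrite /= linearZ scale_lfunE lfunE; apply: mulrC.
rewrite (scalar_linear_sum XgL) (raddf_sum (@coordinate_form C V)) (raddf_sum Xpoly) /=.
have linZ a y : lin (a *: y) = a%:MP * lin y :> S by rewrite mul_mpolyC linearZ.
apply: eq_bigr => i _; rewrite linZ (rmorphM Xpoly) /= XpolyC; congr (_ * _).
rewrite -XpolyX; suff -> : 'X_i = lin (dual_form i) by [].
rewrite -linear_formX; congr linear_form.
by apply/rowP => j; rewrite !mxE lfunE /= coord_basis.
Qed.

Lemma YpolyE xi : Yg xi = Ypoly (\sum_i (coord b i xi)%:MP * 'X_i).
Proof.
rewrite [in LHS](coord_basisE xi) (scalar_linear_sum YgL) raddf_sum.
by apply: eq_bigr => i _; rewrite /= rmorphM /= YpolyC YpolyX.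
Qed.

Lemma T_conj w x y : T w * x * T w^-1%g = y -> T w * x = y * T w.
Proof. by move=> <-; rewrite -!mulrA TM mulVg T1 mulr1. Qed.

Lemma T_Xpoly w p : T w * Xpoly p = Xpoly (act w p) * T w.
Proof.
elim/coordinate_ind: p => [c|p q ep eq|x p ep].
- by rewrite lsubC XpolyC scalar_of_central.
- by rewrite !raddfD /= mulrDr ep eq -mulrDl -raddfD.
- rewrite !rmorphM /= act_form !Xpoly_form mulrA (T_conj (TXg w x)).
  by rewrite -!mulrA ep.
Qed.

Lemma T_Ypoly w q : exists q', T w * Ypoly q = Ypoly q' * T w.
Proof.
elim/mpoly_ring_ind: q => [c|p q [p' ep] [q' eq]|i q [q' eq]].
- by exists c%:MP; rewrite YpolyC scalar_of_central.
- by exists (p' + q'); rewrite !raddfD /= mulrDr ep eq mulrDl.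
- exists ((\sum_j (coord b j (rho w b`_i))%:MP * 'X_j) * q').
  rewrite !rmorphM /= -YpolyE YpolyX mulrA (T_conj (TYg w b`_i)).
  by rewrite -!mulrA eq.
Qed.

(** Repeated use of the bracket of xi with a form, moving each group element to the right; only this
    shape of the remainder matters for [nf_span]. *)
Lemma Yg_Xpoly xi p : exists g : W -> S,
  Yg xi * Xpoly p = Xpoly p * Yg xi + \sum_w Xpoly (g w) * T w.
Proof.
elim/coordinate_ind: p => [c|p q [g eg] [h eh]|x p [g eg]].
- exists (fun=> 0); rewrite XpolyC scalar_of_central big1 ?addr0 // => w _.
  by rewrite raddf0 mul0r.
- exists (fun w => g w + h w); rewrite raddfD /= mulrDr eg eh mulrDl addrACA.
  by rewrite -big_split; congr (_ + _); apply: eq_bigr => w _; rewrite raddfD /= mulrDl.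
- have [c ec] := YXg xi x; exists (fun w => lin x * g w + (c w)%:MP * act w p).
  rewrite rmorphM /= Xpoly_form mulrA ec mulrDl -mulrA eg mulrDr mulrA -addrA; congr (_ + _).
  rewrite mulr_sumr mulr_suml -big_split; apply: eq_bigr => w _ /=.
  rewrite raddfD /= !rmorphM /= XpolyC Xpoly_form mulrDl -!mulrA; congr (_ + _ * _).
  exact: T_Xpoly.
Qed.

Lemma Xpoly_Ypoly_ind (P : H -> Prop) z : P z ->
  (forall x y, P x -> P y -> P (x + y)) ->
  (forall a x, P x -> P (scalar_of a * x)) ->
  (forall p x, P x -> P (Xpoly p * x)) ->
  (forall i x, P x -> P (Ypoly 'X_i * x)) ->
  (forall w x, P x -> P (T w * x)) -> forall x, P (x * z).
Proof.
move=> Pz PD PZ PX PY PT; apply: Hind => // [y x Px|xi x Px].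
  by rewrite -Xpoly_form; apply: PX.
rewrite YpolyE raddf_sum mulr_suml; elim: (index_enum _) => [|i r IHr].
  by rewrite big_nil -(mul0r x) -(@scalar_of0 C H); apply: PZ.
rewrite big_cons; apply: PD IHr; rewrite /= rmorphM /= YpolyC -mulrA.
exact/PZ/PY.
Qed.

Lemma group_idempotentE w : T w * e = e.
Proof.
rewrite eE mulrA -scalar_of_central -mulrA mulr_sumr; congr (_ * _).
rewrite [RHS](reindex_inj (mulgI w)); apply: eq_bigr => t _; exact: TM.
Qed.

Lemma action_Xpoly p q : F (Xpoly p) q = p * q.
Proof.
elim/coordinate_ind: p => [c|p p' ep ep'|x p ep].
- by rewrite XpolyC F_scalar mul_mpolyC.
- by rewrite (raddfD Xpoly) (raddfD F) endoD ep ep' mulrDl.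
- by rewrite (rmorphM Xpoly) (rmorphM F) endoM ep /= Xpoly_form F_Xg mulrA.
Qed.

Lemma action_e q : F e q = average (group_matrix rho) q.
Proof.
rewrite eE (rmorphM F) endoM F_scalar (raddf_sum F) /= endo_sum.
by congr (_ *: _); apply: eq_bigr => w _; rewrite F_T.
Qed.

Lemma dir_deriv_basis (i : 'I_n) (p : S) : dir_deriv b`_i p = p^`M(i).
Proof.
rewrite /dir_deriv (bigD1 i) //= coord_basis eqxx scale1r big1 ?addr0 // => j ji.
by rewrite coord_basis eq_sym (negPf ji) scale0r.
Qed.

Variable Refl : {set W}.
Hypothesis genW : <<Refl>>%g = [set: W].
Hypothesis reflP : forall s, s \in Refl ->
  exists2 v : 'rV[C]_n, v != 0 & forall i, exists c,
    act s 'X_i - 'X_i = c *: linear_form v.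

Lemma cherednik_fractions : isomorphic_fractions (corner ee) (weyl C n).
Proof.
have [f [f_inv f_gen f_inj f_J]] :=
  chevalley (group_matrix1 rhoP) (group_matrixM rhoP) genW reflP.
have J_neq0 : \det (\matrix_(j, i) (f i)^`M(j)) != 0.
  by rewrite -det_tr; congr (\det _ != 0): f_J; apply/matrixP => i j; rewrite !mxE.
refine (corner_fractions (group_matrix1 rhoP) (group_matrixM rhoP) f_inv f_gen f_inj J_neq0
  XpolyC YpolyC group_idempotentE ee T_Xpoly T_Ypoly _ Xpoly_Ypoly_ind (F := F)
  (tau := fun i => F (Yg b`_i) : {additive S -> S}) action_Xpoly _ action_e _ _
  (wX := weyl_X C n) (wact := weyl_act C n)
  (d_ := fun i => weyl_D C n 'X_i) (@weyl_act_scalar C n) _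
  (@weyl_act_Di C n) _ _ _ (@weyl_ind C n) (@weyl_ind_r C n) (weyl_ore_domain C n)).
- by move=> i p; rewrite YpolyX; apply: Yg_Xpoly.
- by move=> i q; rewrite YpolyX.
- by move=> i; apply: F_Yg1.
- by move=> i g p ginv; rewrite /= F_Yg // dir_deriv_basis.
- exact: (weyl_act_X (@weyl_XC C n) (@weyl_act_scalar C n) (@weyl_act_Xi C n)).
- move=> G; exists (normal_form (weyl_X C n) (weyl_D C n) 1 G) => q.
  exact: (weyl_act_nf (@weyl_XC C n) (@weyl_act_scalar C n) (@weyl_act_Xi C n)
    (@weyl_act_Di C n)).
- move=> P; exact: (weyl_faithful (@weyl_XC C n) (@weyl_relDX C n) (@weyl_ind C n)
    (@weyl_act_scalar C n) (@weyl_act_Xi C n) (@weyl_act_Di C n)).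
- exact: (commutator_DX (@weyl_XC C n) (@weyl_relDX C n)).
Qed.

End CherednikGenerators.

Section ScalarSpan.
Variables (C : fieldType) (A : pzAlgType C) (W : finType) (T : W -> A).

Definition scalar_span (u : A) : Prop :=
  exists c : W -> C, u = \sum_w scalar_of (c w) * T w.

Lemma scalar_spanD u v : scalar_span u -> scalar_span v -> scalar_span (u + v).
Proof.
move=> [c ->] [d ->]; exists (fun w => c w + d w).
by rewrite -big_split; apply: eq_bigr => w _; rewrite /= -mulrDl -scalar_ofD.
Qed.

Lemma scalar_spanZ a u : scalar_span u -> scalar_span (scalar_of a * u).
Proof.
move=> [c ->]; exists (fun w => a * c w).
by rewrite mulr_sumr; apply: eq_bigr => w _; rewrite mulrA -scalar_ofM.
Qed.

Lemma scalar_span0 : scalar_span 0.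
Proof.
by exists (fun=> 0); rewrite big1 // => w _; rewrite scalar_of0 mul0r.
Qed.

Lemma scalar_span_sum I (r : seq I) (P : pred I) (G : I -> A) :
  (forall i, P i -> scalar_span (G i)) -> scalar_span (\sum_(i <- r | P i) G i).
Proof. by move=> h; elim/big_ind: _ => //; [exact: scalar_span0|exact: scalar_spanD]. Qed.

Lemma scalar_span_gen w : scalar_span (T w).
Proof.
exists (fun t => (t == w)%:R); rewrite (bigD1 w) //= eqxx scalar_of1 mul1r.
rewrite big1 ?addr0 // => t /negPf->.
by rewrite scalar_of0 mul0r.
Qed.

Lemma scalar_span_scalar w (Tw : T w = 1) a : scalar_span (scalar_of a).
Proof.
by rewrite -[scalar_of a]mulr1 -Tw; apply/scalar_spanZ/scalar_span_gen.
Qed.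

End ScalarSpan.

(** * The rational Cherednik algebra of the given reflection group *)

Section RationalCherednik.
Variables (C : numClosedFieldType) (V : vectType C) (W : finGroupType).
Variable rho : W -> 'End(V).
Hypothesis rhoP : linear_group rho.
Hypothesis genW : generated_by_reflections rho.
Variables (form : V -> V -> C) (alpha : {vspace V} -> 'Hom(V, C^o)).
Variables (vH : {vspace V} -> V) (k : {vspace V} -> nat -> nat).
Hypothesis formP : invariant_hermitian_form rho form.
Hypothesis alphaP : forall H, H \in reflection_hyperplanes rho ->
  lker (alpha H) = H /\ forall u, alpha H u = form (vH H) u.
Hypothesis kP : forall H w i, H \in reflection_hyperplanes rho ->
  (i < #|pointwise_stabilizer rho H|)%N -> k (rho w @: H)%VS i = k H i.
Local Notation n := (\dim {:V}).
Local Notation S := {mpoly C[n]}.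
Local Notation lin := coordinate_form.
Local Notation act w := (lsub (group_matrix rho w)).
Local Notation rel := (cherednik_rel rho alpha vH k).
Local Notation pi := (presented_pi rel).
Local Notation H := (cherednik rho alpha vH k).
Local Notation Xg x := (pi (cherednik_X W x)).
Local Notation Yg xi := (pi (cherednik_Y W xi)).
Local Notation T w := (pi (cherednik_T V w)).

(** With s u - u = a(u) v, the dual action changes each form by a multiple of a. This is the input
    on reflections for [chevalley]. *)
Lemma reflection_moves_line s : s \in reflections rho ->
  exists2 v : 'rV[C]_n, v != 0 & forall i, exists c,
    act s 'X_i - 'X_i = c *: linear_form v.
Proof.
move=> sR; have [a [v av]] := refl_rank1 rhoP formP alphaP sR.
have s1 : s != 1%g by have /(reflectionsP rhoP)[] := sR.
exists (\row_j a (vbasis {:V})`_j).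
  apply: contra_neq s1 => a0; apply/(linear_group_inj rhoP)/lfunP => u.
  have -> : rho s u = u + (a u : C) *: v by rewrite -av addrC subrK.
  have -> : a = 0.
    apply: coordinate_form_inj; rewrite [RHS](raddf0 (@coordinate_form C V)).
    by rewrite /coordinate_form a0 raddf0.
  by rewrite zero_lfunE scale0r addr0 (rho1 rhoP).
move=> i; have [x ->] := coordinate_formX i.
exists (- (refl_eigenvalue rho alpha vH s)^-1 * x v).
rewrite (act_refl_form rhoP (Refl := reflections rho)
  (lambda := refl_eigenvalue rho alpha vH)) //; last 2 first.
- by move=> t /(reflectionsP rhoP)[].
- by move=> t xi tR; apply: (refl_eigenvalueE rhoP formP alphaP).
rewrite -scalerA; congr (_ *: _); rewrite -[linear_form _]/(lin a) -linearZ; congr lin.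
apply/lfunP => u; rewrite refl_form_eval av scale_lfunE linearZ.
exact: mulrC.
Qed.

Local Notation in_group_span := (scalar_span (fun w => T w)).

Lemma cherednik_T1 : T 1%g = 1.
Proof. exact: (presented_pi_eq1 (cherednik_one _ _ _ _)). Qed.

Lemma group_span_bracket xi x : in_group_span (pi (cherednik_bracket rho alpha vH k xi x)).
Proof.
rewrite /cherednik_bracket presented_piD; apply: scalar_spanD.
  exact: (scalar_span_scalar (T := fun w => T w) cherednik_T1 (x xi)).
rewrite presented_pi_sum; apply: scalar_span_sum => K _.
rewrite presented_piZ; apply: scalar_spanZ.
rewrite presented_pi_sum; apply: scalar_span_sum => i _.
rewrite !presented_piZ; apply: scalar_spanZ; apply: scalar_spanZ.
rewrite presented_pi_sum; apply: scalar_span_sum => w _.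
by rewrite presented_piZ; apply/scalar_spanZ/(scalar_span_gen (fun w => T w)).
Qed.

Lemma cherednik_ind (P : H -> Prop) z : P z ->
  (forall x y, P x -> P y -> P (x + y)) ->
  (forall a x, P x -> P (scalar_of a * x)) ->
  (forall y x, P x -> P (Xg y * x)) ->
  (forall xi x, P x -> P (Yg xi * x)) ->
  (forall w x, P x -> P (T w * x)) -> forall x, P (x * z).
Proof.
move=> Pz PD PZ PX PY PT; refine (presented_ind_l Pz PD PZ _).
by move=> [[y|xi]|w] x Px; [exact: PX|exact: PY|exact: PT].
Qed.

Lemma cherednik_eE : cherednik_e rho alpha vH k = scalar_of (#|W|%:R^-1) * \sum_w T w.
Proof. by rewrite /cherednik_e presented_piZ presented_pi_sum. Qed.

(** Feeds the presentation and the Dunkl representation into [cherednik_fractions]. The two facts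
    required of the Dunkl operators are the Leibniz rule on invariant factors and the vanishing on
    constants. *)
Lemma spherical_fractions :
  isomorphic_fractions (spherical rho alpha vH k) (weyl C n).
Proof.
have [F FE] := presented_lift (cherednik_relP rhoP formP alphaP kP).
have F_X x q : F (Xg x) q = lin x * q.
  by rewrite FE (free_eval_gen _ (inl (inl x))).
have F_Y xi q : F (Yg xi) q = dunkl_endo rhoP k formP alphaP xi q.
  by rewrite FE (free_eval_gen _ (inl (inr xi))).
have F_T w q : F (T w) q = act w q.
  by rewrite FE (free_eval_gen _ (inr w)).
have F_sc a q : F (scalar_of a) q = a *: q.
  by rewrite -[scalar_of a]/(pi (monalg.mkmalgU monalg.mone a)) FE free_evalC.
refine (cherednik_fractions rhoP (H := H) (Xg := fun x => Xg x) (Yg := fun xi => Yg xi)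
  (T := fun w => T w) _ _ _ _ cherednik_T1 _ _ _ _ cherednik_ind cherednik_eE
  (cherednik_e_idem rho alpha vH k) (F := F)
  F_sc F_X _ _ F_T genW reflection_moves_line).
- move=> a x x'; exact: (presented_pi_lin (cherednik_linX _ _ _ _ a x x')).
- move=> a x x'; exact: (presented_pi_lin (cherednik_linY _ _ _ _ a x x')).
- move=> x x'; exact: (presented_pi_comm (cherednik_XX _ _ _ _ x x')).
- move=> x x'; exact: (presented_pi_comm (cherednik_YY _ _ _ _ x x')).
- move=> w w'; exact: (presented_pi_mul (cherednik_mul _ _ _ _ w w')).
- move=> w x; exact: (presented_pi_mul3 (cherednik_TX _ _ _ _ w x)).
- move=> w x; exact: (presented_pi_mul3 (cherednik_TY _ _ _ _ w x)).
- move=> xi x; have [c ec] := group_span_bracket xi x; exists c; rewrite -ec.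
  exact: (presented_pi_commutator (cherednik_YX _ _ _ _ xi x)).
- move=> xi g q ginv; rewrite !F_Y; apply: dunklM => s _; exact: ginv.
- by move=> xi; rewrite F_Y -mpolyC1; apply: dunklC.
Qed.

End RationalCherednik.

Theorem theorem5 (R : realType) (n : nat) (V : vectType R[i])
    (W : finGroupType) (rho : W -> 'End(V)) (form : V -> V -> R[i])
    (alpha : {vspace V} -> 'Hom(V, R[i]^o)) (vH : {vspace V} -> V)
    (k : {vspace V} -> nat -> nat) :
  \dim {:V} = n ->
  linear_group rho ->
  generated_by_reflections rho ->
  invariant_hermitian_form rho form ->
  (forall H, H \in reflection_hyperplanes rho ->
     lker (alpha H) = H /\ forall u, alpha H u = form (vH H) u) ->
  (forall H w i, H \in reflection_hyperplanes rho ->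
     (i < #|pointwise_stabilizer rho H|)%N -> k (rho w @: H)%VS i = k H i) ->
  isomorphic_fractions (spherical rho alpha vH k) (weyl R[i] n).
Proof.
move=> <- rhoP genW formP alphaP kP.
exact: (spherical_fractions rhoP genW formP alphaP kP).
Qed.
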